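(* Let $P_n(z)=\sum_{k=0}^{n}\xi_k z^k$, where $\xi_0,\xi_1,\ldots$ are iid standard complex Gaussian random variables, and let $\mu$ denote the uniform probability measure on the unit circle of $\mathbb{C}$ (which is the limit in probability of the empirical root measure of $P_n$). For any fixed $t\in(0,1)$, the empirical root distribution of the $\lceil tn\rceil$-th derivative of the polynomial $x\mapsto P_n((1-t)^2x)$ converges weakly in probability, as $n\to\infty$, to $\mathrm{sq}\big((\mathrm{sq}^{-1}\mu)^{\oplus 1/(1-t)}\big)$.
   Context: The empirical root distribution of a polynomial of degree $d$ with roots $x_1,\dots,x_d$ (with multiplicity) is $\frac1d\sum_i\delta_{x_i}$. For a rotationally invariant measure $\nu$ on $\mathbb{C}$, $\mathrm{sq}\,\nu$ is the measure with $(\mathrm{sq}\,\nu)(\mathbb{D}_r)=\nu(\mathbb{D}_{\sqrt r})$ for $r>0$, where $\mathbb{D}_r=\{z:|z|<r\}$; its inverse is $(\mathrm{sq}^{-1}\nu)(\mathbb{D}_r)=\nu(\mathbb{D}_{r^2})$. Free probability setting: $(\mathscr{M},\tau)$ is a von Neumann algebra with a faithful normal tracial state. An element $u$ is a Haar unitary if $u^*u=uu^*=1$ and $\tau(u^n)=0$ for all $n\ge1$. An element $a$ is $R$-diagonal if it has the same $*$-distribution as $uh$ with $u$ Haar unitary, $h\ge0$, and $u,h$ $*$-free. The Brown measure $\mu_a$ of $a$ is $\frac{1}{2\pi}\nabla^2_\lambda \log\Delta(a-\lambda1)$ (distributional Laplacian), $\Delta$ the Fuglede–Kadison determinant. For a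 probability measure $\nu$ on $[0,\infty)$ other than $\delta_0$, let $M_\nu(z)=\int \frac{zt}{1-zt}d\nu(t)$ and define the $S$-transform $\mathscr{S}_\nu(z)=\frac{1+z}{z}M_\nu^{\langle-1\rangle}(z)$ near $0$ (inverse under composition), analytically continued to $(-1+\nu(\{0\}),0)$; for positive $b$ write $\mathscr{S}_b=\mathscr{S}_{\mu_b}$. For an $R$-diagonal $a$ and real $k>1$ put $\mathscr{S}_k(z)=\frac{1+z/k}{k(1+z)}\mathscr{S}_{aa^*}(z/k)$ and $\lambda_2=(\int x^2d\mu_{|a|}(x))^{1/2}$; then $\mu_a^{\oplus k}$ is the radially symmetric probability measure with $\mu_a^{\oplus k}(\overline{\mathbb{D}_r})=1+\mathscr{S}_k^{\langle-1\rangle}(r^{-2})$ for $0<r<\sqrt k\lambda_2$ and $=1$ for $r\ge\sqrt k\lambda_2$. Here $\mathrm{sq}^{-1}\mu=\mu$ is the Brown measure of a Haar unitary, and $(\mathrm{sq}^{-1}\mu)^{\oplus k}$ is defined by taking $a$ to be a Haar unitary. *)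

(* Defs.v *)
From HB Require Import structures.
From mathcomp Require Import all_boot all_order all_algebra.
From mathcomp Require Import complex.
From mathcomp Require Import all_classical all_reals all_analysis.

Set Implicit Arguments.
Unset Strict Implicit.
Unset Printing Implicit Defensive.

Import Order.TTheory GRing.Theory Num.Theory.
Import numFieldTopology.Exports numFieldNormedType.Exports.
Local Open Scope classical_set_scope.
Local Open Scope ring_scope.

(* The complex plane is identified with R * R (x + iy <-> (x, y)) whenever    *)
(* measures / test functions on C are needed; polynomial roots live in R[i]. *)

Section Plane.
Variable R : realType.

Definition to_plane (z : R[i]) : R * R := (complex.Re z, complex.Im z).

Definition open_disk (r : R) : set (R * R) :=
  [set p | p.1 ^+ 2 + p.2 ^+ 2 < r ^+ 2].
Definition closed_disk (r : R) : set (R * R) :=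
  [set p | p.1 ^+ 2 + p.2 ^+ 2 <= r ^+ 2].

Definition rot (theta : R) (p : R * R) : R * R :=
  (cos theta * p.1 - sin theta * p.2, sin theta * p.1 + cos theta * p.2).

Definition rot_invariant (nu : probability (R * R)%type R) : Prop :=
  forall theta (A : set (R * R)), measurable A -> nu (rot theta @^-1` A) = nu A.

Definition is_sq (nu' nu : probability (R * R)%type R) : Prop :=
  rot_invariant nu' /\
  forall r : R, 0 < r -> nu' (open_disk r) = nu (open_disk (Num.sqrt r)).

(* M_nu(z) = int z t / (1 - z t) dnu(t) ; we use it for real z < 0.           *)
Definition Mtrans (nu : probability R R) (z : R) : R :=
  Rintegral nu setT (fun t => z * t / (1 - z * t)).

(* M_nu^{<-1>}(w): the (unique) negative real y with M_nu(y) = w.            *)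
Definition Minv (nu : probability R R) (w : R) : R :=
  xget 0 [set y | y < 0 /\ Mtrans nu y = w].

(* S_nu(z) = (1+z)/z * M_nu^{<-1>}(z), for z in (-1 + nu{0}, 0)              *)
Definition Strans (nu : probability R R) (z : R) : R :=
  (1 + z) / z * Minv nu z.

(* ------------- the measure mu_a^{(+)k} for an R-diagonal a ----------------- *)
(* nu_aa = mu_{aa*},  nu_abs = mu_{|a|}                                       *)
Definition Sk (nu_aa : probability R R) (k z : R) : R :=
  (1 + z / k) / (k * (1 + z)) * Strans nu_aa (z / k).

(* S_k^{<-1>}(w): the z in the domain (-k(1 - nu_aa{0}), 0) of S_k with S_k(z)=w *)
Definition Sk_inv (nu_aa : probability R R) (k w : R) : R :=
  xget 0 [set z | - k * (1 - fine (nu_aa [set 0])) < z < 0 /\ Sk nu_aa k z = w].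

Definition lambda2 (nu_abs : probability R R) : R :=
  Num.sqrt (Rintegral nu_abs setT (fun x => x ^+ 2)).

Definition oplus_cdf (nu_aa nu_abs : probability R R) (k r : R) : R :=
  if r < Num.sqrt k * lambda2 nu_abs then 1 + Sk_inv nu_aa k (r ^- 2) else 1.

Definition is_oplus (nu_aa nu_abs : probability R R) (k : R)
    (rho : probability (R * R)%type R) : Prop :=
  rot_invariant rho /\
  forall r : R, 0 < r -> rho (closed_disk r) = (oplus_cdf nu_aa nu_abs k r)%:E.

(* For a Haar unitary u: u u^* = 1 and |u| = 1, so mu_{uu^*} = mu_{|u|} = delta_1. *)
Definition haar_aa : probability R R := \d_(1 : R).
Definition haar_abs : probability R R := \d_(1 : R).

(* rho = (sq^{-1} mu)^{(+)k}  (a Haar unitary),  nu = sq rho *)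
Definition limit_measures (k : R) (rho nu : probability (R * R)%type R) : Prop :=
  is_oplus haar_aa haar_abs k rho /\ is_sq nu rho.

End Plane.

Section Roots.
Variable R : realType.

(* the roots (with multiplicity) of p : for p <> 0,
   p = lead_coef p *: \prod_(z <- root_seq p) ('X - z%:P) *)
Definition root_seq (p : {poly R[i]}) : seq R[i] :=
  sval (closed_field_poly_normal p).

Definition emp_root_int (p : {poly R[i]}) (f : R * R -> R) : R :=
  (size (root_seq p))%:R^-1 * \sum_(z <- root_seq p) f (to_plane z).

End Roots.

Section Random.
Context {R : realType} {d : measure_display} {T : measurableType d}.
Variable P : probability T R.

Definition mutually_independent (Z : nat -> T -> R) : Prop :=
  forall (J : seq nat) (B : nat -> set R), uniq J ->
    (forall i, measurable (B i)) ->
    P (\bigcap_(i in [set i | i \in J]) (Z i @^-1` B i)) =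
    (\prod_(i <- J) P (Z i @^-1` B i))%E.

Definition xi (Z : nat -> T -> R) (k : nat) (w : T) : R[i] :=
  Complex (Z k.*2 w) (Z k.*2.+1 w).

Definition Pn (Z : nat -> T -> R) (n : nat) (w : T) : {poly R[i]} :=
  \sum_(k < n.+1) (xi Z k w)%:P * 'X^k.

(* weak convergence in probability of random measures (given through their
   integrals against test functions) to a deterministic measure nu on C:
   for every bounded continuous f and eps > 0,
   P( |int f dmu_n - int f dnu| > eps ) -> 0   (outer probability). *)
Definition weak_cvg_in_prob (mu_int : nat -> T -> (R * R -> R) -> R)
    (nu : probability (R * R)%type R) : Prop :=
  forall f : R * R -> R, continuous f -> (exists M : R, forall x, `|f x| <= M) ->
  forall eps : R, 0 < eps ->
  exists A : nat -> set T,
    (forall n, measurable (A n) /\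
       [set w | eps < `|mu_int n w f - Rintegral nu setT f|] `<=` A n) /\
    (fun n => P (A n)) @ \oo --> 0%E.

End Random.

(* Main.v *)
Require Import Defs.
From HB Require Import structures.
From mathcomp Require Import all_boot all_order all_algebra.
From mathcomp Require Import complex.
From mathcomp Require Import all_classical all_reals all_analysis.
From mathcomp Require Import measurable_realfun separable cyclotomic.
From mathcomp Require Import ring lra.
Set Implicit Arguments.
Unset Strict Implicit.
Unset Printing Implicit Defensive.

Import Order.TTheory GRing.Theory Num.Theory.
Import numFieldTopology.Exports numFieldNormedType.Exports.
Local Open Scope classical_set_scope.
Local Open Scope ring_scope.

(**
The derivative is [Q_n = \sum_k a_k xi_(k+m) X^k] with explicit positive weights
[a_k]. With high probability its Gaussian coefficients are polynomially bounded
and, by anticoncentration of a single Gaussian coordinate, [|Q_n|] is not much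
smaller than the maximal term [M(|x|) = max_k a_k |x|^k] at polynomially many
prescribed nodes [x = a (c + r w)], [w] a [2^p]-th root of unity. A discrete Jensen
formula on these nodes then determines the mean over the roots [z] of
[ln max(r, |z - a c|)] up to [o(1)], independently of the unit complex number [a]
and of the angles of the coefficients.

For [c = 0] the logarithmic derivative of [M] is the index of its maximal term,
which gives the limit of the proportion of roots in every disk centered at 0. For
[c <> 0], differences of two such functions are bumps around [c]; their means are
asymptotically invariant under rotation, hence close to the means of nearly
radial functions, so bumps too are tested correctly in the limit. A greedy
approximation by sums of bumps reaches every continuous function with compact
support.

For a Haar unitary the S-transform is constant 1, so the limit law gives mass
[t (1 - t) r / (1 - (1 - t)^2 r)] to the disk of radius [r < 1 / (1 - t)].
*)

(** Three scales have to fit together. The weights are controlled only up to an exponential factor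
    [H ^+ n], so a root can be kept away from a node only by an exponentially small distance. The
    logarithm of that distance is of order n, and the discrete Jensen formula divides it by the
    number of nodes: about n^2 nodes leave an error O(1/n), uniform over the roots. A union bound
    over n^2 nodes asks for anticoncentration with failure probability o(n^-2) at each node; the
    threshold (n+1)^-4 gives this and costs only 4 ln(n+1) in ln |Q_n|, negligible after division by
    the degree. Rotation invariance of the Gaussian law would only give invariance in distribution
    of the root measure. What is needed is invariance in probability, and it comes from the
    approximation by the maximal term, which depends on |x| alone. The function ln max(r, |z - c|)
    is a circular mean of logarithms, so finite sums replace the distributional Laplacian. The
    leading coefficient of Q_n adds a term that is never estimated: it cancels in each difference
    that is used. *)

Section ComplexModulus.
Variable R : realType.
Implicit Types (x y z w : R[i]).

Definition cmod z : R := ComplexField.Normc.normc z.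

Arguments cmod : simpl never.

Lemma cmodE z : cmod z = Num.sqrt (complex.Re z ^+ 2 + complex.Im z ^+ 2).
Proof. by case: z. Qed.

Lemma cmod_ge0 z : 0 <= cmod z.
Proof. by rewrite cmodE sqrtr_ge0. Qed.

Lemma cmod_sqr z : cmod z ^+ 2 = complex.Re z ^+ 2 + complex.Im z ^+ 2.
Proof. by rewrite cmodE sqr_sqrtr// addr_ge0 ?sqr_ge0. Qed.

Lemma cmod0 : cmod 0 = 0. Proof. exact: ComplexField.Normc.normc0. Qed.

Lemma cmod1 : cmod 1 = 1. Proof. exact: ComplexField.Normc.normc1. Qed.

Lemma cmodM x y : cmod (x * y) = cmod x * cmod y.
Proof. exact: ComplexField.Normc.normcM. Qed.

Lemma cmodV x : cmod x^-1 = (cmod x)^-1.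
Proof. exact: ComplexField.Normc.normcV. Qed.

Lemma cmodN x : cmod (- x) = cmod x. Proof. exact: normcN. Qed.

Lemma cmodD_le x y : cmod (x + y) <= cmod x + cmod y.
Proof. exact: le_normcD. Qed.

Lemma cmod_eq0 z : (cmod z == 0) = (z == 0).
Proof.
apply/eqP/eqP => [|->]; last exact: cmod0.
exact: ComplexField.Normc.eq0_normc.
Qed.

Lemma cmod_gt0 z : (0 < cmod z) = (z != 0).
Proof. by rewrite lt_def cmod_ge0 andbT cmod_eq0. Qed.

Lemma cmodC x y : cmod (x - y) = cmod (y - x).
Proof. by rewrite -cmodN opprB. Qed.

Lemma cmodX z n : cmod (z ^+ n) = cmod z ^+ n.
Proof.
by elim: n => [|n IH]; rewrite ?expr0 ?cmod1// !exprS cmodM IH.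
Qed.

Lemma cmod_real (a : R) : cmod (complex.real_complex R a) = `|a|.
Proof. by rewrite cmodE/= expr0n addr0 sqrtr_sqr. Qed.

Lemma cmodB_ge x y : cmod x - cmod y <= cmod (x - y).
Proof. by rewrite lerBlDr -{1}(subrK y x) cmodD_le. Qed.

Lemma cmod_dist x y : `|cmod x - cmod y| <= cmod (x - y).
Proof. by rewrite ler_norml lerNl opprB cmodB_ge cmodC cmodB_ge. Qed.

Lemma cmod_sum (I : Type) (r : seq I) (F : I -> R[i]) :
  cmod (\sum_(i <- r) F i) <= \sum_(i <- r) cmod (F i).
Proof.
elim: r => [|i r IH]; first by rewrite !big_nil cmod0.
by rewrite !big_cons (le_trans (cmodD_le _ _))// lerD2l.
Qed.

Lemma cmod_prod (I : Type) (r : seq I) (F : I -> R[i]) :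
  cmod (\prod_(i <- r) F i) = \prod_(i <- r) cmod (F i).
Proof.
elim: r => [|i r IH]; first by rewrite !big_nil cmod1.
by rewrite !big_cons cmodM IH.
Qed.

Lemma cmod_parallelogram x y :
  cmod (x + y) ^+ 2 + cmod (x - y) ^+ 2 = 2 * (cmod x ^+ 2 + cmod y ^+ 2).
Proof. by case: x => a b; case: y => c d; rewrite !cmod_sqr/=; ring. Qed.

Lemma Re_le_cmod z : `|complex.Re z| <= cmod z.
Proof.
by rewrite cmodE -sqrtr_sqr ler_wsqrtr// lerDl sqr_ge0.
Qed.

Lemma Im_le_cmod z : `|complex.Im z| <= cmod z.
Proof.
by rewrite cmodE -sqrtr_sqr ler_wsqrtr// lerDr sqr_ge0.
Qed.

Lemma cmod_le z : cmod z <= `|complex.Re z| + `|complex.Im z|.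
Proof.
rewrite -(@ler_pXn2r _ 2) ?nnegrE ?cmod_ge0 ?addr_ge0//.
rewrite cmod_sqr sqrrD !real_normK ?num_real//.
by rewrite lerD2r lerDl mulrn_wge0// mulr_ge0.
Qed.

(** * Roots of unity and the discrete Jensen formula for one root *)

Lemma cmod_unity w n : (0 < n)%N -> w ^+ n = 1 -> cmod w = 1.
Proof.
move=> n0 wn; have /eqP := congr1 cmod wn.
by rewrite cmodX cmod1 pexpr_eq1 ?cmod_ge0// => /eqP.
Qed.

(* Of the two square roots of w, the one farther from y is at distance at least
   1, so the nearer one loses nothing when a square is taken. *)
Lemma near_sqrt_unity y w : cmod w = 1 ->
  exists2 a : R[i], a ^+ 2 = w /\ cmod a = 1 &
    cmod (y - a) * cmod (y + a) = cmod (y ^+ 2 - w) /\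
    cmod (y - a) <= cmod (y + a).
Proof.
move=> w1; set b := sqrtc w.
have b2 : b ^+ 2 = w by exact: sqr_sqrtc.
have b1 : cmod b = 1.
  have : cmod b ^+ 2 == 1 by rewrite -cmodX b2 w1.
  by rewrite sqrp_eq1 ?cmod_ge0// => /eqP.
have fac (a : R[i]) : a ^+ 2 = w ->
    cmod (y - a) * cmod (y + a) = cmod (y ^+ 2 - w).
  by move=> <-; rewrite -cmodM subr_sqr.
have [le_ba|lt_ba] := lerP (cmod (y - b)) (cmod (y + b)).
  by exists b => //; rewrite fac.
exists (- b); first by rewrite sqrrN cmodN.
split; first by rewrite fac// sqrrN.
by rewrite opprK ltW.
Qed.

(** Induction through [y ^+ 2], which is why the orders of the nodes are powers of 2. Read
    backwards, it bounds [y ^+ (2 ^ p) - 1] from below by the distance from [y] to the nodes. *)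
Lemma near_unity_root p y :
  exists2 w : R[i], w ^+ (2 ^ p) = 1 & cmod (y - w) <= cmod (y ^+ (2 ^ p) - 1).
Proof.
elim: p y => [|p IH] y; first by exists 1; rewrite ?expr1n// expn0 expr1.
have [v v1 lev] := IH (y ^+ 2).
have cv : cmod v = 1 by apply: cmod_unity v1; rewrite expn_gt0.
have [a [a2 a1] [fac le_a]] := near_sqrt_unity y cv.
exists a; first by rewrite expnS exprM a2.
rewrite expnS exprM (le_trans _ lev)// -fac ler_peMr ?cmod_ge0//.
have : cmod (a + a) <= cmod (y + a) + cmod (y - a).
  rewrite -[X in cmod X](_ : (y + a) - (y - a) = a + a); last by ring.
  by rewrite (le_trans (cmodD_le _ _))// cmodN.
rewrite -mulr2n -mulr_natl cmodM a1 mulr1.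
have -> : cmod (2 : R[i]) = 2.
  by rewrite -(rmorph_nat (complex.real_complex R)) cmod_real ger0_norm.
lra.
Qed.

(** By the parallelogram law the farther square root is at squared distance at least 2 from [y], so
    each doubling of the order halves the squared distance. The resulting rate 2^(-p/2) is not
    optimal but suffices for averaging. *)
Lemma unity_root_dense p y : cmod y = 1 ->
  exists2 w : R[i], w ^+ (2 ^ p) = 1 & cmod (y - w) ^+ 2 * 2 ^+ p <= 4.
Proof.
elim: p y => [|p IH] y y1.
  exists 1; rewrite ?expr1n// expr0 mulr1.
  have : cmod (y - 1) <= 2.
    by rewrite (le_trans (cmodD_le _ _))// cmodN cmod1 y1.
  have := cmod_ge0 (y - 1); nra.
have [|v v1 lev] := IH (y ^+ 2); first by rewrite cmodX y1 expr1n.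
have cv : cmod v = 1 by apply: cmod_unity v1; rewrite expn_gt0.
have [a [a2 a1] [fac le_a]] := near_sqrt_unity y cv.
exists a; first by rewrite expnS exprM a2.
apply: le_trans lev; rewrite [2 ^+ p.+1]exprS mulrA ler_pM2r ?exprn_gt0//.
have := cmod_parallelogram y a; rewrite y1 a1 -fac.
have := cmod_ge0 (y - a); move: (cmod _) (cmod _) le_a => u v'.
move=> uv v0 e; rewrite exprMn; apply: ler_wpM2l; first exact: sqr_ge0.
nra.
Qed.

Definition unity_roots (n : nat) : seq R[i] := root_seq ('X^n - 1).

Lemma unity_roots_prod n : (0 < n)%N ->
  'X^n - 1 = \prod_(w <- unity_roots n) ('X - w%:P) :> {poly R[i]}.
Proof.
move=> n0; rewrite /unity_roots /root_seq; case: closed_field_poly_normal => /= r.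
by rewrite (monicP (monic_Xn_sub_1 _ n0)) scale1r.
Qed.

Lemma size_unity_roots n : (0 < n)%N -> size (unity_roots n) = n.
Proof.
move=> n0; apply/succn_inj; rewrite -(size_prod_XsubC _ id).
by rewrite -unity_roots_prod// -polyC1 size_XnsubC.
Qed.

Lemma mem_unity_roots n w : (0 < n)%N -> (w \in unity_roots n) = (w ^+ n == 1).
Proof.
move=> n0; rewrite -root_prod_XsubC -unity_roots_prod//.
by rewrite rootE !hornerE subr_eq0.
Qed.

Lemma uniq_unity_roots n : (0 < n)%N -> uniq (unity_roots n).
Proof.
move=> n0; rewrite -separable_prod_XsubC -unity_roots_prod//.
by rewrite separable_Xn_sub_1// pnatr_eq0 -lt0n.
Qed.

Lemma perm_unity_roots n a : (0 < n)%N -> a ^+ n = 1 ->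
  perm_eq [seq a * w | w <- unity_roots n] (unity_roots n).
Proof.
move=> n0 an; have a0 : a != 0.
  by apply: contra_eq_neq an => ->; rewrite expr0n gtn_eqF// eq_sym oner_eq0.
have u : uniq [seq a * w | w <- unity_roots n].
  by rewrite map_inj_uniq ?uniq_unity_roots//; exact: mulfI.
apply: uniq_perm => //; first exact: uniq_unity_roots.
have sub : {subset [seq a * w | w <- unity_roots n] <= unity_roots n}.
  move=> _ /mapP[w + ->]; rewrite !mem_unity_roots// => /eqP wn.
  by rewrite exprMn an wn mulr1.
by have [] := uniq_min_size u sub; rewrite ?size_map.
Qed.

(** The homogeneous form of the factorization of ['X^n - 1]; it turns a sum of logarithms over the
    nodes of a circle into a single logarithm. *)
Lemma prod_unity_roots n (a b : R[i]) : (0 < n)%N ->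
  \prod_(w <- unity_roots n) (a - b * w) = a ^+ n - b ^+ n.
Proof.
move=> n0; have [->|b0] := eqVneq b 0.
  rewrite expr0n gtn_eqF// subr0.
  under eq_bigr do rewrite mul0r subr0.
  by rewrite big_const_seq count_predT size_unity_roots// iter_mulr_1.
transitivity (b ^+ n * (('X^n - 1).[a / b])); last first.
  by rewrite !hornerE exprMn exprVn; field; rewrite expf_neq0.
rewrite unity_roots_prod// horner_prod -{2}(size_unity_roots n0).
rewrite -(count_predT (unity_roots n)) -iter_mulr_1 -big_const_seq -big_split/=.
by apply: eq_bigr => w _; rewrite !hornerE; field.
Qed.

Lemma ln_prod (I : eqType) (s : seq I) (F : I -> R) :
  {in s, forall i, 0 < F i} -> ln (\prod_(i <- s) F i) = \sum_(i <- s) ln (F i).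
Proof.
elim: s => [|i s IH] F0; first by rewrite !big_nil ln1.
rewrite !big_cons lnM ?posrE ?F0 ?mem_head//; last first.
  rewrite big_seq; apply: prodr_gt0 => j js.
  by apply: F0; rewrite inE js orbT.
by rewrite IH// => j js; apply: F0; rewrite inE js orbT.
Qed.

(* The discrete form of Jensen's formula at a single root y; e only has to keep
   y away from the nodes, since its logarithm is divided by 2 ^ p. *)
Lemma jensen_kernel p (r e : R) y : 0 < r -> 0 < e ->
  (forall w, w ^+ (2 ^ p) = 1 ->
     e <= cmod (y - complex.real_complex R r * w)) ->
  `|ln (Num.max r (cmod y)) - ((2 ^ p)%:R)^-1 *
    \sum_(w <- unity_roots (2 ^ p)) ln (cmod (y - complex.real_complex R r * w))|
  <= (ln 2 + `|ln (e / r)|) / (2 ^ p)%:R.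
Proof.
move=> r0 e0 far; set N := (2 ^ p)%N; set rc := complex.real_complex R r.
have N0 : (0 < N)%N by rewrite expn_gt0.
have NR0 : 0 < N%:R :> R by rewrite ltr0n.
have rc0 : rc != 0 by rewrite -cmod_eq0 cmod_real normr_eq0 gt_eqF.
have crc : cmod rc = r by rewrite cmod_real gtr0_norm.
have -> : \sum_(w <- unity_roots N) ln (cmod (y - rc * w)) =
    ln (cmod (y ^+ N - rc ^+ N)).
  rewrite -prod_unity_roots// cmod_prod ln_prod// => w.
  by rewrite mem_unity_roots// => /eqP/far; exact: lt_le_trans.
set u := y / rc.
have yu : y = rc * u by rewrite /u mulrC divfK.
have cy : cmod y = r * cmod u by rewrite yu cmodM crc.
have eu : e / r <= cmod (u ^+ N - 1).
  have [w w1 lew] := near_unity_root p u.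
  apply: le_trans lew; rewrite ler_pdivrMr// (le_trans (far _ w1))//.
  by rewrite yu -mulrBr cmodM crc mulrC.
have er0 : 0 < e / r by rewrite divr_gt0.
have cu0 : 0 < cmod (u ^+ N - 1) by exact: lt_le_trans eu.
have -> : y ^+ N - rc ^+ N = rc ^+ N * (u ^+ N - 1).
  by rewrite yu exprMn mulrBr mulr1.
rewrite cmodM cmodX crc lnM ?posrE ?exprn_gt0//.
rewrite lnXn// -[ln r *+ _]mulr_natl mulrDr mulrA mulVf ?gt_eqF// mul1r.
have -> : Num.max r (cmod y) = r * Num.max 1 (cmod u).
  by rewrite cy maxr_pMr ?mulr1// ltW.
have m1 : 1 <= Num.max 1 (cmod u) by rewrite le_max lexx.
have m0 : 0 < Num.max 1 (cmod u) by exact: lt_le_trans m1.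
rewrite lnM ?posrE// opprD addrACA subrr add0r.
set m := Num.max 1 (cmod u) in m1 m0 *.
have -> : ln m - N%:R^-1 * ln (cmod (u ^+ N - 1)) =
  (ln (m ^+ N) - ln (cmod (u ^+ N - 1))) / N%:R.
  by rewrite lnXn// -[ln m *+ _]mulr_natl; field; rewrite pnatr_eq0 -lt0n.
rewrite normrM normfV (@gtr0_norm _ N%:R)//.
rewrite ler_pM2r ?invr_gt0//.
have mN : 1 <= m ^+ N by rewrite exprn_ege1.
have mN0 : 0 < m ^+ N by exact: lt_le_trans mN.
have le_ln2 : 0 <= ln 2 :> R by rewrite ln_ge0// ler1n.
have lelr := normr_ge0 (ln (e / r)).
rewrite ler_norml; apply/andP; split.
  have : ln (cmod (u ^+ N - 1)) <= ln 2 + ln (m ^+ N).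
    rewrite -lnM ?posrE// ler_ln ?posrE ?mulr_gt0//.
    rewrite (le_trans (cmodD_le _ _))// cmodN cmod1 cmodX.
    have : cmod u ^+ N <= m ^+ N.
      by rewrite lerXn2r ?nnegrE ?cmod_ge0 ?(ltW m0)// /m le_max lexx orbT.
    lra.
  lra.
(* If |u|^N >= 2, subtracting 1 at most halves the modulus of u^N. Otherwise [m ^+ N] is at most 2,
   and it is [eu], the distance to the nodes, that bounds the other logarithm. *)
have [h|h] := lerP 2 (cmod u ^+ N).
  have mu : m = cmod u.
    rewrite /m max_r// leNgt; apply/negP => u1.
    have : cmod u ^+ N <= 1 by rewrite exprn_ile1 ?cmod_ge0 ?ltW.
    lra.
  have : ln (m ^+ N) <= ln 2 + ln (cmod (u ^+ N - 1)).
    rewrite -lnM ?posrE// ler_ln ?posrE ?mulr_gt0// mu -cmodX.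
    have := cmodB_ge (u ^+ N) 1; rewrite cmod1 -cmodX in h *; lra.
  lra.
have : ln (m ^+ N) <= ln 2.
  rewrite ler_ln ?posrE// /m; case: (lerP 1 (cmod u)) => _; last by rewrite expr1n ler1n.
  exact: ltW.
have : ln (e / r) <= ln (cmod (u ^+ N - 1)) by rewrite ler_ln.
have := ler_norm (- ln (e / r)); rewrite normrN; lra.
Qed.

End ComplexModulus.
Arguments cmod {R} z : simpl never.

(** * Events of high probability as a filter *)

Section WithHighProbability.
Context {R : realType} {d : measure_display} {T : measurableType d}.
Variable P : probability T R.

(* Convergence along this filter is convergence in (outer) probability. *)
Definition whp : set_system (nat * T) := [set S | exists A : nat -> set T,
  (forall n, measurable (A n) /\ [set w | ~ S (n, w)] `<=` A n) /\
  (fun n => P (A n)) @ \oo --> 0%E].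

(** Through this instance [near] performs the intersections of high-probability events, and the
    limit laws for sums and products apply to convergence in probability. *)
#[global] Instance whp_filter : Filter whp.
Proof.
split.
- exists (fun=> set0); split; last by rewrite measure0; exact: cvg_cst.
  by move=> n; split => // w /=; case.
- move=> S S' [A [mA A0]] [A' [mA' A0']].
  exists (fun n => A n `|` A' n); split.
    move=> n; split; first by apply: measurableU; [exact: (mA n).1|exact: (mA' n).1].
    move=> w /=; rewrite not_andP => -[nS|nS].
      by left; exact: (mA n).2.
    by right; exact: (mA' n).2.
  apply: (@squeeze_cvge _ _ _ _ (fun=> 0%E) _ (fun n => P (A n) + P (A' n))%E).
  + by apply: nearW => n; rewrite measure_ge0 measureU2//; [exact: (mA n).1|exact: (mA' n).1].
  + exact: cvg_cst.
  + by rewrite -(adde0 (0%E : \bar R)); apply: cvgeD.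
- move=> S S' SS' [A [mA A0]]; exists A; split => // n.
  split; first exact: (mA n).1.
  by move=> w /= nS'; apply: (mA n).2 => /= /SS'.
Qed.

Lemma whp_eventually (S : set (nat * T)) :
  (\forall n \near \oo, forall w, S (n, w)) -> whp S.
Proof.
(* The slices of [S] need not be measurable, so the exceptional set is the whole space at each [n]
   where [S] fails somewhere. *)
move=> hS; exists (fun n => if `[< forall w, S (n, w) >] then set0 else setT).
split.
  move=> n; case: asboolP => h; split => //; first by move=> w /=; apply.
apply: cvg_near_cst; near=> n; rewrite (_ : `[< _ >] = true) ?measure0//.
by apply/asboolP; near: n.
Unshelve. all: by end_near.
Qed.

Lemma whp_le_cvg (A : nat -> set T) (u : nat -> R) :
  (forall n, measurable (A n)) -> (forall n, (P (A n) <= (u n)%:E)%E) ->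
  u @ \oo --> (0 : R) -> whp [set p | ~ A p.1 p.2].
Proof.
move=> mA Au u0; exists A; split.
  by move=> n; split => // w /=; rewrite notK.
apply: (@squeeze_cvge _ _ _ _ (fun=> 0%E) _ (fun n => (u n)%:E)%E).
+ by apply: nearW => n; rewrite measure_ge0 Au.
+ exact: cvg_cst.
+ by apply/fine_cvgP; split => //; exact: nearW.
Qed.

Lemma cvg_whp_fst : (@fst nat T) @ whp --> \oo.
Proof.
move=> S hS; apply: whp_eventually; near=> n => w /=.
by near: n; apply: hS.
Unshelve. all: by end_near.
Qed.

Lemma cvg_whp_cst (u : nat -> R) (l : R) :
  u @ \oo --> l -> (fun p : nat * T => u p.1) @ whp --> l.
Proof. by move=> ul; exact: (cvg_comp _ _ cvg_whp_fst ul). Qed.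

End WithHighProbability.

(** * Independence and anticoncentration of linear combinations *)

Section Anticoncentration.
Context {R : realType} {d : measure_display} {T : measurableType d}.
Variables (P : probability T R) (Z : nat -> {RV P >-> R}).
Hypothesis indZ : mutually_independent P (fun n => (Z n : T -> R)).

Let rect (J : seq nat) (B : nat -> set R) : set T :=
  \bigcap_(i in [set i | i \in J]) (Z i @^-1` B i).

Let measurable_rect J B : (forall i, measurable (B i)) -> measurable (rect J B).
Proof.
move=> mB; apply: bigcap_measurableType => // i _.
by rewrite -[X in measurable X]setTI; exact: measurable_funP.
Qed.

(** Two finite measures, A |-> P(A and D) and A |-> P(A) P(D), agree on the rectangles in the
    coordinates [J]. These form a pi-system, and the linear combination is measurable for the
    sigma-algebra it generates. *)
Lemma indep_lincomb (i0 : nat) (J : seq nat) (a : nat -> R) (B C : set R) :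
  i0 \notin J -> uniq J -> measurable B -> measurable C ->
  P ((fun w => \sum_(i <- J) a i * Z i w) @^-1` C `&` Z i0 @^-1` B) =
  (P ((fun w => (\sum_(i <- J) a i * Z i w)%R) @^-1` C) * P (Z i0 @^-1` B))%E.
Proof.
move=> i0J uJ mB mC; set Y := fun w => _.
pose G : set (set T) := [set A | exists2 B : nat -> set R,
  (forall i, measurable (B i)) & A = rect J B].
have mD : measurable (Z i0 @^-1` B).
  by rewrite -[X in measurable X]setTI; exact: measurable_funP.
set D := Z i0 @^-1` B in mD *.
have finD : P D \is a fin_num by exact: fin_num_measure.
have D0 : 0 <= fine (P D) by rewrite fine_ge0.
pose m1 : {measure set T -> \bar R} := mrestr P mD.
pose m2 : {measure set T -> \bar R} := mscale (NngNum D0) P.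
have GT : G setT.
  exists (fun=> setT) => //; rewrite /rect.
  by apply/seteqP; split.
suff : m1 (Y @^-1` C) = m2 (Y @^-1` C).
  by rewrite /m1 /m2 /= /mrestr /mscale/= fineK// muleC => ->.
apply: (@g_sigma_algebra_measure_unique _ _ _ G _ (fun=> setT)) => //.
- by move=> _ [B' mB' ->]; exact: measurable_rect.
- by rewrite bigcup_const//; exists 0%N.
- move=> _ _ [B1 mB1 ->] [B2 mB2 ->]; exists (fun i => B1 i `&` B2 i).
    by move=> i; exact: measurableI.
  apply/seteqP; split => w /=; first by move=> [h1 h2] i iJ; split; [exact: h1|exact: h2].
  by move=> h; split => i iJ; have [] := h i iJ.
- move=> _ [B' mB' ->]; rewrite /m1 /m2 /= /mrestr /mscale/= fineK// muleC.
  pose B2 i := if i == i0 then B else B' i.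
  have mB2 i : measurable (B2 i) by rewrite /B2; case: ifP.
  have rJ : rect J B2 = rect J B'.
    apply/seteqP; split => w h i /= iJ; have := h i iJ; rewrite /B2.
      by case: eqP => // ie; move: i0J; rewrite -ie iJ.
    by case: eqP => // ie; move: i0J; rewrite -ie iJ.
  transitivity (P (rect (i0 :: J) B2)).
    congr (P _); rewrite -rJ; apply/seteqP; split => w /=.
      move=> [h1 h2] i /=; rewrite inE => /orP[/eqP ->|iJ]; last exact: h1.
      by rewrite /B2 eqxx.
    move=> h; split; first by move=> i /= iJ; apply: h => /=; rewrite inE iJ orbT.
    have /= := h i0; rewrite inE eqxx => /(_ isT).
    by rewrite /B2 eqxx.
  rewrite /rect indZ//=; last by rewrite i0J.
  rewrite big_cons -indZ// -/(rect J B2) rJ muleC; congr (_ * P _)%E.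
  by rewrite /B2 eqxx.
- by move=> _; rewrite /m1/= /mrestr/= setTI -ge0_fin_numE.
- have : measurable_fun [set: g_sigma_algebraType G] (Y : g_sigma_algebraType G -> R).
    (* [measurable_sum] asks for measurability at every index, while only the coordinates in [J] are
       measurable for the generated sigma-algebra; the guard kills the others. *)
    have -> : Y = fun w => \sum_(i <- J) (if i \in J then a i * Z i w else 0).
      by apply/funext => w; apply: eq_big_seq => i ->.
    apply: measurable_sum => i; have [iJ|_] := boolP (i \in J); last exact: measurable_cst.
    apply: measurable_funM; first exact: measurable_cst.
    move=> _ A mA; rewrite setTI; apply: sub_sigma_algebra.
    exists (fun j => if j == i then A else setT).
      by move=> j; case: ifP.
    apply/seteqP; split => w /=.
      by move=> wA j /= jJ; case: eqP => // ->.
    by move=> /(_ i iJ); rewrite eqxx.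
  by move=> /(_ measurableT C mC); rewrite setTI.
Qed.

(* Cutting the values of Y into cells of length e, X has to lie in an interval
   of length 3e whose position is fixed by the cell. *)
Lemma anticoncentration (X Y : T -> R) (K e : R) :
  measurable_fun setT X -> measurable_fun setT Y -> 0 <= K -> 0 < e ->
  (forall a b : R, a <= b -> (P (X @^-1` `[a, b]) <= (K * (b - a))%:E)%E) ->
  (forall B C : set R, measurable B -> measurable C ->
    P (Y @^-1` C `&` X @^-1` B) = (P (Y @^-1` C) * P (X @^-1` B))%E) ->
  (P [set w | (`|X w + Y w| <= e)%R] <= (3 * K * e)%:E)%E.
Proof.
move=> mX mY K0 e0 XK XY.
(* The cells are indexed by integers but countable subadditivity by [nat]; codes of no integer get
   empty cells. *)
have [f [g [fK gK]]] : exists f g, pcancel f g /\ @ocancel int nat g f.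
  by exists pickle, pickle_inv; split; [exact: pickleK_inv|exact: pickle_invK].
pose cell (m : nat) : set R := if g m is Some z
  then [set` `[(z : int)%:~R * e, (z + 1)%:~R * e[ ] else set0.
pose itvl (m : nat) : set R := if g m is Some z
  then [set` `[- (z : int)%:~R * e - 2 * e, - z%:~R * e + e] ] else set0.
have mcell m : measurable (cell m) by rewrite /cell; case: (g _).
have mitvl m : measurable (itvl m) by rewrite /itvl; case: (g _).
have mYc m : measurable (Y @^-1` cell m).
  by rewrite -[X in measurable X]setTI; exact: mY.
have mXi m : measurable (X @^-1` itvl m).
  by rewrite -[X in measurable X]setTI; exact: mX.
have PXi m : (P (X @^-1` itvl m) <= (3 * K * e)%:E)%E.
  rewrite /itvl; case: (g _) => [z|].
    apply: le_trans (XK _ _ _) _; first lra.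
    by rewrite lee_fin; lra.
  by rewrite preimage_set0 measure0 lee_fin mulr_ge0 ?(ltW e0)// mulr_ge0.
have mS : measurable [set w | `|X w + Y w| <= e].
  rewrite [X in measurable X](_ : _ = (fun w => `|X w + Y w|) @^-1` `]-oo, e]).
    rewrite -[X in measurable X]setTI.
    have mXY : measurable_fun setT (fun w => `|X w + Y w|).
      by apply: measurableT_comp => //; exact: measurable_funD.
    exact: mXY.
  by apply/seteqP; split => w /=; rewrite in_itv.
have cov : [set w | `|X w + Y w| <= e] `<=`
    \bigcup_m (Y @^-1` cell m `&` X @^-1` itvl m).
  move=> w /= XYe; pose z := Num.floor (Y w / e).
  have /andP[z1 z2] : z%:~R <= Y w / e < (z + 1)%:~R by exact: floor_itv.
  rewrite ler_pdivlMr// in z1; rewrite ltr_pdivrMr// in z2.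
  exists (f z) => //=; rewrite /cell /itvl fK/= !in_itv/= z1 z2.
  split => //; move: XYe z2; rewrite ler_norml intrD => /andP[? ?] ?.
  by apply/andP; split; lra.
apply: (le_trans (measure_sigma_subadditive P _ mS cov)).
  by move=> m; exact: measurableI.
apply: (@le_trans _ _ (\sum_(m <oo) ((3 * K * e)%:E * P (Y @^-1` cell m)))%E).
  apply: lee_nneseries => [m _ _|m _]; first exact: measure_ge0.
  by rewrite [leLHS](XY _ _ (mitvl m) (mcell m)) muleC lee_wpmul2r.
(* The cells are disjoint, so the probabilities that [Y] falls in them add up to at most 1. *)
rewrite nneseriesZl// -measure_semi_bigcup//; first last.
- exact: bigcupT_measurable.
- move=> m m' _ _ [w []]/=; rewrite /cell.
  case e1 : (g m) => [z|]//; case e2 : (g m') => [z'|]//.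
  rewrite /= !in_itv/= => /andP[h1 h2] /andP[h3 h4].
  have := le_lt_trans h1 h4; have := le_lt_trans h3 h2.
  rewrite !ltr_pM2r// !ltr_int !ltzD1 => zz' z'z.
  have zE : z = z' by apply/le_anti; rewrite zz' z'z.
  have := gK m; have := gK m'.
  by rewrite e1 e2/= zE => <- <-.
rewrite -[leRHS]mule1 lee_wpmul2l//.
  by rewrite lee_fin mulr_ge0 ?(ltW e0)// mulr_ge0.
by apply: probability_le1; exact: bigcupT_measurable.
Qed.

End Anticoncentration.

(** * Two estimates for a centered Gaussian *)

Section Gaussian.
Context {R : realType}.
Implicit Types s a b : R.

Lemma normal_prob_itv s a b : s != 0 -> a <= b ->
  (normal_prob 0 s `[a, b] <= (normal_peak s * (b - a))%:E)%E.
Proof.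
move=> s0 ab; rewrite /normal_prob.
apply: (@le_trans _ _ (\int[lebesgue_measure]_(x in `[a, b]) (normal_peak s)%:E)%E).
  apply: ge0_le_integral => //=.
  - by move=> x _; rewrite lee_fin normal_pdf_ge0.
  - by apply/measurable_EFinP/measurable_funTS; exact: measurable_normal_pdf.
  - by move=> x _; rewrite lee_fin normal_pdf_ub.
rewrite integral_cst//= lebesgue_measure_itv/= lte_fin.
case: ifP => [_|/negbT]; first by rewrite -EFinD -EFinM.
by rewrite mule0 lee_fin mulr_ge0 ?normal_peak_ge0 ?subr_ge0.
Qed.

(* e^{-x^2} = e^{-x^2/2} e^{-x^2/2}: one factor is small on the tail and the
   other one is a multiple of the standard normal density. *)
Lemma normal_prob_tail : exists2 K : R, 0 <= K & forall a, 0 < a ->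
  (normal_prob 0 (Num.sqrt 2^-1) [set x : R | (a < `|x|)%R] <= (K / a ^+ 2)%:E)%E.
Proof.
set s := Num.sqrt 2^-1.
have s2 : s ^+ 2 *+ 2 = 1 by rewrite sqr_sqrtr ?invr_ge0// -mulr_natr mulVf.
have s0 : s != 0 by rewrite gt_eqF// sqrtr_gt0 invr_gt0.
pose k := normal_peak s / normal_peak 1.
have k0 : 0 <= k by rewrite divr_ge0 ?normal_peak_ge0.
exists (2 * k); first by rewrite mulr_ge0.
move=> a a0; rewrite /normal_prob.
have c0 : 0 <= 2 * k / a ^+ 2 by rewrite divr_ge0 ?exprn_ge0 ?(ltW a0)// mulr_ge0.
have mt : measurable [set x : R | a < `|x|].
  rewrite [X in measurable X](_ : _ = (fun x : R => `|x|) @^-1` `]a, +oo[).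
    by rewrite -[X in measurable X]setTI; exact: measurableT_comp.
  by apply/seteqP; split => w /=; rewrite in_itv/= andbT.
apply: (@le_trans _ _ (\int[lebesgue_measure]_(x in [set x : R | (a < `|x|)%R])
   ((2 * k / a ^+ 2)%:E * (normal_pdf 0 1 x)%:E))%E).
  apply: ge0_le_integral => //=.
  - by move=> x _; rewrite lee_fin normal_pdf_ge0.
  - by apply/measurable_EFinP/measurable_funTS; exact: measurable_normal_pdf.
  - apply: measurable_funeM; apply/measurable_EFinP/measurable_funTS.
    exact: measurable_normal_pdf.
  - move=> x ax; rewrite -EFinM lee_fin !normal_pdfE ?oner_eq0// /normal_fun.
    rewrite s2 divr1 subr0 expr1n.
    have -> : expR (- x ^+ 2) = expR (- (x ^+ 2 / 2)) * expR (- x ^+ 2 / 2%:R).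
      by rewrite -expRD; congr expR; field.
    rewrite mulrA [leRHS]mulrA ler_pM2r ?expR_gt0//.
    have -> : 2 * k / a ^+ 2 * normal_peak 1 = normal_peak s * (2 / a ^+ 2).
      by rewrite /k; field; rewrite gt_eqF//= gt_eqF// normal_peak_gt0.
    (* On the tail exp(x^2/2) >= x^2/2 >= a^2/2. The quadratic decay in [a] is all that the union
       bound over the coefficients will ask for. *)
    rewrite ler_wpM2l ?normal_peak_ge0// expRN.
    have ax2 : a ^+ 2 <= x ^+ 2.
      by rewrite -(real_normK (num_real x)) lerXn2r ?nnegrE// ?ltW.
    have a20 : 0 < a ^+ 2 by rewrite exprn_gt0.
    rewrite -[leRHS]invf_div lef_pV2 ?posrE ?expR_gt0 ?divr_gt0//.
    by apply: le_trans (expR_ge1Dx _); lra.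
rewrite ge0_integralZl//=; first last.
- by move=> x _; rewrite lee_fin normal_pdf_ge0.
- by apply/measurable_EFinP/measurable_funTS; exact: measurable_normal_pdf.
rewrite -[leRHS]mule1 lee_wpmul2l//.
exact: (@probability_le1 _ _ _ (normal_prob 0 1)).
Qed.

End Gaussian.

(** * Circle potentials, bumps and uniform continuity in the plane *)

Section Plane.
Variable R : realType.
Implicit Types (p q : R * R) (c a : R[i]) (r x : R) (f g : R * R -> R).

Definition of_plane p : R[i] := Complex p.1 p.2.

Lemma to_planeK (z : R[i]) : of_plane (to_plane z) = z.
Proof. by case: z. Qed.

Lemma measurable_sqrt : measurable_fun setT (@Num.sqrt R).
Proof. by apply: continuous_measurable_fun; exact: sqrt_continuous. Qed.

Lemma measurable_cmodB c :
  measurable_fun setT (fun p : R * R => cmod (of_plane p - c)).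
Proof.
under eq_fun do rewrite cmodE.
apply: measurableT_comp; first exact: measurable_sqrt.
case: c => c1 c2; apply: measurable_funD => /=;
  apply: measurable_funX; apply: measurable_funB => //.
Qed.

Lemma open_diskE r p : 0 <= r -> open_disk r p = (cmod (of_plane p) < r) :> Prop.
Proof.
move=> r0; rewrite /open_disk/= cmodE/=; congr is_true.
rewrite -{2}(ger0_norm r0) -sqrtr_sqr.
have [->|rn0] := eqVneq r 0.
  by rewrite expr0n/= sqrtr0 !ltNge sqrtr_ge0 addr_ge0 ?sqr_ge0.
by rewrite ltr_sqrt// exprn_even_gt0.
Qed.

Lemma measurable_open_disk r : 0 <= r -> measurable (open_disk r).
Proof.
move=> r0.
rewrite [X in measurable X](_ : _ = (fun p => cmod (of_plane p - 0)) @^-1` `]-oo, r[).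
  by rewrite -[X in measurable X]setTI; exact: measurable_cmodB.
by apply/seteqP; split => p; rewrite open_diskE//= subr0 in_itv.
Qed.

Definition lip f := exists2 K, 0 <= K &
  forall p q, `|f p - f q| <= K * cmod (of_plane p - of_plane q).

Lemma lip_continuous f : lip f -> continuous f.
Proof.
move=> [K K0 fK] p; apply/cvgrPdist_le => e e0.
have h0 : 0 < e / (2 * (K + 1)) by rewrite divr_gt0// mulr_gt0//; lra.
exists (ball p.1 (e / (2 * (K + 1))), ball p.2 (e / (2 * (K + 1)))) => /=.
  by split; exact: nbhsx_ballx.
move=> q [] /=; rewrite /ball/= => h1 h2; apply: le_trans (fK p q) _.
have : cmod (of_plane p - of_plane q) <= e / (K + 1).
  apply: le_trans (cmod_le _) _ => /=.
  have -> : e / (K + 1) = e / (2 * (K + 1)) + e / (2 * (K + 1)).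
    by field; rewrite gt_eqF//; lra.
  by rewrite lerD// ltW.
move=> h; apply: le_trans (ler_wpM2l K0 h) _.
by rewrite mulrA ler_pdivrMr; nra.
Qed.

Lemma lipZ k f : lip f -> lip (fun p => k * f p).
Proof.
move=> [K K0 fK]; exists (`|k| * K); first by rewrite mulr_ge0.
by move=> p q; rewrite -mulrBr normrM -mulrA ler_wpM2l.
Qed.

Lemma lipD f g : lip f -> lip g -> lip (fun p => f p + g p).
Proof.
move=> [K K0 fK] [L L0 gL]; exists (K + L); first by rewrite addr_ge0.
move=> p q; rewrite mulrDl opprD addrACA.
by apply: le_trans (ler_normD _ _) _; rewrite lerD.
Qed.

Lemma lip_sum (I : Type) (s : seq I) (F : I -> R * R -> R) :
  (forall i, lip (F i)) -> lip (fun p => \sum_(i <- s) F i p).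
Proof.
move=> lF; elim: s => [|i s IH].
  by exists 0 => // p q; rewrite !big_nil subr0 normr0 mul0r.
have -> : (fun p => \sum_(j <- i :: s) F j p) =
    (fun p => F i p + \sum_(j <- s) F j p).
  by apply/funext => p; rewrite big_cons.
exact: lipD.
Qed.

(** The mean of ln |p - c - r w| over the unit circle: up to sign, the logarithmic potential of the
    uniform measure on the circle of center [c] and radius [r]. *)
Definition lmax r c p := ln (Num.max r (cmod (of_plane p - c))).

Lemma ln_le_subr1 x : 0 < x -> ln x <= x - 1.
Proof. by move=> x0; have := expR_ge1Dx (ln x); rewrite lnK ?posrE//; lra. Qed.

Lemma ln_max_lip r x y : 0 < r ->
  `|ln (Num.max r x) - ln (Num.max r y)| <= r^-1 * `|x - y|.
Proof.
move=> r0; wlog xy : x y / y <= x.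
  move=> h; have [/h//|/ltW/h] := leP y x.
  by rewrite distrC (distrC y).
have My : 0 < Num.max r y by rewrite lt_max r0.
have Mx : 0 < Num.max r x by rewrite lt_max r0.
have Mxy : Num.max r y <= Num.max r x.
  by rewrite ge_max !le_max lexx xy orbT.
rewrite ger0_norm ?subr_ge0 ?ler_ln// ger0_norm ?subr_ge0//.
rewrite -ln_div ?posrE//; apply: le_trans (ln_le_subr1 _) _; first exact: divr_gt0.
have -> : Num.max r x / Num.max r y - 1 = (Num.max r y)^-1 * (Num.max r x - Num.max r y).
  by field; rewrite gt_eqF.
apply: ler_pM; rewrite ?invr_ge0 ?subr_ge0 ?(ltW My)//.
  by rewrite lef_pV2 ?posrE// le_max lexx.
by case: (leP r x); case: (leP r y) => *; lra.
Qed.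

Lemma lip_lmax r c : 0 < r -> lip (lmax r c).
Proof.
move=> r0; exists r^-1; first by rewrite invr_ge0 ltW.
move=> p q; apply: le_trans (ln_max_lip _ _ r0) _.
rewrite ler_pM2l ?invr_gt0//; apply: le_trans (cmod_dist _ _) _.
by rewrite opprB addrA subrK.
Qed.

Lemma measurable_lmax r c : measurable_fun setT (lmax r c).
Proof.
apply: measurableT_comp; first exact: measurable_ln.
by apply: measurable_maxr => //; exact: measurable_cmodB.
Qed.

Lemma lmax_rot r c a p : cmod a = 1 ->
  lmax r (a * c) p = lmax r c (to_plane (a^-1 * of_plane p)).
Proof.
move=> a1; have a0 : a != 0 by rewrite -cmod_eq0 a1 oner_eq0.
rewrite /lmax to_planeK; congr (ln (Num.max _ _)).
by rewrite -{1}(mulVKf a0 (of_plane p)) -mulrBr cmodM a1 mul1r.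
Qed.

(** Two concentric circles with opposite charges: the potentials cancel outside the larger one,
    which gives compact support, and differ by the constant [ln 2] inside the smaller one. *)
Definition bump r c p := lmax (2 * r) c p - lmax r c p.

Lemma bump_in r c p : 0 < r -> cmod (of_plane p - c) <= r -> bump r c p = ln 2.
Proof.
move=> r0 h; have h2 : cmod (of_plane p - c) <= 2 * r by lra.
by rewrite /bump /lmax !max_l// lnM ?posrE//; ring.
Qed.

Lemma bump_out r c p : 0 < r -> 2 * r <= cmod (of_plane p - c) -> bump r c p = 0.
Proof.
move=> r0 h; have h2 : r <= cmod (of_plane p - c) by lra.
by rewrite /bump /lmax !max_r ?subrr.
Qed.

Lemma bump_ge0 r c p : 0 < r -> 0 <= bump r c p.
Proof.
move=> r0; have h2 : r <= 2 * r by lra.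
rewrite subr_ge0 ler_ln ?posrE ?lt_max ?r0 ?mulr_gt0//.
by rewrite ge_max !le_max lexx orbT andbT h2.
Qed.

Lemma bump_le r c p : 0 < r -> bump r c p <= ln 2.
Proof.
move=> r0; have h2 : cmod (of_plane p - c) <= 2 * cmod (of_plane p - c).
  by have := cmod_ge0 (of_plane p - c); lra.
rewrite lerBlDr -lnM ?posrE ?lt_max ?r0// ler_ln ?posrE ?lt_max ?mulr_gt0 ?lt_max ?r0//.
by rewrite maxr_pMr// ge_max !le_max lexx h2 orbT.
Qed.

Lemma lip_bump r c : 0 < r -> lip (bump r c).
Proof.
move=> r0; have -> : bump r c = (fun p => lmax (2 * r) c p + (-1) * lmax r c p).
  by apply/funext => p; rewrite /bump mulN1r.
by apply: lipD; [|apply: lipZ]; apply: lip_lmax => //; rewrite mulr_gt0.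
Qed.

Lemma measurable_bump r c : measurable_fun setT (bump r c).
Proof. by apply: measurable_funB; exact: measurable_lmax. Qed.

Lemma bump_norm r c p : 0 < r -> `|bump r c p| <= ln 2.
Proof. by move=> r0; rewrite ger0_norm ?bump_ge0 ?bump_le. Qed.

Lemma bump_rot r c a p : cmod a = 1 ->
  bump r (a * c) p = bump r c (to_plane (a^-1 * of_plane p)).
Proof. by move=> a1; rewrite /bump !lmax_rot. Qed.

Lemma unif_continuous_cpt_support f B e : continuous f ->
  (forall p, B <= cmod (of_plane p) -> f p = 0) -> 0 < e ->
  exists2 h, 0 < h & forall p q, cmod (of_plane p - of_plane q) < h ->
    `|f p - f q| <= e.
Proof.
move=> cf f0 e0; set B1 := `|B| + 1.
have cK : compact (`[- B1, B1]%classic `*` `[- B1, B1]%classic : set (R * R)).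
  by apply: compact_setX; exact: segment_compact.
pose Q (h : R) (p : R * R) := forall q, cmod (of_plane q - of_plane p) < h ->
    `|f p - f q| <= e.
have /compact_near_coveringP/(_ R (0^'+) Q) := cK.
have loc p : \forall p' \near p & h \near 0^'+, Q h p'.
  have /cvgrPdist_le/(_ (e / 2)) := cf p.
  have e20 : 0 < e / 2 by rewrite divr_gt0.
  move=> /(_ e20)/nbhs_ballP[s /= s0 hs].
  exists (ball p (s / 2), [set h | h < s / 2]) => /=.
    split; first by apply: nbhsx_ballx; rewrite divr_gt0.
    by apply: nbhs_right_lt; rewrite divr_gt0.
  move=> [p' h] /= [[pp1 pp2] hh] q qp'.
  have h1 : `|f p - f p'| <= e / 2.
    apply: hs; split; rewrite /ball/=; first by apply: lt_trans pp1 _; lra.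
    by apply: lt_trans pp2 _; lra.
  have h2 : `|f p - f q| <= e / 2.
    have := Re_le_cmod (of_plane q - of_plane p').
    have := Im_le_cmod (of_plane q - of_plane p').
    rewrite /= => i1 i2; rewrite /ball/= in pp1 pp2.
    apply: hs; split; rewrite /ball/=.
      have -> : p.1 - q.1 = (p.1 - p'.1) - (q.1 - p'.1) by ring.
      by apply: le_lt_trans (ler_normB _ _) _; lra.
    have -> : p.2 - q.2 = (p.2 - p'.2) - (q.2 - p'.2) by ring.
    by apply: le_lt_trans (ler_normB _ _) _; lra.
  have -> : f p' - f q = (f p - f q) - (f p - f p') by ring.
  by apply: le_trans (ler_normB _ _) _; lra.
move=> /(_ _ (fun p _ => loc p)) nQ.
have : \forall h \near 0^'+, (forall p, (`[- B1, B1]%classic `*` `[- B1, B1]%classic) p -> Q h p) /\ 0 < h :> R.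
  by apply: filterI; [exact: nQ|exact: nbhs_right_gt].
move=> /(@filter_ex R _ (at_right_proper_filter 0))[h [hQ h0]].
(* If [p] is outside the compact square, its modulus is at least |B| + 1; capping the distance by 1
   keeps the modulus of [q] above [B], and [f] vanishes at both points. *)
exists (Num.min h 1); first by rewrite lt_min h0 ltr01.
move=> p q; rewrite lt_min => /andP[pqh pq1].
have [pK|pK] := pselect ((`[- B1, B1]%classic `*` `[- B1, B1]%classic : set (R * R)) p).
  by apply: hQ => //; rewrite cmodC.
have pB : B1 <= cmod (of_plane p).
  rewrite leNgt; apply/negP => pB; apply: pK; split; rewrite /= in_itv/= -ler_norml.
    by rewrite (le_trans (Re_le_cmod (of_plane p)))// ltW.
  by rewrite (le_trans (Im_le_cmod (of_plane p)))// ltW.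
have BB := ler_norm B.
rewrite !f0 ?subrr ?normr0 ?(ltW e0)//; rewrite /B1 in pB; first last.
  lra.
by have := cmodB_ge (of_plane p) (of_plane q); lra.
Qed.

(** The indices lie in an open interval of length 8, hence among 9 consecutive integers. Its square
    81 bounds how many bumps centered on a grid of mesh [h] overlap at a point. *)
Lemma card_near_multiples (b h : R) (K : nat) : 0 < h ->
  \sum_(j < K) (`|b - j%:R * h| < 4 * h)%R%:R <= 9 :> R.
Proof.
move=> h0; rewrite -natr_sum ler_nat.
rewrite -(big_mkord xpredT (fun j => nat_of_bool (`|b - j%:R * h| < 4 * h)%R)).
rewrite /index_iota subn0.
have -> : (\sum_(j <- iota 0 K) (`|b - j%:R * h| < 4 * h)%R =
    size [seq j <- iota 0 K | (`|b - j%:R * h| < 4 * h)%R])%N.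
  rewrite size_filter -sum1_count [RHS]big_mkcond/=.
  by apply: eq_bigr => j _; case: ifP.
set s := [seq _ <- _ | _].
have us : uniq s by rewrite filter_uniq// iota_uniq.
pose j0 := Num.trunc (b / h - 4).
suff sub : {subset s <= iota j0 9} by rewrite -[9%N](size_iota j0); exact: uniq_leq_size.
move=> j; rewrite mem_filter [j \in iota j0 9]mem_iota ltr_norml => /andP[/andP[j1 j2] _].
have k1 : b / h - 4 < j%:R.
  by rewrite ltrBlDr ltr_pdivrMr//; lra.
have k2 : j%:R < b / h + 4 by rewrite -ltrBlDr ltr_pdivlMr//; lra.
have [x0|x0] := leP 0 (b / h - 4).
  have /andP[t1 t2] := truncn_itv x0; rewrite -/j0 in t1 t2.
  have a1 : j0%:R < j%:R :> R by apply: le_lt_trans k1.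
  rewrite ltr_nat in a1; rewrite (ltnW a1)/=.
  have : j%:R < (j0 + 9)%:R :> R by rewrite natrD; rewrite -natr1 in t2; lra.
  by rewrite ltr_nat.
have -> : j0 = 0%N by apply/truncn0Pn; rewrite -ltNge (lt_trans x0).
rewrite leq0n/= add0n -(ltr_nat R); lra.
Qed.

End Plane.

(** * Test functions for which empirical means converge along a filter *)

Section TestFunctions.
Context {R : realType} {I : Type} (F : set_system I).
Context {FF : Filter F}.
Variables (S : I -> seq R[i]) (nu : probability (R * R)%type R).
Implicit Types (f g h : R * R -> R) (c a : R[i]).

(** On [root_seq p] this is convertible to [emp_root_int p f]; working on sequences forgets the
    polynomial. *)
Definition emp (s : seq R[i]) f : R :=
  (size s)%:R^-1 * \sum_(z <- s) f (to_plane z).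

Lemma le_emp s f g : (forall p, f p <= g p) -> emp s f <= emp s g.
Proof. by move=> fg; rewrite ler_wpM2l ?invr_ge0//; apply: ler_sum. Qed.

Lemma empD s f g : emp s (fun p => f p + g p) = emp s f + emp s g.
Proof. by rewrite /emp big_split/= mulrDr. Qed.

Lemma empZ s k f : emp s (fun p => k * f p) = k * emp s f.
Proof. by rewrite /emp -mulr_sumr mulrCA. Qed.

Lemma empB s f g : emp s (fun p => f p - g p) = emp s f - emp s g.
Proof. by rewrite /emp sumrB mulrBr. Qed.

(** Only an inequality, because [emp] is 0 on the empty sequence. *)
Lemma emp_cst_le s (M : R) : 0 <= M -> emp s (fun=> M) <= M.
Proof.
move=> M0; rewrite /emp big_const_seq count_predT iter_addr_0 -[M *+ _]mulr_natl mulrA.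
have [->|s0] := eqVneq (size s) 0%N; first by rewrite mulr0 mul0r.
by rewrite mulVf ?mul1r// pnatr_eq0.
Qed.

Lemma emp_dist s f g h : (forall p, `|f p - g p| <= h p) ->
  `|emp s f - emp s g| <= emp s h.
Proof.
move=> fgh; rewrite -empB ler_norml -mulN1r -empZ; apply/andP; split; apply: le_emp => p.
  by rewrite mulN1r; have := fgh p; rewrite ler_norml => /andP[].
by apply: le_trans (fgh p); exact: ler_norm.
Qed.

Lemma emp_unif s f g e : (forall p, `|f p - g p| <= e) -> 0 <= e ->
  `|emp s f - emp s g| <= e.
Proof.
by move=> fge e0; rewrite (le_trans (emp_dist s fge))// emp_cst_le.
Qed.

Definition tame f := measurable_fun setT f /\ exists M, forall p, `|f p| <= M.

Lemma tame_integrable f : tame f -> nu.-integrable setT (EFin \o f).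
Proof.
move=> [mf [M fM]]; apply: measurable_bounded_integrable => //.
  by rewrite -ge0_fin_numE// fin_num_measure.
exists M; split; first exact: num_real.
by move=> x Mx p _ /=; rewrite (le_trans (fM p))// ltW.
Qed.

Lemma tameD f g : tame f -> tame g -> tame (fun p => f p + g p).
Proof.
move=> [mf [M fM]] [mg [N gN]]; split; first exact: measurable_funD.
by exists (M + N) => p; rewrite (le_trans (ler_normD _ _))// lerD.
Qed.

Lemma tameZ k f : tame f -> tame (fun p => k * f p).
Proof.
move=> [mf [M fM]]; split; first exact: measurable_funM.
by exists (`|k| * M) => p; rewrite normrM ler_wpM2l.
Qed.

Lemma tame_cst (k : R) : tame (fun=> k).
Proof. by split => //; exists `|k|. Qed.

(** This class is closed under linear combinations and uniform limits; the argument enlarges it from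
    disks to bumps, then to compactly supported and finally to bounded continuous functions. *)
Definition good f :=
  tame f /\ (fun i => emp (S i) f) @ F --> Rintegral nu setT f.

Lemma goodD f g : good f -> good g -> good (fun p => f p + g p).
Proof.
move=> [tf cf] [tg cg]; split; first exact: tameD.
rewrite RintegralD//; [|exact: tame_integrable|exact: tame_integrable].
by under eq_fun do rewrite empD; exact: cvgD.
Qed.

Lemma goodZ k f : good f -> good (fun p => k * f p).
Proof.
move=> [tf cf]; split; first exact: tameZ.
rewrite RintegralZl//; last exact: tame_integrable.
by under eq_fun do rewrite empZ; apply: cvgM => //; exact: cvg_cst.
Qed.

Lemma goodB f g : good f -> good g -> good (fun p => f p - g p).
Proof.
move=> gf gg; have -> : (fun p => f p - g p) = (fun p => f p + (-1) * g p).
  by apply/funext => p; rewrite mulN1r.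
by apply: goodD => //; exact: goodZ.
Qed.

Lemma good0 : good (fun=> 0).
Proof.
split; first exact: tame_cst.
rewrite Rintegral_cst// mul0r.
under eq_fun do rewrite /emp big1_eq mulr0.
exact: cvg_cst.
Qed.

Lemma good_sum (J : Type) (s : seq J) (G : J -> R * R -> R) :
  (forall j, good (G j)) -> good (fun p => \sum_(j <- s) G j p).
Proof.
move=> gG; elim: s => [|j s IH].
  by under eq_fun do rewrite big_nil; exact: good0.
by under eq_fun do rewrite big_cons; exact: goodD.
Qed.

Lemma Rintegral_dist f g h : tame f -> tame g -> tame h ->
  (forall p, `|f p - g p| <= h p) ->
  `|Rintegral nu setT f - Rintegral nu setT g| <= Rintegral nu setT h.
Proof.
move=> tf tg th fgh.
have tN : tame (fun p => (-1) * h p) by exact: tameZ.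
have tgN : tame (fun p => (-1) * g p) by exact: tameZ.
have tfg : tame (fun p => f p + (-1) * g p) by exact: tameD.
have -> : Rintegral nu setT f - Rintegral nu setT g =
    Rintegral nu setT (fun p => f p + (-1) * g p).
  rewrite RintegralD ?RintegralZl//; [|exact: tame_integrable..].
  by rewrite mulN1r.
rewrite ler_norml -[- Rintegral nu setT h]mulN1r -RintegralZl//; last exact: tame_integrable.
apply/andP; split; apply: le_Rintegral => //; try exact: tame_integrable.
  by move=> p _; rewrite !mulN1r; have := fgh p; rewrite ler_norml => /andP[].
by move=> p _; rewrite mulN1r; apply: le_trans (fgh p); exact: ler_norm.
Qed.

Lemma Rintegral_unif f g e : tame f -> tame g ->
  (forall p, `|f p - g p| <= e) ->
  `|Rintegral nu setT f - Rintegral nu setT g| <= e.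
Proof.
move=> tf tg fge; have := Rintegral_dist tf tg (tame_cst e) fge.
by rewrite Rintegral_cst//= probability_setT mulr1.
Qed.

(** Three-epsilon argument. Measurability of [f] is obtained on the way, as that of a pointwise
    limit of approximants at precision 1/(n+1). *)
Lemma good_unif f : (exists M, forall p, `|f p| <= M) ->
  (forall e, 0 < e -> exists2 g, good g & forall p, `|f p - g p| <= e) -> good f.
Proof.
move=> bf ap; have tf : tame f.
  split => //.
  have /choice[g gP] : forall n, exists g : R * R -> R,
      good g /\ forall p, `|f p - g p| <= n.+1%:R^-1.
    by move=> n; have [|g ? ?] := ap n.+1%:R^-1; [rewrite invr_gt0|exists g].
  apply: (@measurable_fun_cvg _ _ _ _ g) => [n|p _]; first by have [[[]]] := gP n.
  apply/cvgrPdist_le => e e0; near=> n.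
  have [_ /(_ p) h] := gP n; apply: le_trans h _; apply: ltW.
  by near: n; exact: (near_infty_natSinv_lt (PosNum e0)).
split => //; apply/cvgrPdist_le => e e0.
have e30 : 0 < e / 3 by rewrite divr_gt0.
have [g [tg cg] fg] := ap _ e30.
near=> i.
have h1 := Rintegral_unif tf tg fg.
have h2 : `|emp (S i) f - emp (S i) g| <= e / 3 by apply: emp_unif => //; exact: ltW.
have h3 : `|Rintegral nu setT g - emp (S i) g| <= e / 3.
  by near: i; exact: cvgr_dist_le.
have -> : Rintegral nu setT f - emp (S i) f =
   (Rintegral nu setT f - Rintegral nu setT g) +
   (Rintegral nu setT g - emp (S i) g) - (emp (S i) f - emp (S i) g) by ring.
apply: le_trans (ler_normB _ _) _.
by have := ler_normD (Rintegral nu setT f - Rintegral nu setT g)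
   (Rintegral nu setT g - emp (S i) g); lra.
Unshelve. all: by end_near.
Qed.

(** An error whose majorant [h] has integral 0 disappears in the limit on both sides. This removes
    the part of a function that lives where [nu] has no mass. *)
Lemma good_dom f g h : tame f -> good g -> good h ->
  (forall p, `|f p - g p| <= h p) -> Rintegral nu setT h = 0 -> good f.
Proof.
move=> tf [tg cg] [th ch] fgh h0; split => //.
have fg : Rintegral nu setT f = Rintegral nu setT g.
  have := Rintegral_dist tf tg th fgh; rewrite h0 normr_le0 subr_eq0.
  by move/eqP.
rewrite fg; rewrite h0 in ch.
apply/cvgrPdist_le => e e0; have e20 : 0 < e / 2 by rewrite divr_gt0.
near=> i.
have h1 := emp_dist (S i) fgh.
have h2 : `|Rintegral nu setT g - emp (S i) g| <= e / 2.
  by near: i; exact: cvgr_dist_le.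
have h3 : `|0 - emp (S i) h| <= e / 2 by near: i; exact: cvgr_dist_le.
rewrite sub0r normrN in h3; have := ler_norm (emp (S i) h) => h4.
have -> : Rintegral nu setT g - emp (S i) f =
   (Rintegral nu setT g - emp (S i) g) - (emp (S i) f - emp (S i) g) by ring.
by apply: le_trans (ler_normB _ _) _; lra.
Unshelve. all: by end_near.
Qed.

Definition disk_ind (r : R) (p : R * R) : R := (cmod (of_plane p) < r)%R%:R.

Definition radial_good := forall r, 0 < r -> good (disk_ind r).
(** Asymptotic invariance is stated on differences, since neither mean is known to converge by
    itself. *)
Definition rotation_good := forall r c a, 0 < r -> cmod a = 1 ->
  (fun i => emp (S i) (lmax r (a * c)) - emp (S i) (lmax r c)) @ F --> (0 : R).

Lemma measurable_disk_ind r : measurable_fun setT (disk_ind r).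
Proof.
have -> : disk_ind r = (fun b : bool => b%:R) \o (fun p => cmod (of_plane p - 0) < r).
  by apply/funext => p; rewrite /disk_ind/= subr0.
apply: measurableT_comp => //.
by apply: measurable_fun_ltr => //; exact: measurable_cmodB.
Qed.

Lemma tame_disk_ind r : tame (disk_ind r).
Proof.
split; first exact: measurable_disk_ind.
by exists 1 => p; rewrite /disk_ind; case: (_ < _); rewrite ?normr1 ?normr0.
Qed.

Lemma Rintegral_disk_ind r : 0 <= r ->
  Rintegral nu setT (disk_ind r) = fine (nu (open_disk r)).
Proof.
move=> r0; rewrite /Rintegral; congr fine.
rewrite -[in RHS](setIT (open_disk r)) -integral_indic//; last exact: measurable_open_disk.
apply: eq_integral => p _; rewrite /disk_ind indicE.
suff -> : (p \in open_disk r) = (cmod (of_plane p) < r) by [].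
by apply/idP/idP; rewrite inE open_diskE.
Qed.

(** A Lipschitz radial function is uniformly close to a function constant on thin annuli, and
    indicators of annuli are differences of disk indicators. *)
Lemma good_radial (g : R -> R) (K B : R) : radial_good -> 0 <= K ->
  (forall x y, 0 <= x -> 0 <= y -> `|g x - g y| <= K * `|x - y|) ->
  (forall x, B <= x -> g x = 0) -> good (fun p => g (cmod (of_plane p))).
Proof.
move=> rg K0 gK g0; set B1 := `|B| + 1.
have B10 : 0 < B1 by rewrite /B1; have := normr_ge0 B; lra.
have BB1 : B <= B1 by rewrite /B1; have := ler_norm B; lra.
apply: good_unif.
  exists (K * B1) => p; have [h|h] := leP B1 (cmod (of_plane p)).
    by rewrite g0 ?normr0 ?mulr_ge0 ?(ltW B10)// (le_trans BB1).
  rewrite -[g _]subr0 -(g0 B1)//; apply: le_trans (gK _ _ _ _) _; rewrite ?cmod_ge0 ?(ltW B10)//.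
  rewrite ler_wpM2l// distrC ger0_norm ?subr_ge0 ?(ltW h)//.
  by have := cmod_ge0 (of_plane p); lra.
(* Width of the annuli: [K + 1] rather than [K], so that [K = 0] is allowed. *)
move=> e e0; pose h := e / (K + 1).
have K10 : 0 < K + 1 by lra.
have h0 : 0 < h by rewrite divr_gt0.
have Khe : K * h <= e.
  by rewrite /h mulrA ler_pdivrMr//; nra.
pose N := (Num.trunc (B1 / h)).+1.
have NB : B1 < N%:R * h.
  by rewrite -ltr_pdivrMr//; exact: truncnS_gt.
exists (fun p => \sum_(j <- iota 0 N) g (j%:R * h) *
    (disk_ind (j.+1%:R * h) p - disk_ind (j%:R * h) p)).
  apply: good_sum => j; apply: goodZ; apply: goodB.
    by apply: rg; rewrite mulr_gt0.
  (* The innermost annulus starts at radius 0, outside the range of [radial_good]; its inner disk is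
     empty. *)
  case: j => [|j]; last by apply: rg; rewrite mulr_gt0.
  have -> : disk_ind (0%:R * h) = fun=> 0; last exact: good0.
  by apply/funext => p; rewrite /disk_ind mul0r ltNge cmod_ge0.
move=> p; rewrite /disk_ind; set x := cmod (of_plane p).
have x0 : 0 <= x by exact: cmod_ge0.
pose j := Num.trunc (x / h).
have /andP[j1 j2] : j%:R <= x / h < j.+1%:R by apply: truncn_itv; rewrite divr_ge0// ltW.
rewrite ler_pdivlMr// in j1; rewrite ltr_pdivrMr// in j2.
have term k : k != j -> (x < k.+1%:R * h)%R%:R - (x < k%:R * h)%R%:R = 0 :> R.
  move=> kj; have [kj'|kj'] := ltnP k j.
    have : k.+1%:R * h <= x by apply: le_trans j1; rewrite ler_pM2r// ler_nat.
    move=> h1; have h2 : k%:R * h <= x.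
      by apply: le_trans h1; rewrite ler_pM2r// ler_nat.
    by rewrite !ltNge h1 h2 subr0.
  have jk : (j < k)%N by rewrite ltn_neqAle eq_sym kj.
  have h1 : x < k%:R * h by apply: lt_le_trans j2 _; rewrite ler_pM2r// ler_nat.
  have h2 : x < k.+1%:R * h by apply: lt_le_trans h1 _; rewrite ler_pM2r// ler_nat.
  by rewrite h1 h2 subrr.
have [jN|jN] := ltnP j N.
  have jI : j \in iota 0 N by rewrite mem_iota.
  rewrite (bigD1_seq j jI (iota_uniq _ _)).
  rewrite big1 => [|k kj]; last by rewrite term ?mulr0.
  rewrite /= addr0 j2 ltNge j1/= subr0 mulr1.
  have jh0 : 0 <= j%:R * h by rewrite mulr_ge0// ltW.
  apply: le_trans (gK _ _ x0 jh0) _; apply: le_trans Khe; rewrite ler_wpM2l//.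
  by rewrite ger0_norm ?subr_ge0// lerBlDr; move: j2; rewrite -natr1; lra.
rewrite big_seq big1 => [|k]; last first.
  rewrite mem_iota add0n => kN; rewrite term ?mulr0// ltn_eqF//.
  exact: leq_trans kN jN.
rewrite subr0 g0 ?normr0 ?(ltW e0)//; apply: le_trans j1; apply: le_trans BB1 _.
by apply: le_trans (ltW NB) _; rewrite ler_pM2r// ler_nat.
Qed.

Hypothesis nu_rot : rot_invariant nu.

Lemma Rintegral_rot f a : tame f -> cmod a = 1 ->
  Rintegral nu setT (fun p => f (to_plane (a * of_plane p))) = Rintegral nu setT f.
Proof.
move=> tf a1; set phi := fun p : R * R => to_plane (a * of_plane p).
(* [rot_invariant] speaks of angles, so an argument of [a] is recovered from [acos], with its sign
   fixed by the imaginary part. *)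
have [t cst sst] : exists2 t, cos t = complex.Re a & sin t = complex.Im a.
  have a2 : complex.Re a ^+ 2 + complex.Im a ^+ 2 = 1 by rewrite -cmod_sqr a1 expr1n.
  have re1 : -1 <= complex.Re a <= 1 by rewrite -ler_norml -a1 Re_le_cmod.
  have s1 : sin (acos (complex.Re a)) = `|complex.Im a|.
    by rewrite sin_acos// -sqrtr_sqr; congr Num.sqrt; rewrite -a2 addrAC subrr add0r.
  have [im0|im0] := leP 0 (complex.Im a).
    by exists (acos (complex.Re a)); rewrite ?acosK// s1 ger0_norm.
  exists (- acos (complex.Re a)); first by rewrite cosN acosK.
  by rewrite sinN s1 ltr0_norm// opprK.
have phiE : phi = Defs.rot t.
  apply/funext => -[x y]; rewrite /phi /Defs.rot cst sst /to_plane /of_plane.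
  by case: (a) => u v /=; congr (_, _); ring.
have mphi : measurable_fun setT phi.
  rewrite phiE /Defs.rot; apply: measurable_fun_prod => /=.
  - by apply: measurable_funB; apply: measurable_funM.
  - by apply: measurable_funD; apply: measurable_funM.
rewrite /Rintegral; congr fine.
transitivity (\int[pushforward nu phi]_y (f y)%:E)%E.
  rewrite integral_pushforward//.
  - by apply/measurable_EFinP; exact: tf.1.
  - rewrite preimage_setT; apply: (@tame_integrable (f \o phi)); split.
      by apply: measurableT_comp => //; exact: tf.1.
    by have [_ [M fM]] := tf; exists M => p; exact: fM.
apply: eq_measure_integral => A mA _.
by transitivity (nu (phi @^-1` A)) => //; rewrite phiE; exact: nu_rot.
Qed.

End TestFunctions.

(** * From disks and rotated potentials to all bounded continuous functions *)

Section ContinuousTests.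
Context {R : realType} {I : Type} (F : set_system I).
Context {FF : Filter F}.
Variables (S : I -> seq R[i]) (nu : probability (R * R)%type R).
Implicit Types (f g h : R * R -> R) (c a : R[i]).
Local Notation good := (good F S nu).
Hypothesis nu_rot : rot_invariant nu.
Hypothesis Hrad : radial_good F S nu.
Hypothesis Hrot : rotation_good F S.

Lemma tame_bump (r : R) c : 0 < r -> tame (bump r c).
Proof.
move=> r0; split; first exact: measurable_bump.
by exists (ln 2) => p; exact: bump_norm.
Qed.

(** Both sides tend to 0: the integral by rotation invariance of [nu], the empirical mean by [Hrot]
    at the radii [r] and [2 * r]. *)
Lemma good_bump_rot (r : R) c a : 0 < r -> cmod a = 1 ->
  good (fun p => bump r (a * c) p - bump r c p).
Proof.
move=> r0 a1.
have -> : (fun p => bump r (a * c) p - bump r c p) =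
    (fun p => bump r (a * c) p + (-1) * bump r c p).
  by apply/funext => p; rewrite mulN1r.
split; first by apply: tameD; [|apply: tameZ]; exact: tame_bump.
rewrite RintegralD//; last 2 first.
- by apply: tame_integrable; exact: tame_bump.
- by apply: tame_integrable; apply: tameZ; exact: tame_bump.
rewrite RintegralZl//; last by apply: tame_integrable; exact: tame_bump.
have -> : Rintegral nu setT (bump r (a * c)) = Rintegral nu setT (bump r c).
  have aV : cmod a^-1 = 1 by rewrite cmodV a1 invr1.
  rewrite -(Rintegral_rot nu_rot (tame_bump c r0) aV).
  by congr Rintegral; apply/funext => p; exact: bump_rot.
rewrite mulN1r subrr.
have -> : (fun i => emp (S i) (fun p => bump r (a * c) p + -1 * bump r c p)) =
    (fun i => (emp (S i) (lmax (2 * r) (a * c)) - emp (S i) (lmax (2 * r) c)) -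
      (emp (S i) (lmax r (a * c)) - emp (S i) (lmax r c))).
  by apply/funext => i; rewrite empD empZ /bump !empB; ring.
rewrite -[X in _ --> X](subrr (0 : R)).
by apply: cvgB; apply: Hrot => //; rewrite mulr_gt0.
Qed.

(* The average of a bump over the 2^p-th roots of unity is nearly radial. *)
Lemma good_bump (r : R) c : 0 < r -> good (bump r c).
Proof.
move=> r0; apply: good_unif; first by exists (ln 2) => p; exact: bump_norm.
move=> e e0; have [K K0 bK] := lip_bump c r0.
set B := cmod c + 2 * r.
have B0 : 0 < B by rewrite /B; have := cmod_ge0 c; lra.
(* Every point of modulus at most [B] has a rotation by some 2^k-th root of unity within 2B/2^(k/2)
   of the positive real axis; [k] makes [K] times this at most [e]. *)
have [k hk] : exists k : nat, (2 * K * B / e) ^+ 2 < 2 ^+ k.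
  exists (Num.trunc ((2 * K * B / e) ^+ 2)).+1.
  apply: lt_le_trans (truncnS_gt _) _.
  by rewrite -natrX ler_nat ltnW// ltn_expl.
pose L := (2 ^ k)%N.
have L0 : (0 < L)%N by rewrite expn_gt0.
have LR0 : 0 < L%:R :> R by rewrite ltr0n.
pose av p := L%:R^-1 * \sum_(a <- unity_roots R L) bump r (a * c) p.
have unit1 a : a \in unity_roots R L -> cmod a = 1.
  by rewrite mem_unity_roots// => /eqP; exact: cmod_unity.
pose rad (x : R) := av (to_plane (complex.real_complex R x)).
(* The bump is its rotational average [av] minus the mean of the differences with its rotated
   copies. The approximant replaces [av] by the radial function with the same values on the positive
   real axis. The membership test only serves [good_sum], which wants every term good. *)
exists (fun p => rad (cmod (of_plane p)) - L%:R^-1 *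
   \sum_(a <- unity_roots R L) (if a \in unity_roots R L then bump r (a * c) p - bump r c p else 0)).
  apply: goodB; last first.
    apply: goodZ; apply: good_sum => a.
    by have [/unit1 a1|_] := boolP (a \in _); [exact: good_bump_rot|exact: good0].
  apply: (@good_radial _ _ _ _ _ _ rad K B) => //.
  - move=> x y x0 y0; rewrite /rad /av -mulrBr -sumrB normrM.
    rewrite gtr0_norm ?invr_gt0// ler_pdivrMl//.
    apply: le_trans (ler_norm_sum _ _ _) _.
    rewrite big_seq; apply: (@le_trans _ _ (\sum_(a <- unity_roots R L | a \in unity_roots R L) K * `|x - y|)).
      apply: ler_sum => a /unit1 a1; rewrite !bump_rot// !to_planeK.
      apply: le_trans (bK _ _) _; rewrite !to_planeK ler_wpM2l//.
      by rewrite -mulrBr cmodM cmodV a1 invr1 mul1r -rmorphB cmod_real.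
    by rewrite -big_seq big_const_seq count_predT size_unity_roots// iter_addr_0 -[K * _ *+ _]mulr_natl.
  - move=> x Bx; rewrite /rad /av big_seq big1 ?mulr0// => a /unit1 a1.
    apply: bump_out => //; rewrite to_planeK.
    apply: le_trans (cmodB_ge _ _); rewrite cmodM a1 mul1r cmod_real ger0_norm; last by lra.
    by rewrite /B in Bx; lra.
move=> p; set x := cmod (of_plane p).
have -> : L%:R^-1 * \sum_(a <- unity_roots R L) (if a \in unity_roots R L then bump r (a * c) p - bump r c p else 0)
    = av p - bump r c p.
  rewrite (eq_big_seq (fun a => bump r (a * c) p - bump r c p)); last by move=> a ->.
  rewrite sumrB mulrBr; congr (_ - _).
  rewrite big_const_seq count_predT size_unity_roots// iter_addr_0 -[bump r c p *+ _]mulr_natl.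
  by rewrite mulrA mulVf ?mul1r// gt_eqF.
have -> : bump r c p - (rad x - (av p - bump r c p)) = av p - rad x by ring.
have [xB|xB] := leP B x.
  have -> : av p = 0.
    rewrite /av big_seq big1 ?mulr0// => a /unit1 a1; apply: bump_out => //.
    apply: le_trans (cmodB_ge _ _); rewrite cmodM a1 mul1r -/x.
    by rewrite /B in xB; lra.
  have -> : rad x = 0.
    rewrite /rad /av big_seq big1 ?mulr0// => a /unit1 a1.
    apply: bump_out => //; rewrite to_planeK.
    apply: le_trans (cmodB_ge _ _); rewrite cmodM a1 mul1r cmod_real ger0_norm; last by lra.
    by rewrite /B in xB; lra.
  by rewrite subrr normr0 ltW.
have x0 : 0 <= x by exact: cmod_ge0.
have [y y1 py] : exists2 y, cmod y = 1 & of_plane p = complex.real_complex R x * y.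
  have [pz|pz] := eqVneq (of_plane p) 0.
    by exists 1; rewrite ?cmod1// /x pz cmod0 rmorph0 mul0r.
  have xn0 : complex.real_complex R x != 0.
    by rewrite fmorph_eq0 cmod_eq0.
  exists (of_plane p / complex.real_complex R x); last by rewrite mulrC divfK.
  by rewrite cmodM cmodV cmod_real ger0_norm// divff// cmod_eq0.
have [w wL yw] := unity_root_dense k y1.
have w1 : cmod w = 1 by apply: cmod_unity wL.
have w0 : w != 0 by rewrite -cmod_eq0 w1 oner_eq0.
(* Multiplication by [w] permutes the roots of unity, so [av] takes the same value at [x] and at
   [w * x], which is close to [p]. *)
have -> : rad x = L%:R^-1 * \sum_(a <- unity_roots R L)
    bump r (a * c) (to_plane (w * complex.real_complex R x)).
  rewrite /rad /av; congr (_ * _).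
  rewrite -[RHS](perm_big _ (perm_unity_roots L0 wL))/= big_map.
  by apply: eq_bigr => a _; rewrite -mulrA [RHS]bump_rot// to_planeK mulKf.
rewrite /av -mulrBr -sumrB normrM gtr0_norm ?invr_gt0// ler_pdivrMl//.
apply: le_trans (ler_norm_sum _ _ _) _.
rewrite big_seq; apply: (@le_trans _ _ (\sum_(a <- unity_roots R L | a \in unity_roots R L) e)).
  apply: ler_sum => a /unit1 a1; rewrite !bump_rot// to_planeK.
  apply: le_trans (bK _ _) _; rewrite !to_planeK -mulrBr cmodM cmodV a1 invr1 mul1r.
  rewrite py [w * _]mulrC -mulrBr cmodM cmod_real ger0_norm//.
  set u := cmod (y - w) in yw *; have u0 : 0 <= u by exact: cmod_ge0.
  have q0 : 0 <= 2 * K * B / e by rewrite divr_ge0 ?mulr_ge0// ltW.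
  have : u * (2 * K * B / e) <= 2.
    have uq0 : 0 <= u * (2 * K * B / e) by rewrite mulr_ge0.
    rewrite -(@ler_pXn2r _ 2) ?nnegrE// exprMn.
    apply: le_trans (ler_wpM2l (sqr_ge0 _) (ltW hk)) _.
    by apply: le_trans yw _; rewrite -natrX.
  have -> : u * (2 * K * B / e) = 2 * (K * (B * u) / e) by field; rewrite gt_eqF.
  rewrite ger_pMr// ler_pdivrMr// mul1r; apply: le_trans.
  by rewrite ler_wpM2l// ler_wpM2r// ltW.
by rewrite -big_seq big_const_seq count_predT size_unity_roots// iter_addr_0 -[e *+ _]mulr_natl.
Qed.

(** 324 = 4 * 81: at most 81 bumps overlap, and together they may use up a quarter of the bound [M],
    so that a single one removes M/324. *)
Definition greedy_rate : R := 1 - 324^-1.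

Lemma greedy_rate_gt0 : 0 < greedy_rate.
Proof. by rewrite subr_gt0 invf_lt1 ?ltr0n// ltr1n. Qed.

Lemma greedy_rate_lt1 : greedy_rate < 1.
Proof. by rewrite gtrBl invr_gt0 ltr0n. Qed.

(* One step of a greedy approximation: a sum of bumps of equal height, placed
   where f is large, stays below f and removes a fixed proportion of sup f. *)
Lemma good_greedy_step f (B M : R) : continuous f -> 0 < M ->
  (forall p, 0 <= f p <= M) -> (forall p, B <= cmod (of_plane p) -> f p = 0) ->
  exists g, [/\ good g, lip g &
    forall p, 0 <= g p <= f p /\ f p - g p <= greedy_rate * M].
Proof.
move=> cf M0 fM f0.
have M40 : 0 < M / 4 by rewrite divr_gt0.
have [d d0 fd] := unif_continuous_cpt_support cf f0 M40.
(* The bumps below have radius [2 * h] and support of radius [4 * h < d], so [f] varies by at most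
   M/4 between the center of a bump and any point of its support. *)
pose h := d / 5.
have h0 : 0 < h by rewrite divr_gt0.
set B1 := `|B| + 1.
have B10 : 0 < B1 by rewrite /B1; have := normr_ge0 B; lra.
pose K := (Num.trunc (2 * B1 / h)).+1.
have KB : 2 * B1 < K%:R * h by rewrite -ltr_pdivrMr//; exact: truncnS_gt.
pose x (jk : 'I_K * 'I_K) : R[i] :=
  Complex (jk.1%:R * h - B1) (jk.2%:R * h - B1).
(* Bumps sit at the grid points where [f] is at least M/2. On their supports [f] stays above M/4,
   the largest possible total height; and a point where [f] is at least 3M/4 has an active grid
   point within [2 * h]. *)
pose act jk := M / 2 <= f (to_plane (x jk)).
have ln20 : 0 < ln 2 :> R by rewrite ln_gt0// ltr1n.
pose kap := M / (4 * 81 * ln 2).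
have kap0 : 0 < kap by rewrite divr_gt0// !mulr_gt0.
have h20 : 0 < 2 * h by rewrite mulr_gt0.
pose sm p := \sum_(jk <- index_enum ('I_K * 'I_K)%type) (if act jk then bump (2 * h) (x jk) p else 0).
have sm0 p : 0 <= sm p.
  by apply: sumr_ge0 => jk _; case: ifP => // _; exact: bump_ge0.
have smle p : sm p <= 81 * ln 2.
  apply: (@le_trans _ _ (\sum_(jk : 'I_K * 'I_K)
     ln 2 * ((`|(p.1 + B1) - jk.1%:R * h| < 4 * h)%R%:R * (`|(p.2 + B1) - jk.2%:R * h| < 4 * h)%R%:R))).
    apply: ler_sum => jk _; case: ifP => _; last by rewrite mulr_ge0 ?(ltW ln20)// mulr_ge0.
    have [ge|lt] := leP (2 * (2 * h)) (cmod (of_plane p - x jk)).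
      by rewrite bump_out// mulr_ge0 ?(ltW ln20)// mulr_ge0.
    have r1 := Re_le_cmod (of_plane p - x jk); have r2 := Im_le_cmod (of_plane p - x jk).
    rewrite /= in r1 r2.
    have -> : `|p.1 + B1 - jk.1%:R * h| < 4 * h.
      have -> : p.1 + B1 - jk.1%:R * h = p.1 - (jk.1%:R * h - B1) by ring.
      by apply: le_lt_trans r1 _; lra.
    have -> : `|p.2 + B1 - jk.2%:R * h| < 4 * h.
      have -> : p.2 + B1 - jk.2%:R * h = p.2 - (jk.2%:R * h - B1) by ring.
      by apply: le_lt_trans r2 _; lra.
    by rewrite !mulr1; exact: bump_le.
  rewrite -mulr_sumr mulrC ler_pM2r//.
  rewrite -(pair_big xpredT xpredT (fun j k : 'I_K => (`|(p.1 + B1) - j%:R * h| < 4 * h)%R%:R * (`|(p.2 + B1) - k%:R * h| < 4 * h)%R%:R : R))/=.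
  under eq_bigr do rewrite -mulr_sumr.
  rewrite -mulr_suml.
  have -> : 81 = 9 * 9 :> R by ring.
  by apply: ler_pM; rewrite ?sumr_ge0//; exact: card_near_multiples.
exists (fun p => kap * sm p); split.
- apply: goodZ; apply: good_sum => jk.
  by case: (act jk); [exact: good_bump|exact: good0].
- apply: lipZ; apply: lip_sum => jk; case: (act jk); first exact: lip_bump.
  by exists 0 => // p q; rewrite subrr normr0 mul0r.
move=> p; have /andP[fp0 fpM] := fM p.
have gM : kap * sm p <= M / 4.
  have -> : M / 4 = kap * (81 * ln 2) by rewrite /kap; field; rewrite gt_eqF.
  by rewrite ler_pM2l.
split; first apply/andP; first split.
- by rewrite mulr_ge0// ltW.
- have [[jk ajk cl]|no] := pselect (exists2 jk, act jk & cmod (of_plane p - x jk) < 4 * h).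
    have : `|f p - f (to_plane (x jk))| <= M / 4.
      by apply: fd; rewrite to_planeK; apply: lt_trans cl _; rewrite /h; lra.
    rewrite ler_norml => /andP[+ _]; rewrite /act in ajk; lra.
  rewrite /sm big1 ?mulr0// => jk _; case: ifP => // ajk; apply: bump_out => //.
  rewrite leNgt; apply/negP => cl; apply: no; exists jk => //.
  by apply: lt_le_trans cl _; lra.
(* Below 3M/4 the bound already holds with nothing removed, as 3/4 is less than the rate. *)
rewrite /greedy_rate; have [fbig|fsmall] := leP (3 / 4 * M) (f p); last first.
  have : 0 <= kap * sm p by rewrite mulr_ge0// ltW.
  lra.
have pB : cmod (of_plane p) < B1.
  rewrite ltNge; apply/negP => pB; move: fbig; rewrite f0; first lra.
  by apply: le_trans pB; rewrite /B1; have := ler_norm B; lra.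
have r1 := Re_le_cmod (of_plane p); have r2 := Im_le_cmod (of_plane p).
rewrite /= !ler_norml in r1 r2; move/andP: r1 => [r11 r12]; move/andP: r2 => [r21 r22].
have idx u : - B1 <= u -> u <= B1 -> exists j : 'I_K, `|u - (j%:R * h - B1)| <= h.
  move=> u1 u2; pose j := Num.trunc ((u + B1) / h).
  have /andP[j1 j2] : j%:R <= (u + B1) / h < j.+1%:R.
    apply: truncn_itv; have uB : 0 <= u + B1 by lra.
    by rewrite divr_ge0// ltW.
  rewrite ler_pdivlMr// in j1; rewrite ltr_pdivrMr// in j2.
  have jK : (j < K)%N.
    rewrite ltnNge; apply/negP => Kj.
    have : K%:R * h <= j%:R * h by rewrite ler_pM2r// ler_nat.
    lra.
  exists (Ordinal jK) => /=; rewrite ger0_norm; last lra.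
  by move: j2; rewrite -natr1; lra.
have [j jP] : exists j : 'I_K, `|p.1 - (j%:R * h - B1)| <= h by apply: idx; lra.
have [k kP] : exists j : 'I_K, `|p.2 - (j%:R * h - B1)| <= h by apply: idx; lra.
have cl : cmod (of_plane p - x (j, k)) <= 2 * h.
  by apply: le_trans (cmod_le _) _; rewrite /=; lra.
have ajk : act (j, k).
  have : `|f p - f (to_plane (x (j, k)))| <= M / 4.
    by apply: fd; rewrite to_planeK; apply: le_lt_trans cl _; rewrite /h; lra.
  by rewrite /act ler_norml => /andP[_ ?]; lra.
have : ln 2 <= sm p.
  rewrite /sm (bigD1 (j, k))//= ajk bump_in// lerDl.
  by apply: sumr_ge0 => jk _; case: ifP => // _; exact: bump_ge0.
rewrite -(ler_pM2l kap0).
have -> : kap * ln 2 = 324^-1 * M by rewrite /kap; field; rewrite gt_eqF.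
lra.
Qed.

(** The remainder of a greedy step satisfies the same hypotheses with a bound smaller by a fixed
    factor, so iteration gives geometric uniform convergence by good functions. *)
Lemma good_cpt_support_ge0 f (B M : R) : continuous f ->
  (forall p, 0 <= f p <= M) -> (forall p, B <= cmod (of_plane p) -> f p = 0) ->
  good f.
Proof.
move=> cf fM f0.
have M10 : 0 < `|M| + 1 by have := normr_ge0 M; lra.
have fM1 p : 0 <= f p <= `|M| + 1.
  by have := fM p; have := ler_norm M; move=> ? /andP[-> ?]/=; lra.
have iter n : exists g, [/\ good g, continuous g &
    forall p, 0 <= g p <= f p /\ f p - g p <= greedy_rate ^+ n * (`|M| + 1)].
  elim: n => [|n [g [gg cg gP]]].
    exists (fun=> 0); split; [exact: good0|by move=> p; exact: cvg_cst|].
    move=> p; have /andP[a b] := fM1 p.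
    by rewrite lexx a subr0 expr0 mul1r.
  have cfg : continuous (fun p => f p - g p) by move=> p; apply: cvgB; [exact: cf|exact: cg].
  have n0 : 0 < greedy_rate ^+ n * (`|M| + 1) by rewrite mulr_gt0// exprn_gt0// greedy_rate_gt0.
  have [||g' [gg' lg' g'P]] := @good_greedy_step _ B _ cfg n0.
  - by move=> p; have [/andP[_ a] ->] := gP p; rewrite subr_ge0 a.
  - move=> p Bp; have [/andP[a b] _] := gP p; move: b; rewrite f0// => b.
    by rewrite sub0r; apply/eqP; rewrite oppr_eq0 eq_le a b.
  exists (fun p => g p + g' p); split; first exact: goodD.
    by move=> p; apply: cvgD; [exact: cg|exact: lip_continuous].
  move=> p; have [/andP[a b] c] := gP p; have [/andP[a' b'] c'] := g'P p.
  split; first by apply/andP; split; lra.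
  by rewrite exprS -mulrA; lra.
apply: good_unif.
  by exists M => p; have /andP[? ?] := fM p; rewrite ger0_norm.
move=> e e0.
have th : (fun n => greedy_rate ^+ n) @ \oo --> (0 : R).
  by apply: cvg_expr; rewrite ger0_norm ?greedy_rate_lt1// ltW ?greedy_rate_gt0.
have [n hn] : exists n, greedy_rate ^+ n <= e / (`|M| + 1).
  have e1 : 0 < e / (`|M| + 1) by rewrite divr_gt0.
  have /cvgrPdist_le/(_ _ e1)[n _ hn] := th.
  exists n; have := hn n (leqnn _).
  by rewrite /= sub0r normrN; apply: le_trans; exact: ler_norm.
have [g [gg _ gP]] := iter n; exists g => // p.
have [/andP[a b] c] := gP p; rewrite ger0_norm ?subr_ge0//.
apply: le_trans c _; rewrite -ler_pdivlMr//.
Qed.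

Lemma good_cpt_support f (B M : R) : continuous f ->
  (forall p, `|f p| <= M) -> (forall p, B <= cmod (of_plane p) -> f p = 0) ->
  good f.
Proof.
move=> cf fM f0.
have -> : f = (fun p => 2^-1 * (`|f p| + f p) - 2^-1 * (`|f p| - f p)).
  by apply/funext => p; field.
have cn : continuous (fun p => `|f p|) by move=> p; apply: cvg_norm; exact: cf.
apply: goodB; apply: (@good_cpt_support_ge0 _ B M).
- by move=> p; apply: cvgM; [exact: cvg_cst|apply: cvgD; [exact: cn|exact: cf]].
- move=> p; have := fM p; have := ler_norm (f p); have := ler_norm (- f p).
  by rewrite normrN => ? ? ?; apply/andP; split; lra.
- by move=> p Bp; rewrite f0// normr0 addr0 mulr0.
- by move=> p; apply: cvgM; [exact: cvg_cst|apply: cvgB; [exact: cn|exact: cf]].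
- move=> p; have := fM p; have := ler_norm (f p); have := ler_norm (- f p).
  by rewrite normrN => ? ? ?; apply/andP; split; lra.
- by move=> p Bp; rewrite f0// normr0 subr0 mulr0.
Qed.

(** Tightness comes from the disk [B] of full mass: a cut-off equal to 1 there changes [f] by at
    most [M] times the indicator of the complement, which has integral 0, and [good_dom] applies. *)
Lemma good_continuous f (B M : R) : 0 < B -> nu (open_disk B) = 1%E ->
  continuous f -> (forall p, `|f p| <= M) -> good f.
Proof.
move=> B0 nuB cf fM.
have M0 : 0 <= M by apply: le_trans (fM (0, 0)).
pose chi (b : R) p := Num.max 0 (Num.min 1 (b + 1 - cmod (of_plane p))).
have chi01 b p : 0 <= chi b p <= 1.
  by rewrite /chi le_max lexx/= ge_max ler01/= ge_min lexx.
have chi1 b p : cmod (of_plane p) <= b -> chi b p = 1.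
  move=> h; have h' : 1 <= b + 1 - cmod (of_plane p) by lra.
  by rewrite /chi min_l// max_r.
have chi0 b p : b + 1 <= cmod (of_plane p) -> chi b p = 0.
  move=> h; have h' : b + 1 - cmod (of_plane p) <= 0 by lra.
  by rewrite /chi max_l// ge_min h' orbT.
have cchi b : continuous (chi b).
  apply: lip_continuous; exists 1 => // q q'; rewrite mul1r.
  apply: le_trans (cmod_dist _ _); rewrite /chi.
  have clamp (u v : R) : `|Num.max 0 (Num.min 1 (b + 1 - u)) -
      Num.max 0 (Num.min 1 (b + 1 - v))| <= `|u - v|.
    have le1 := ler_norm (u - v); have := ler_norm (- (u - v)); rewrite normrN => le2.
    rewrite !maxEle !minEle ler_norml.
    by case: (leP 1 (b + 1 - u)) => ?; case: (leP 1 (b + 1 - v)) => ?;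
      rewrite ?ler01; try case: (leP 0 (b + 1 - u)) => ?;
      try case: (leP 0 (b + 1 - v)) => ?; apply/andP; split; lra.
  exact: clamp.
have gchi b : good (fun p => f p * chi b p).
  apply: (@good_cpt_support _ (b + 1) M).
  - by move=> p; apply: cvgM; [exact: cf|exact: cchi].
  - move=> p; have /andP[c0 c1] := chi01 b p.
    by rewrite normrM (ger0_norm c0) (le_trans _ (fM p))// ler_piMr.
  - by move=> p h; rewrite chi0 ?mulr0.
have tf : tame f.
  split; last by exists M.
  apply: (@measurable_fun_cvg _ _ _ _ (fun n p => f p * chi n%:R p)).
    by move=> n; have [[]] := gchi n%:R.
  move=> p _; apply: cvg_near_cst; near=> n; rewrite chi1 ?mulr1//.
  by near: n; exact: nbhs_infty_ger.
have nuBE : Rintegral nu setT (disk_ind B) = 1.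
  by rewrite Rintegral_disk_ind ?(ltW B0)// nuB.
(* The mean of 1 can be 0 on an empty sequence; it is squeezed between the mean of [disk_ind B] and
   1. *)
have gone : good (fun=> 1).
  split; first exact: tame_cst.
  have -> : Rintegral nu setT (fun=> 1) = 1 by rewrite Rintegral_cst//= probability_setT mulr1.
  have cB : (fun i => emp (S i) (disk_ind B)) @ F --> (1 : R).
    by have [_] := Hrad B0; rewrite nuBE.
  apply: squeeze_cvgr cB (cvg_cst (1 : R)).
  apply: nearW => i; rewrite emp_cst_le// andbT; apply: le_emp => p.
  by rewrite /disk_ind; case: (_ < _).
apply: (@good_dom _ _ _ _ _ _ _ _ (fun p => M * (1 - disk_ind B p)) tf (gchi B)).
- by apply: goodZ; apply: goodB => //; exact: Hrad.
- move=> p; rewrite /disk_ind; have [h|h] := ltP.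
    rewrite chi1 ?(ltW h)// mulr1 subrr normr0 mulr_ge0// subr_ge0; exact: lexx.
  have /andP[c0 c1] := chi01 B p.
  have d0 : 0 <= 1 - chi B p by rewrite subr_ge0.
  rewrite mulr0n subr0 mulr1 -[X in X - _]mulr1 -mulrBr normrM (ger0_norm d0).
  by apply: le_trans (fM p); rewrite ler_piMr//; lra.
have tB := tame_disk_ind B; have t1 := @tame_cst R 1.
rewrite RintegralZl//; last by apply: tame_integrable; have [] := goodB gone (Hrad B0).
rewrite RintegralB//; [|exact: tame_integrable..].
by rewrite nuBE Rintegral_cst//= probability_setT mulr1 subrr mulr0.
Unshelve. all: by end_near.
Qed.

End ContinuousTests.

(** * Discrete Jensen formula for a polynomial *)

Section PolynomialRoots.
Variable R : realType.
Implicit Types (p q : {poly R[i]}) (x z c a : R[i]).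
Local Notation "k %:C" := (complex.real_complex R k) : ring_scope.

Lemma root_seqE p : p = lead_coef p *: \prod_(z <- root_seq p) ('X - z%:P).
Proof. by rewrite /root_seq; case: closed_field_poly_normal. Qed.

Lemma size_root_seq p : p != 0 -> size (root_seq p) = (size p).-1.
Proof.
move=> p0; rewrite {2}(root_seqE p) size_scale ?lead_coef_eq0//.
by rewrite size_prod_XsubC.
Qed.

Lemma root_seq_root p z : z \in root_seq p -> p.[z] = 0.
Proof.
move=> zp; rewrite (root_seqE p) hornerZ.
suff /rootP-> : root (\prod_(y <- root_seq p) ('X - y%:P)) z by rewrite mulr0.
by rewrite root_prod_XsubC.
Qed.

Lemma cmod_horner p x :
  cmod p.[x] = cmod (lead_coef p) * \prod_(z <- root_seq p) cmod (x - z).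
Proof.
rewrite {1}(root_seqE p) hornerZ cmodM horner_prod cmod_prod.
by congr (_ * _); apply: eq_bigr => z _; rewrite !hornerE.
Qed.

(** The logarithm of |p(x)| is that of the leading coefficient plus a sum over the roots, so
    [jensen_kernel] is summed over the roots. Dividing by the unit [a] brings the nodes back to the
    circle of center 0, with [y = a^-1 * z - c]. *)
Lemma discrete_jensen p k r e a c : p != 0 -> 0 < r -> 0 < e -> cmod a = 1 ->
  (forall z w, z \in root_seq p -> w ^+ (2 ^ k) = 1 ->
     e <= cmod (z - a * (c + r%:C * w))) ->
  `|emp (root_seq p) (lmax r (a * c)) +
      (size (root_seq p))%:R^-1 * ln (cmod (lead_coef p)) -
    (2 ^ k)%:R^-1 * \sum_(w <- unity_roots R (2 ^ k))
      (size (root_seq p))%:R^-1 * ln (cmod p.[a * (c + r%:C * w)])|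
  <= (ln 2 + `|ln (e / r)|) / (2 ^ k)%:R.
Proof.
move=> p0 r0 e0 a1 far.
set s := root_seq p; set N := (2 ^ k)%N; set U := unity_roots R N.
have N0 : (0 < N)%N by rewrite expn_gt0.
have NR0 : 0 < N%:R :> R by rewrite ltr0n.
have an0 : a != 0 by rewrite -cmod_eq0 a1 oner_eq0.
have l0 : 0 < cmod (lead_coef p) by rewrite cmod_gt0 lead_coef_eq0.
set C := (ln 2 + _) / _.
have C0 : 0 <= C.
  by rewrite divr_ge0 ?ler0n// addr_ge0// ln_ge0// ler1n.
have nodeU w : w \in U -> w ^+ N = 1 by rewrite mem_unity_roots// => /eqP.
have lnp w : w \in U -> ln (cmod p.[a * (c + r%:C * w)]) =
    ln (cmod (lead_coef p)) + \sum_(z <- s) ln (cmod (z - a * (c + r%:C * w))).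
  move=> wU; rewrite cmod_horner lnM ?posrE//; last first.
    rewrite big_seq; apply: prodr_gt0 => z zs; rewrite cmodC.
    by apply: lt_le_trans e0 (far _ _ zs (nodeU _ wU)).
  rewrite ln_prod//; last first.
    move=> z zs; rewrite cmodC.
    by apply: lt_le_trans e0 (far _ _ zs (nodeU _ wU)).
  by congr (_ + _); apply: eq_bigr => z _; rewrite cmodC.
have -> : N%:R^-1 * \sum_(w <- U) (size s)%:R^-1 * ln (cmod p.[a * (c + r%:C * w)]) =
    (size s)%:R^-1 * ln (cmod (lead_coef p)) +
    (size s)%:R^-1 * \sum_(z <- s) (N%:R^-1 * \sum_(w <- U) ln (cmod (z - a * (c + r%:C * w)))).
  rewrite -mulr_sumr mulrCA -mulrDr; congr (_ * _).
  rewrite (eq_big_seq _ lnp) big_split/= mulrDr exchange_big/= mulr_sumr.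
  congr (_ + _); last by rewrite mulr_sumr.
  rewrite big_const_seq count_predT size_unity_roots// iter_addr_0.
  by rewrite -[_ *+ N]mulr_natl mulrA mulfV ?mul1r// gt_eqF.
set la := _ * ln (cmod (lead_coef p)).
rewrite opprD addrA addrK /emp -mulrBr -sumrB.
(* Without roots the prefactor is the inverse of 0, which is 0. *)
have [s0|s0] := eqVneq (size s) 0%N.
  by rewrite s0 invr0 mul0r normr0.
have sR0 : 0 < (size s)%:R :> R by rewrite ltr0n lt0n.
rewrite normrM gtr0_norm ?invr_gt0// ler_pdivrMl//.
apply: le_trans (ler_norm_sum _ _ _) _.
apply: (@le_trans _ _ (\sum_(z <- s) C)); last first.
  by rewrite big_const_seq count_predT iter_addr_0 -[C *+ _]mulr_natl.
rewrite big_seq [leRHS]big_seq; apply: ler_sum => z zs.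
have nodeE w : cmod (z - a * (c + r%:C * w)) = cmod (a^-1 * z - c - r%:C * w).
  rewrite -[LHS]mul1r -invr1 -{1}a1 -cmodV -cmodM; congr cmod.
  by rewrite mulrBr mulKf// opprD addrA.
have -> : lmax r (a * c) (to_plane z) = ln (Num.max r (cmod (a^-1 * z - c))).
  by rewrite lmax_rot// /lmax !to_planeK.
have -> : \sum_(w <- U) ln (cmod (z - a * (c + r%:C * w))) =
    \sum_(w <- U) ln (cmod (a^-1 * z - c - r%:C * w)).
  by apply: eq_bigr => w _; rewrite nodeE.
by apply: jensen_kernel => // w w1; rewrite -nodeE; exact: far.
Qed.

Lemma cmod_exprB x z (e : R) k : cmod (x - z) <= e -> e <= 1 ->
  cmod (x ^+ k - z ^+ k) <= e * k%:R * (cmod x + 1) ^+ k.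
Proof.
move=> xz e1; have x0 := cmod_ge0 x.
have e0 : 0 <= e by apply: le_trans xz; exact: cmod_ge0.
have rho1 : 1 <= cmod x + 1 by lra.
have zx : cmod z <= cmod x + 1.
  by have := cmodB_ge z x; rewrite cmodC; lra.
elim: k => [|k IH]; first by rewrite !expr0 subrr cmod0 mulr0 mul0r.
have -> : x ^+ k.+1 - z ^+ k.+1 = x * (x ^+ k - z ^+ k) + (x - z) * z ^+ k.
  by rewrite !exprS; ring.
apply: le_trans (cmodD_le _ _) _; rewrite !cmodM cmodX.
have h1 : cmod x * cmod (x ^+ k - z ^+ k) <= (cmod x + 1) * (e * k%:R * (cmod x + 1) ^+ k).
  by apply: ler_pM => //; [exact: cmod_ge0|lra].
have h2 : cmod (x - z) * cmod z ^+ k <= e * (cmod x + 1) ^+ k.+1.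
  apply: ler_pM; rewrite ?cmod_ge0 ?exprn_ge0 ?cmod_ge0//.
  apply: (@le_trans _ _ ((cmod x + 1) ^+ k)).
    by rewrite lerXn2r ?nnegrE ?cmod_ge0//; lra.
  by rewrite exprS ler_peMl// exprn_ge0//; lra.
apply: le_trans (lerD h1 h2) _.
by rewrite -natr1 [(_ + 1) ^+ k.+1]exprS le_eqVlt; apply/orP; left; apply/eqP; ring.
Qed.

End PolynomialRoots.

(** * Maximal term and values of a polynomial with weighted coefficients *)

Section WeightedPolynomial.
Variable R : realType.
Local Notation "k %:C" := (complex.real_complex R k) : ring_scope.
Variables (A : nat -> R) (D : nat).
Hypothesis A0 : forall k, 0 < A k.

(** A central index in the sense of Wiman-Valiron theory; [max_term] is the maximal term. Among
    several maximizers any choice serves. *)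
Definition peak (rho : R) : 'I_D.+1 :=
  [arg max_(k > (ord0 : 'I_D.+1)) (A k * rho ^+ k)]%O.

Definition max_term (rho : R) : R := A (peak rho) * rho ^+ peak rho.

Lemma le_max_term rho k : (k <= D)%N -> A k * rho ^+ k <= max_term rho.
Proof.
move=> kD; rewrite /max_term /peak; case: Order.TotalTheory.arg_maxP => // i _ h.
by have := h (Ordinal (kD : (k < D.+1)%N)) isT.
Qed.

Lemma max_term_ge rho : A 0%N <= max_term rho.
Proof. by have := @le_max_term rho 0 (leq0n _); rewrite expr0 mulr1. Qed.

Lemma max_term_gt0 rho : 0 < max_term rho.
Proof. by apply: lt_le_trans (max_term_ge rho). Qed.

(** As a maximum of affine functions of ln rho, the logarithm of the maximal term is convex in ln
    rho, and [peak r1] is a subgradient at ln r1, on both sides of it. *)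
Lemma ln_max_termB_ge r1 r2 : 0 < r1 -> 0 < r2 ->
  (peak r1)%:R * (ln r2 - ln r1) <= ln (max_term r2) - ln (max_term r1).
Proof.
move=> r10 r20; set j := peak r1.
have lnt r : 0 < r -> ln (A j * r ^+ j) = ln (A j) + j%:R * ln r.
  by move=> r0; rewrite lnM ?posrE ?exprn_gt0// lnXn// -[ln r *+ _]mulr_natl.
have h1 : ln (max_term r1) = ln (A j) + j%:R * ln r1 by rewrite -lnt.
have h2 : ln (A j) + j%:R * ln r2 <= ln (max_term r2).
  rewrite -lnt// ler_ln ?posrE ?max_term_gt0 ?mulr_gt0 ?exprn_gt0//.
  by apply: le_max_term; rewrite -ltnS.
by rewrite h1 mulrBr; lra.
Qed.

Lemma ln_max_termB_le r1 r2 : 0 < r1 -> 0 < r2 ->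
  ln (max_term r2) - ln (max_term r1) <= (peak r2)%:R * (ln r2 - ln r1).
Proof.
move=> r10 r20; have := ln_max_termB_ge r20 r10.
by rewrite !mulrBr; lra.
Qed.

Definition weighted (Q : {poly R[i]}) (zeta : nat -> R[i]) :=
  forall k, Q`_k = if (k <= D)%N then (A k)%:C * zeta k else 0.

Variables (Q : {poly R[i]}) (zeta : nat -> R[i]).
Hypothesis wQ : weighted Q zeta.

Lemma weighted_horner x : Q.[x] = \sum_(k < D.+1) (A k)%:C * zeta k * x ^+ k.
Proof.
rewrite (@horner_coef_wide _ D.+1); last first.
  by apply/leq_sizeP => k Dk; rewrite wQ leqNgt Dk.
by apply: eq_bigr => k _; rewrite wQ -ltnS ltn_ord.
Qed.

Lemma weighted_size : zeta D != 0 -> size Q = D.+1.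
Proof.
move=> zD; apply/eqP; rewrite eqn_leq; apply/andP; split.
  by apply/leq_sizeP => k Dk; rewrite wQ leqNgt Dk.
rewrite ltnNge; apply/negP => /leq_sizeP/(_ D (leqnn _))/eqP.
rewrite wQ leqnn mulf_eq0 (negbTE zD) orbF fmorph_eq0.
by rewrite gt_eqF.
Qed.

Lemma cmod_weighted_le (L : R) x : (forall k, (k <= D)%N -> cmod (zeta k) <= L) ->
  cmod Q.[x] <= D.+1%:R * L * max_term (cmod x).
Proof.
move=> zL; rewrite weighted_horner; apply: le_trans (cmod_sum _ _) _.
apply: (@le_trans _ _ (\sum_(k < D.+1) L * max_term (cmod x))); last first.
  by rewrite sumr_const card_ord -[_ *+ D.+1]mulr_natl mulrA.
apply: ler_sum => k _; rewrite !cmodM cmod_real gtr0_norm// cmodX mulrAC mulrC.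
have kD : (k <= D)%N by rewrite -ltnS.
by apply: ler_pM; rewrite ?cmod_ge0 ?mulr_ge0 ?exprn_ge0 ?cmod_ge0 ?(ltW (A0 _)) ?zL// le_max_term.
Qed.

(** A mean value estimate: close to a root the polynomial is small compared with its maximal term.
    Against the lower bound at the nodes, this excludes roots near the nodes. *)
Lemma cmod_weighted_near_root (L H e : R) x z :
  (forall k, (k <= D)%N -> cmod (zeta k) <= L) ->
  (forall k, (k <= D)%N -> A k <= A 0%N * H) -> Q.[z] = 0 ->
  cmod (x - z) <= e -> e <= 1 ->
  cmod Q.[x] <= e * (L * D.+1%:R ^+ 2 * H * (cmod x + 1) ^+ D) * max_term (cmod x).
Proof.
move=> zL AH Qz xz e1; have x0 := cmod_ge0 x.
have e0 : 0 <= e by apply: le_trans xz; exact: cmod_ge0.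
have L0 : 0 <= L by apply: le_trans (zL 0%N _) => //; exact: cmod_ge0.
have H0 : 0 < H by have := lt_le_trans (A0 0%N) (AH 0%N (leq0n _)); rewrite pmulr_rgt0.
rewrite -[Q.[x]]subr0 -Qz !weighted_horner -sumrB.
apply: le_trans (cmod_sum _ _) _.
apply: (@le_trans _ _ (\sum_(k < D.+1) e * (L * D.+1%:R * H * (cmod x + 1) ^+ D) * max_term (cmod x))); last first.
  rewrite sumr_const card_ord -[_ *+ _]mulr_natl le_eqVlt; apply/orP; left; apply/eqP; ring.
apply: ler_sum => k _; have kD : (k <= D)%N by rewrite -ltnS.
rewrite -mulrBr !cmodM cmod_real gtr0_norm//.
have h1 : cmod (x ^+ k - z ^+ k) <= e * D.+1%:R * (cmod x + 1) ^+ D.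
  apply: le_trans (cmod_exprB _ xz e1) _; apply: ler_pM.
  - by rewrite mulr_ge0.
  - by rewrite exprn_ge0//; lra.
  - by rewrite ler_wpM2l// ler_nat leqW.
  - by rewrite ler_weXn2l//; lra.
have h2 : A k * cmod (zeta k) <= max_term (cmod x) * H * L.
  apply: ler_pM; rewrite ?cmod_ge0 ?(ltW (A0 _)) ?zL//.
  by apply: le_trans (AH _ kD) _; rewrite ler_pM2r// max_term_ge.
have := ler_pM _ _ h2 h1; rewrite ?cmod_ge0 ?mulr_ge0 ?cmod_ge0 ?(ltW (A0 _))//.
move=> /(_ isT isT)/le_trans; apply.
by rewrite le_eqVlt; apply/orP; left; apply/eqP; ring.
Qed.

End WeightedPolynomial.

(** * High-probability events for the Gaussian coefficients *)

Section GaussianEvents.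
Context {R : realType} {d : measure_display} {T : measurableType d}.
Variables (P : probability T R) (Z : nat -> {RV P >-> R}).
Hypothesis distZ : forall (n : nat) (A : set R), measurable A ->
  distribution P (Z n) A = normal_prob 0 (Num.sqrt (2^-1)) A.
Hypothesis indZ : mutually_independent P (fun n => (Z n : T -> R)).
Local Notation zeta := (xi (fun n => (Z n : T -> R))).
Local Notation sd := (Num.sqrt (2^-1) : R).

Lemma sd_neq0 : sd != 0.
Proof. by rewrite gt_eqF// sqrtr_gt0 invr_gt0. Qed.

Lemma sum_double (V : zmodType) (N : nat) (F : nat -> V) :
  \sum_(i <- iota 0 N.*2) F i = \sum_(j < N) (F j.*2 + F j.*2.+1).
Proof.
elim: N => [|N IH]; first by rewrite big_nil big_ord0.
rewrite doubleS -[N.*2.+2]addn2 iotaD big_cat big_ord_recr -IH add0n /=.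
by rewrite !big_cons big_nil addr0.
Qed.

(** After division by [u j0], the real part of the form is [Z j0.*2] plus a real linear combination
    of the other coordinates, which is independent of it. *)
Lemma linear_form_anticoncentration (n j0 : nat) (u : nat -> R[i]) (e : R) :
  (j0 <= n)%N -> u j0 != 0 -> 0 < e ->
  exists B : set T, [/\ measurable B, (P B <= (3 * normal_peak sd * e)%:E)%E &
    forall w, cmod (\sum_(j < n.+1) u j * zeta j w) <= e * cmod (u j0) -> B w].
Proof.
move=> j0n uj0 e0; pose v j := u j / u j0; pose i0 := j0.*2.
(* The real part of [v j * zeta j] is Re(v j) times the even coordinate minus Im(v j) times the odd
   one. *)
pose al i := if odd i then - complex.Im (v i./2) else complex.Re (v i./2).
pose J := [seq i <- iota 0 n.+1.*2 | i != i0].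
pose Y w := \sum_(i <- J) al i * Z i w.
have i0J : i0 \notin J by rewrite mem_filter eqxx.
have uJ : uniq J by rewrite filter_uniq// iota_uniq.
have mY : measurable_fun setT Y.
  by apply: measurable_sum => i; apply: measurable_funM.
exists [set w | `|Z i0 w + Y w| <= e]; split.
- rewrite [X in measurable X](_ : _ = (fun w => `|Z i0 w + Y w|) @^-1` `]-oo, e]).
    rewrite -[X in measurable X]setTI.
    have mZY : measurable_fun setT (fun w => `|Z i0 w + Y w|).
      by apply: measurableT_comp => //; exact: measurable_funD.
    exact: mZY.
  by apply/seteqP; split => w /=; rewrite in_itv.
- apply: anticoncentration => //; first exact: normal_peak_ge0.
  + move=> x y xy.
    have -> : P (Z i0 @^-1` `[x, y]) = distribution P (Z i0) `[x, y] by [].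
    by rewrite distZ//; apply: normal_prob_itv => //; exact: sd_neq0.
  + by move=> B C mB mC; exact: indep_lincomb.
- move=> w /= h.
  have -> : Z i0 w + Y w = complex.Re ((\sum_(j < n.+1) u j * zeta j w) / u j0).
    rewrite mulr_suml.
    have -> : complex.Re (\sum_(j < n.+1) u j * zeta j w / u j0) =
        \sum_(j < n.+1) (al j.*2 * Z j.*2 w + al j.*2.+1 * Z j.*2.+1 w).
      rewrite (big_morph (@complex.Re R) (id1 := 0) (op1 := +%R)) //; last by case=> ? ? [? ?].
      apply: eq_bigr => j _; rewrite mulrAC -/(v j) /al /= odd_double/=.
      rewrite doubleK uphalf_double /xi; case: (v j) => a b /=; ring.
    rewrite -(sum_double _ (fun i => al i * Z i w)).
    have i0I : i0 \in iota 0 n.+1.*2 by rewrite mem_iota add0n leq0n ltn_double ltnS.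
    rewrite (bigD1_seq i0 i0I (iota_uniq _ _)).
    transitivity (al i0 * Z i0 w + Y w); last by rewrite /Y /J big_filter.
    by congr (_ + _); rewrite /al /i0 odd_double doubleK /v divff//= mul1r.
  apply: le_trans (Re_le_cmod _) _.
  by rewrite cmodM cmodV ler_pdivrMr// cmod_gt0.
Qed.

Lemma measure_bigsetU_le (I : Type) (s : seq I) (B : I -> set T) (c : R) :
  (forall i, measurable (B i)) -> (forall i, (P (B i) <= c%:E)%E) ->
  (P (\big[setU/set0]_(i <- s) B i) <= ((size s)%:R * c)%:E)%E.
Proof.
move=> mB PB; elim: s => [|i s IH]; first by rewrite big_nil measure0 mul0r.
rewrite big_cons; apply: le_trans (measureU2 _ _ _) _ => //.
  exact: bigsetU_measurable.
by rewrite /= -natr1 mulrDl mul1r addrC EFinD; exact: leeD.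
Qed.

Lemma cvg_cst_harmonic (c : R) : (fun n => c / n.+1%:R) @ \oo --> (0 : R).
Proof.
rewrite -[X in _ --> X](mulr0 c); apply: cvgM; first exact: cvg_cst.
exact: cvg_harmonic.
Qed.

(** A union bound over 2(n+1) coordinates, each exceeding n+1 with probability O(n^-2). *)
Lemma whp_coef_le :
  whp P [set p | forall k, (k < p.1.+1.*2)%N -> `|Z k p.2| <= p.1.+1%:R].
Proof.
have [K K0 tail] := @normal_prob_tail R.
pose B n k := [set w | n.+1%:R < `|Z k w|].
have mB n k : measurable (B n k).
  rewrite [X in measurable X](_ : _ = (fun w => `|Z k w|) @^-1` `]n.+1%:R, +oo[).
    rewrite -[X in measurable X]setTI.
    have mZ : measurable_fun setT (fun w => `|Z k w|) by exact: measurableT_comp.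
    exact: mZ.
  by apply/seteqP; split => w /=; rewrite in_itv/= andbT.
have mt (a : R) : measurable [set x : R | a < `|x|].
  rewrite [X in measurable X](_ : _ = (fun x : R => `|x|) @^-1` `]a, +oo[).
    by rewrite -[X in measurable X]setTI; exact: measurableT_comp.
  by apply/seteqP; split => w /=; rewrite in_itv/= andbT.
have PB n k : (P (B n k) <= (K / n.+1%:R ^+ 2)%:E)%E.
  have -> : P (B n k) = distribution P (Z k) [set x : R | n.+1%:R < `|x|] by [].
  by rewrite distZ//; exact: tail.
have := @whp_le_cvg _ _ _ P (fun n => \big[setU/set0]_(k <- iota 0 n.+1.*2) B n k)
  (fun n => 2 * K / n.+1%:R) _ _ _.
move=> /(_ _ _ _)/filterS; apply; last 3 first.
- by move=> n; exact: bigsetU_measurable.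
- move=> n; apply: le_trans (measure_bigsetU_le _ (mB n) (PB n)) _.
  rewrite size_iota lee_fin le_eqVlt; apply/orP; left; apply/eqP.
  by rewrite -muln2 natrM; field; rewrite addrC natr1 pnatr_eq0.
- exact: cvg_cst_harmonic.
- move=> [n w] /= h k kn; rewrite leNgt; apply/negP => Zk; apply: h.
  rewrite -bigcup_seq; exists k => //.
  have : k \in iota 0 n.+1.*2 by rewrite mem_iota.
  by [].
Qed.

(** A Gaussian coordinate has no atom at 0. The coefficient of index [n] becomes the leading one
    below, so this fixes the number of roots. *)
Lemma whp_coef_neq0 : whp P [set p | zeta p.1 p.2 != 0].
Proof.
have := @whp_le_cvg _ _ _ P (fun n => Z n.*2 @^-1` `[0, 0]) (fun=> 0) _ _ _.
move=> /(_ _ _ _)/filterS; apply; last 3 first.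
- by move=> n; rewrite -[X in measurable X]setTI; exact: measurable_funP.
- move=> n.
  have -> : P (Z n.*2 @^-1` `[0, 0]) = distribution P (Z n.*2) `[0, 0] by [].
  rewrite distZ//; apply: le_trans (normal_prob_itv sd_neq0 (lexx _)) _.
  by rewrite subrr mulr0.
- exact: cvg_cst.
- move=> [n w] /= h; apply/eqP => -[Z0 _]; apply: h.
  by rewrite in_itv/= Z0 lexx.
Qed.

(** A union bound: at most 4(n+1)^2 nodes, each failing with probability O(n^-4). The index [j0] of
    the dominant coefficient may depend on the node. *)
Lemma whp_nodes (X : nat -> seq R[i]) (u : nat -> R[i] -> nat -> R[i])
    (j0 : nat -> R[i] -> nat) :
  (forall n, (size (X n) <= 4 * n.+1 ^ 2)%N) ->
  (forall n x, (j0 n x <= n)%N /\ u n x (j0 n x) != 0) ->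
  whp P [set p | forall x, x \in X p.1 ->
    (p.1.+1%:R ^+ 4)^-1 * cmod (u p.1 x (j0 p.1 x)) <
    cmod (\sum_(j < p.1.+1) u p.1 x j * zeta j p.2)].
Proof.
move=> sX j0P.
have e0 n : 0 < (n.+1%:R ^+ 4)^-1 :> R by rewrite invr_gt0 exprn_gt0.
have /choice[B BP] : forall nx : nat * R[i], exists B : set T,
    [/\ measurable B, (P B <= (3 * normal_peak sd * (nx.1.+1%:R ^+ 4)^-1)%:E)%E &
     forall w, cmod (\sum_(j < nx.1.+1) u nx.1 nx.2 j * zeta j w) <=
       (nx.1.+1%:R ^+ 4)^-1 * cmod (u nx.1 nx.2 (j0 nx.1 nx.2)) -> B w].
  move=> [n x]; have [h1 h2] := j0P n x.
  exact: linear_form_anticoncentration.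
have pk0 : 0 <= normal_peak sd by exact: normal_peak_ge0.
have := @whp_le_cvg _ _ _ P (fun n => \big[setU/set0]_(x <- X n) B (n, x))
  (fun n => 12 * normal_peak sd / n.+1%:R) _ _ _.
move=> /(_ _ _ _)/filterS; apply; last 3 first.
- by move=> n; apply: bigsetU_measurable => x _; have [] := BP (n, x).
- move=> n; apply: le_trans (measure_bigsetU_le (c := 3 * normal_peak sd * (n.+1%:R ^+ 4)^-1) _ _ _) _.
  + by move=> x; have [] := BP (n, x).
  + by move=> x; have [] := BP (n, x).
  rewrite lee_fin.
  have n1 : 1 <= n.+1%:R :> R by rewrite ler1n.
  have sn : (size (X n))%:R <= 4 * n.+1%:R ^+ 2 :> R by rewrite -natrX -natrM ler_nat.
  apply: (@le_trans _ _ (4 * n.+1%:R ^+ 2 * (3 * normal_peak sd * (n.+1%:R ^+ 4)^-1))).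
    by rewrite ler_wpM2r// mulr_ge0 ?mulr_ge0// ltW.
  have -> : 4 * n.+1%:R ^+ 2 * (3 * normal_peak sd * (n.+1%:R ^+ 4)^-1) =
     12 * normal_peak sd * (n.+1%:R ^+ 2)^-1 :> R.
    by field; rewrite addrC natr1 pnatr_eq0.
  rewrite ler_wpM2l// ?mulr_ge0// lef_pV2 ?posrE ?exprn_gt0 ?ltr0n//.
  by rewrite expr2 ler_peMl.
- exact: cvg_cst_harmonic.
- move=> [n w] /= h x xX; rewrite ltNge; apply/negP => le; apply: h.
  by rewrite -bigcup_seq; exists x => //=; have [_ _] := BP (n, x); apply.
Qed.

End GaussianEvents.

(** * Empirical means of potentials over the roots of a weighted Gaussian polynomial *)

Section RandomPolynomial.
Context {R : realType} {d : measure_display} {T : measurableType d}.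
Variables (P : probability T R) (Z : nat -> {RV P >-> R}).
Hypothesis distZ : forall (n : nat) (A : set R), measurable A ->
  distribution P (Z n) A = normal_prob 0 (Num.sqrt (2^-1)) A.
Hypothesis indZ : mutually_independent P (fun n => (Z n : T -> R)).
Local Notation zeta := (xi (fun n => (Z n : T -> R))).
Local Notation "k %:C" := (complex.real_complex R k) : ring_scope.

Variables (A : nat -> nat -> R) (D m : nat -> nat) (Q : nat -> T -> {poly R[i]}).
Variables (H kappa : R).
Hypothesis A0 : forall n k, 0 < A n k.
Hypothesis Dm : forall n, (D n + m n)%N = n.
Hypothesis AH : forall n k, (k <= D n)%N -> A n k <= A n 0%N * H ^+ n.
Hypothesis H1 : 1 <= H.
Hypothesis kappa0 : 0 < kappa.
Hypothesis Dkappa : \forall n \near \oo, kappa * n%:R <= (D n)%:R.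
Hypothesis wQ : forall n w,
  weighted (A n) (D n) (Q n w) (fun k => zeta (k + m n) w).

Lemma lnM3 (x y z : R) : 0 < x -> 0 < y -> 0 < z ->
  ln (x * y * z) = ln x + ln y + ln z.
Proof. by move=> x0 y0 z0; rewrite !lnM ?posrE ?mulr_gt0. Qed.

Lemma near_ln_le (e : R) : 0 < e -> \forall n \near \oo, ln n.+1%:R <= e * n%:R :> R.
Proof.
move=> e0; have e20 : 0 < e / 2 by rewrite divr_gt0.
near=> n; have n1 : 0 < n.+1%:R :> R by rewrite ltr0n.
have h1 : ln n.+1%:R = ln (e / 2 * n.+1%:R) - ln (e / 2) :> R.
  by rewrite lnM ?posrE//; ring.
have h2 := ln_le_subr1 (mulr_gt0 e20 n1).
have h3 : (e / 2 - 1 - ln (e / 2)) / (e / 2) <= n%:R by near: n; exact: nbhs_infty_ger.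
rewrite ler_pdivrMr// in h3.
rewrite h1; move: h2; rewrite -[n.+1%:R]natr1; lra.
Unshelve. all: by end_near.
Qed.

(** Makes the number of nodes a power of 2 between (n+1)^2 and 4(n+1)^2: enough to absorb logarithms
    of order n, few enough for the union bound. *)
Definition node_exp n := (trunc_log 2 n.+1).+1.*2.

Lemma node_exp_bounds n : (n.+1 ^ 2 <= 2 ^ node_exp n <= 4 * n.+1 ^ 2)%N.
Proof.
rewrite /node_exp -muln2 expnM; apply/andP; split.
  by rewrite leq_exp2r// ltnW// trunc_log_ltn.
have -> : (4 * n.+1 ^ 2 = (2 * n.+1) ^ 2)%N by rewrite expnMn.
by rewrite leq_exp2r// expnS leq_mul2l/= trunc_logP.
Qed.

(** The deterministic substitute for the mean of ln |Q| / D over the nodes. The rotation [a] does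
    not appear, because the maximal term depends on the modulus only. *)
Definition jensen_mean n c (r : R) : R :=
  (2 ^ node_exp n)%:R^-1 * \sum_(w <- unity_roots R (2 ^ node_exp n))
    (D n)%:R^-1 * ln (max_term (A n) (D n) (cmod (c + r%:C * w))).

Lemma jensen_mean0 n r : 0 < r ->
  jensen_mean n 0 r = (D n)%:R^-1 * ln (max_term (A n) (D n) r).
Proof.
move=> r0; rewrite /jensen_mean; set N := (2 ^ _)%N.
have N0 : (0 < N)%N by rewrite expn_gt0.
rewrite (eq_big_seq (fun=> (D n)%:R^-1 * ln (max_term (A n) (D n) r))); last first.
  move=> w; rewrite mem_unity_roots// => /eqP wN.
  by rewrite add0r cmodM cmod_real gtr0_norm// (cmod_unity N0 wN) mulr1.
rewrite big_const_seq count_predT size_unity_roots// iter_addr_0.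
by rewrite -[(_ * _) *+ N]mulr_natl mulrA mulVf ?mul1r// pnatr_eq0 -lt0n.
Qed.

(** Two errors of e/2 each: the discrete Jensen formula, at most C/(n+1), and the replacement of |Q|
    by its maximal term at each node, at most (ln 2 + 4 ln(n+1))/D. *)
Lemma jensen_whp (a c : R[i]) (r : R) : cmod a = 1 -> 0 < r ->
  (fun p => emp (root_seq (Q p.1 p.2)) (lmax r (a * c)) +
     (D p.1)%:R^-1 * ln (cmod (lead_coef (Q p.1 p.2))) - jensen_mean p.1 c r)
  @ whp P --> (0 : R).
Proof.
move=> a1 r0; pose X n := [seq a * (c + r%:C * w) | w <- unity_roots R (2 ^ node_exp n)].
(* Writes Q(x) as a linear form in all of [zeta 0], ..., [zeta n], with zeros below the shift
   [m n]. *)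
pose u n x j : R[i] := if (m n <= j)%N then (A n (j - m n))%:C * x ^+ (j - m n) else 0.
pose j0 n x := (peak (A n) (D n) (cmod x) + m n)%N.
pose rho := cmod c + r + 1.
have c0 := cmod_ge0 c; have Hge1 := H1.
have rho1 : 1 <= rho by rewrite /rho; lra.
have N0 n : (0 < 2 ^ node_exp n)%N by rewrite expn_gt0.
have sX n : (size (X n) <= 4 * n.+1 ^ 2)%N.
  by rewrite size_map size_unity_roots//; have /andP[] := node_exp_bounds n.
have uj n x : u n x (j0 n x) = (A n (peak (A n) (D n) (cmod x)))%:C * x ^+ peak (A n) (D n) (cmod x).
  by rewrite /u /j0 leq_addl addnK.
have cu n x : cmod (u n x (j0 n x)) = max_term (A n) (D n) (cmod x).
  by rewrite uj cmodM cmod_real gtr0_norm// cmodX.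
have j0P n x : (j0 n x <= n)%N /\ u n x (j0 n x) != 0.
  split; last by rewrite -cmod_gt0 cu max_term_gt0.
  by rewrite /j0 -[leqRHS](Dm n) leq_add2r -ltnS.
have Qx n w x : (Q n w).[x] = \sum_(j < n.+1) u n x j * zeta j w.
  rewrite (weighted_horner (wQ n w)).
  rewrite -(big_mkord xpredT (fun j => u n x j * zeta j w)).
  have mn : (m n <= n)%N by rewrite -[leqRHS](Dm n) leq_addl.
  rewrite (big_cat_nat (n := m n))//=; last exact: leqW.
  rewrite [X in _ = X + _]big_nat [X in _ = X + _]big1 ?add0r => [|j /andP[_ jm]]; last by rewrite /u leqNgt jm mul0r.
  transitivity (\sum_(0 + m n <= i < n.+1) u n x i * zeta i w); last by rewrite add0n.
  rewrite big_addn.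
  have -> : (n.+1 - m n = (D n).+1)%N by rewrite -{1}(Dm n) -addSn addnK.
  rewrite big_mkord; apply: eq_bigr => k _; rewrite /u leq_addl addnK.
  by rewrite mulrAC.
have Hn n : 1 <= H ^+ n by rewrite exprn_ege1.
have nodes := whp_nodes distZ indZ sX j0P.
apply/cvgrPdist_le => e e0.
(* The kernel gives one [ln 2]; the rest bounds |ln(eta / r)| / (n+1) for the [eta] below, using
   ln(n+1) <= n. *)
pose C := ln 2 + ln 2 + 7 + ln (H * rho) + `|ln r|.
have Hr1 : 1 <= H * rho by nra.
have C0 : 0 <= C.
  by rewrite /C !addr_ge0// ?ln_ge0// ler1n.
have large : \forall n \near \oo, [/\ (0 < D n)%N, C / n.+1%:R <= e / 2,
    (ln 2 + 4 * ln n.+1%:R) / (D n)%:R <= e / 2 & ln n.+1%:R <= n%:R :> R].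
  have e2 : 0 < e / 2 by rewrite divr_gt0.
  have ek : 0 < e * kappa / 16 by rewrite divr_gt0// mulr_gt0.
  near=> n.
  have n1 : 1 <= n%:R :> R by near: n; exact: nbhs_infty_ger.
  have h1 : ln n.+1%:R <= (e * kappa / 16) * n%:R by near: n; exact: near_ln_le.
  have h2 : kappa * n%:R <= (D n)%:R by near: n; exact: Dkappa.
  have h3 : ln 2 / (e * kappa / 16) <= n%:R by near: n; exact: nbhs_infty_ger.
  have h4 : ln n.+1%:R <= 1 * n%:R :> R by near: n; apply: near_ln_le.
  have h5 : C / (e / 2) <= n%:R by near: n; exact: nbhs_infty_ger.
  have Dn0 : 0 < (D n)%:R :> R by apply: lt_le_trans h2; rewrite mulr_gt0//; lra.
  rewrite ler_pdivrMr// in h3; rewrite ler_pdivrMr// in h5.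
  split.
  - by rewrite -(ltr0n R).
  - rewrite ler_pdivrMr ?ltr0n//; apply: le_trans h5 _.
    by rewrite mulrC ler_pM2l// ler_nat.
  - rewrite ler_pdivrMr//.
    have : e / 2 * (kappa * n%:R) <= e / 2 * (D n)%:R by rewrite ler_pM2l.
    have -> : e / 2 * (kappa * n%:R) = 8 * (e * kappa / 16 * n%:R) by field.
    have : 0 <= e * kappa / 16 * n%:R by rewrite mulr_ge0// ltW.
    lra.
  - by rewrite mul1r in h4.
near=> p.
have [Dn0 hC hD hln] : [/\ (0 < D p.1)%N, C / p.1.+1%:R <= e / 2,
    (ln 2 + 4 * ln p.1.+1%:R) / (D p.1)%:R <= e / 2 & ln p.1.+1%:R <= p.1%:R :> R].
  by near: p; apply: whp_eventually; apply: filterS large => n h w.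
have zn : zeta p.1 p.2 != 0 by near: p; exact: whp_coef_neq0.
have Zk k : (k < p.1.+1.*2)%N -> `|Z k p.2| <= p.1.+1%:R.
  by move: k; near: p; exact: whp_coef_le.
have nd x : x \in X p.1 -> (p.1.+1%:R ^+ 4)^-1 * cmod (u p.1 x (j0 p.1 x)) <
    cmod (\sum_(j < p.1.+1) u p.1 x j * zeta j p.2).
  by move: x; near: p.
move: zn Zk nd Dn0 hC hD hln; move: (p.1) (p.2) => n w zn Zk nd Dn0 hC hD hln.
set N := (2 ^ node_exp n)%N; have N0' : (0 < N)%N by exact: N0.
have n1 : 1 <= n.+1%:R :> R by rewrite ler1n.
have np : 0 < n.+1%:R :> R by rewrite ltr0n.
pose L : R := 2 * n.+1%:R.
have zL k : (k <= D n)%N -> cmod (zeta (k + m n) w) <= L.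
  move=> kD; apply: le_trans (cmod_le _) _; rewrite /= /L mulr2n mulrDl mul1r.
  have kn : (k + m n <= n)%N by rewrite -[leqRHS](Dm n) leq_add2r.
  by apply: lerD; apply: Zk; rewrite ?ltn_double// doubleS !ltnS leq_double.
have szQ : size (Q n w) = (D n).+1.
  by apply: (weighted_size (A0 n) (wQ n w)); rewrite Dm.
have Q0 : Q n w != 0 by rewrite -size_poly_gt0 szQ.
have szr : size (root_seq (Q n w)) = D n by rewrite size_root_seq// szQ.
have nodeX v : v ^+ N = 1 -> a * (c + r%:C * v) \in X n.
  by move=> vN; apply: map_f; rewrite mem_unity_roots// vN.
have nodeM v : v ^+ N = 1 -> (n.+1%:R ^+ 4)^-1 * max_term (A n) (D n) (cmod (c + r%:C * v)) <
    cmod (Q n w).[a * (c + r%:C * v)].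
  by move=> vN; have := nd _ (nodeX _ vN); rewrite cu -Qx cmodM a1 mul1r.
(* Chosen so that [eta] times the factor 2 (n+1)^3 (H rho)^n from [cmod_weighted_near_root] is
   exactly the anticoncentration threshold (n+1)^-4. *)
pose eta : R := (2 * n.+1%:R ^+ 7 * (H * rho) ^+ n)^-1.
have Hrn : 1 <= (H * rho) ^+ n by rewrite exprn_ege1.
have n7 : 1 <= n.+1%:R ^+ 7 :> R by rewrite exprn_ege1.
have Ge1 : 1 <= 2 * n.+1%:R ^+ 7 * (H * rho) ^+ n by nra.
have eta0 : 0 < eta by rewrite invr_gt0; lra.
have eta1 : eta <= 1 by rewrite invf_le1//; lra.
have far z v : z \in root_seq (Q n w) -> v ^+ N = 1 ->
    eta <= cmod (z - a * (c + r%:C * v)).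
  move=> zr vN; rewrite leNgt; apply/negP => lt.
  set x := a * (c + r%:C * v).
  have cx : cmod x = cmod (c + r%:C * v) by rewrite cmodM a1 mul1r.
  have cxr : cmod x + 1 <= rho.
    rewrite cx /rho lerD2r; apply: le_trans (cmodD_le _ _) _.
    by rewrite cmodM cmod_real gtr0_norm// (cmod_unity (N0 n) vN) mulr1.
  have xz : cmod (x - z) <= eta by rewrite cmodC ltW.
  have := cmod_weighted_near_root (A0 n) (wQ n w) zL (@AH n) (root_seq_root zr) xz eta1.
  apply/negP; rewrite -ltNge; apply: le_lt_trans (nodeM _ vN).
  rewrite cx ler_pM2r ?max_term_gt0//.
  have rhon : (cmod (c + r%:C * v) + 1) ^+ D n <= rho ^+ n.
    rewrite -cx; apply: (@le_trans _ _ (rho ^+ D n)).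
      rewrite lerXn2r ?nnegrE//; first by have := cmod_ge0 x; lra.
      lra.
    by rewrite ler_weXn2l// -[leqRHS](Dm n) leq_addr.
  have DnR : (D n).+1%:R ^+ 2 <= n.+1%:R ^+ 2 :> R.
    by rewrite lerXn2r ?nnegrE// ler_nat ltnS -[leqRHS](Dm n) leq_addr.
  apply: (@le_trans _ _ (eta * (L * n.+1%:R ^+ 2 * H ^+ n * rho ^+ n))).
    rewrite ler_pM2l//; apply: ler_pM => //.
    - by rewrite !mulr_ge0 ?exprn_ge0//; lra.
    - by rewrite exprn_ge0// addr_ge0// cmod_ge0.
    - rewrite ler_pM2r; last by apply: lt_le_trans (Hn n).
      by rewrite ler_pM2l// /L mulr_gt0.
  rewrite /eta /L exprMn le_eqVlt; apply/orP; left; apply/eqP.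
  field; rewrite addrC natr1 pnatr_eq0/= !expf_neq0// gt_eqF//; lra.
have J := discrete_jensen Q0 r0 eta0 a1 far.
rewrite szr -/N in J.
have NR : n.+1%:R ^+ 2 <= N%:R :> R.
  by rewrite -natrX ler_nat; have /andP[] := node_exp_bounds n.
have NR0 : 0 < N%:R :> R by apply: lt_le_trans NR; rewrite exprn_gt0.
have Jle : (ln 2 + `|ln (eta / r)|) / N%:R <= e / 2.
  apply: le_trans hC.
  have lneta : ln (eta / r) = - (ln 2 + 7 * ln n.+1%:R + n%:R * ln (H * rho)) - ln r.
    have Hr0 : 0 < H * rho by lra.
    rewrite ln_div ?posrE// /eta lnV ?posrE; last lra.
    rewrite lnM3 ?exprn_gt0// !lnXn//.
    by rewrite -[ln n.+1%:R *+ 7]mulr_natl -[ln _ *+ n]mulr_natl.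
  have lnH0 : 0 <= ln (H * rho) by rewrite ln_ge0.
  have lnn0 : 0 <= ln n.+1%:R :> R by rewrite ln_ge0.
  have ln20 : 0 <= ln 2 :> R by rewrite ln_ge0// ler1n.
  have bd : ln 2 + `|ln (eta / r)| <= C * n.+1%:R.
    rewrite lneta; apply: le_trans (lerD (lexx _) (ler_normB _ _)) _.
    rewrite normrN ger0_norm; last by rewrite !addr_ge0// mulr_ge0.
    have r0' := normr_ge0 (ln r).
    move: hln lnn0; set l := ln n.+1%:R => hln lnn0.
    rewrite /C -[n.+1%:R]natr1; set nn := n%:R in hln *.
    have nn0 : 0 <= nn by rewrite /nn.
    by have := mulr_ge0 ln20 nn0; have := mulr_ge0 r0' nn0; lra.
  rewrite ler_pdivrMr//; apply: le_trans bd _.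
  rewrite mulrAC ler_pdivlMr// -mulrA ler_wpM2l//.
set S1 := _ * \sum_(w0 <- _) _ in J.
(* At every node |Q| lies between (n+1)^-4 and 2(n+1)^2 times the maximal term. *)
have S1J : `|S1 - jensen_mean n c r| <= e / 2.
  rewrite /S1 /jensen_mean -/N -mulrBr -sumrB normrM gtr0_norm ?invr_gt0//.
  rewrite ler_pdivrMl//; apply: le_trans (ler_norm_sum _ _ _) _.
  rewrite big_seq; apply: (@le_trans _ _ (\sum_(v <- unity_roots R N | v \in unity_roots R N) e / 2)); last first.
    by rewrite -big_seq big_const_seq count_predT size_unity_roots// iter_addr_0 -[e / 2 *+ _]mulr_natl.
  apply: ler_sum => v; rewrite mem_unity_roots// => /eqP vN.
  rewrite -mulrBr normrM ger0_norm ?invr_ge0//; apply: le_trans hD.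
  rewrite mulrC ler_pM2r ?invr_gt0 ?ltr0n//.
  set x := a * (c + r%:C * v).
  have cx : cmod x = cmod (c + r%:C * v) by rewrite cmodM a1 mul1r.
  have M0 := max_term_gt0 (D n) (A0 n) (cmod (c + r%:C * v)).
  set M := max_term _ _ _ in M0 *.
  have lo := nodeM _ vN; rewrite -/x -/M in lo.
  have n40 : 0 < n.+1%:R ^+ 4 :> R by rewrite exprn_gt0.
  have Qx0 : 0 < cmod (Q n w).[x] by apply: lt_trans lo; rewrite mulr_gt0// invr_gt0.
  have up : cmod (Q n w).[x] <= 2 * n.+1%:R ^+ 2 * M.
    have := cmod_weighted_le (A0 n) (wQ n w) x zL; rewrite cx -/M => /le_trans; apply.
    rewrite ler_pM2r// /L.
    have : (D n).+1%:R <= n.+1%:R :> R by rewrite ler_nat ltnS -[leqRHS](Dm n) leq_addr.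
    by nra.
  have lnn0 : 0 <= ln n.+1%:R :> R by rewrite ln_ge0.
  have ln20 : 0 <= ln 2 :> R by rewrite ln_ge0// ler1n.
  rewrite ler_norml; apply/andP; split.
    have : ln ((n.+1%:R ^+ 4)^-1 * M) <= ln (cmod (Q n w).[x]).
      have lo0 : 0 < (n.+1%:R ^+ 4)^-1 * M by rewrite mulr_gt0// invr_gt0.
      by rewrite ler_ln ?posrE// ltW.
    rewrite lnM ?posrE ?invr_gt0// lnV ?posrE// lnXn// -[ln n.+1%:R *+ 4]mulr_natl.
    lra.
  have : ln (cmod (Q n w).[x]) <= ln (2 * n.+1%:R ^+ 2 * M).
    by rewrite ler_ln ?posrE// (lt_le_trans Qx0 up).
  rewrite lnM3 ?exprn_gt0// lnXn// -[ln n.+1%:R *+ 2]mulr_natl.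
  lra.
rewrite sub0r normrN.
set E := emp _ _ + _ in J *.
have -> : E - jensen_mean n c r = (E - S1) + (S1 - jensen_mean n c r) by ring.
apply: le_trans (ler_normD _ _) _.
by have := le_trans J Jle; lra.
Unshelve. all: by end_near.
Qed.

(** The leading coefficient and [jensen_mean] are the same for [a] and for 1, so both cancel. *)
Lemma rotation_good_whp :
  rotation_good (whp P) (fun p => root_seq (Q p.1 p.2)).
Proof.
move=> r c a r0 a1.
pose E b p := emp (root_seq (Q p.1 p.2)) (lmax r (b * c)) +
     (D p.1)%:R^-1 * ln (cmod (lead_coef (Q p.1 p.2))) - jensen_mean p.1 c r.
rewrite (_ : (fun i => _) = (fun p => E a p - E 1 p)); last first.
  by apply/funext => p; rewrite /E mul1r; ring.
rewrite -[X in _ --> X](subr0 (0 : R)).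
by apply: cvgB; apply: jensen_whp => //; exact: cmod1.
Qed.

Lemma jensen_radial_whp r1 r2 : 0 < r1 -> 0 < r2 ->
  (fun p => emp (root_seq (Q p.1 p.2)) (lmax r2 0) -
      emp (root_seq (Q p.1 p.2)) (lmax r1 0) -
      (D p.1)%:R^-1 * (ln (max_term (A p.1) (D p.1) r2) -
         ln (max_term (A p.1) (D p.1) r1)))
  @ whp P --> (0 : R).
Proof.
move=> r10 r20.
pose E r p := emp (root_seq (Q p.1 p.2)) (lmax r (1 * 0)) +
     (D p.1)%:R^-1 * ln (cmod (lead_coef (Q p.1 p.2))) - jensen_mean p.1 0 r.
rewrite (_ : (fun i => _) = (fun p => E r2 p - E r1 p)); last first.
  by apply/funext => p; rewrite /E mul1r !jensen_mean0//; ring.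
rewrite -[X in _ --> X](subr0 (0 : R)).
by apply: cvgB; apply: jensen_whp => //; exact: cmod1.
Qed.

(** The derivative of [lmax r 0] with respect to ln r is the indicator of the disk; this lemma and
    the next bracket its difference quotients. *)
Lemma lmaxB_le_disk (r1 r2 : R) (q : R * R) : 0 < r1 -> r1 < r2 ->
  lmax r2 0 q - lmax r1 0 q <= (ln r2 - ln r1) * disk_ind r2 q.
Proof.
move=> r10 r12; rewrite /lmax /disk_ind subr0; set x := cmod _.
have r20 : 0 < r2 by apply: lt_trans r12.
have [xr|xr] := ltP x r2.
  rewrite mulr1 lerD2l lerN2 ler_ln ?posrE ?lt_max ?r10//.
  by rewrite le_max lexx.
by rewrite mulr0 max_r ?subrr// (le_trans (ltW r12)).
Qed.

Lemma disk_le_lmaxB (r1 r2 : R) (q : R * R) : 0 < r1 -> r1 < r2 ->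
  (ln r2 - ln r1) * disk_ind r1 q <= lmax r2 0 q - lmax r1 0 q.
Proof.
move=> r10 r12; rewrite /lmax /disk_ind subr0; set x := cmod _.
have r20 : 0 < r2 by apply: lt_trans r12.
have [xr|xr] := ltP x r1.
  by rewrite mulr1 (max_l (ltW (lt_trans xr r12))).
have x0 : 0 < x by apply: lt_le_trans xr.
by rewrite mulr0 subr_ge0 ler_ln ?posrE ?lt_max ?x0 ?orbT// le_max lexx orbT.
Qed.

Section RadialLimit.
Variables (G : R -> R) (edge : R).
Hypothesis peakG : forall r, 0 < r -> r < edge ->
  (fun n => (peak (A n) (D n) r)%:R / (D n)%:R) @ \oo --> G r.
Hypothesis G_left : forall r e, 0 < r -> 0 < e ->
  exists r1, [/\ 0 < r1, r1 < r, r1 < edge & G r - e <= G r1].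
Hypothesis G_right : forall r e, 0 < r -> r < edge -> 0 < e ->
  exists r2, [/\ r < r2, r2 < edge & G r2 <= G r + e].
Hypothesis G_edge : forall r, edge <= r -> G r = 1.

(** Difference quotients in ln r, to the left of [r] for the lower bound and to the right for the
    upper one, compare the disk with the subgradient [peak / D]. The three thirds of [e] pay for the
    Jensen error, the convergence of the peak and the variation of [G]. *)
Lemma radial_cdf_whp r : 0 < r ->
  (fun p => emp (root_seq (Q p.1 p.2)) (disk_ind r)) @ whp P --> G r.
Proof.
move=> r0; apply/cvgrPdist_le => e e0; have e30 : 0 < e / 3 by rewrite divr_gt0.
have lower : \forall p \near whp P,
    G r - e <= emp (root_seq (Q p.1 p.2)) (disk_ind r).
  have [r1 [r10 r1r r1e Gr1]] := G_left r0 e30.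
  have D0 : 0 < ln r - ln r1 by rewrite subr_gt0 ltr_ln ?posrE.
  have De : 0 < (ln r - ln r1) * (e / 3) by rewrite mulr_gt0.
  have /cvgrPdist_le/(_ _ De) X := jensen_radial_whp r10 r0.
  have /cvgrPdist_le/(_ _ e30) Y := cvg_whp_cst P (peakG r10 r1e).
  near=> p.
  have X' : `|0 - (emp (root_seq (Q p.1 p.2)) (lmax r 0) -
      emp (root_seq (Q p.1 p.2)) (lmax r1 0) -
      (D p.1)%:R^-1 * (ln (max_term (A p.1) (D p.1) r) -
         ln (max_term (A p.1) (D p.1) r1)))| <= (ln r - ln r1) * (e / 3) by near: p.
  have Y' : `|G r1 - (peak (A p.1) (D p.1) r1)%:R / (D p.1)%:R| <= e / 3 by near: p.
  have h1 := le_emp (root_seq (Q p.1 p.2)) (fun q => lmaxB_le_disk q r10 r1r).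
  rewrite empB empZ in h1.
  have h2 := ln_max_termB_ge (D p.1) (A0 p.1) r10 r0.
  have Di0 : 0 <= (D p.1)%:R^-1 :> R by rewrite invr_ge0.
  have h3 := ler_wpM2l Di0 h2.
  rewrite sub0r normrN ler_norml in X'; move/andP: X' => [X1 X2].
  rewrite ler_norml in Y'; move/andP: Y' => [Y1 Y2].
  rewrite -(ler_pM2l D0).
  set E := emp _ (disk_ind r) in h1 *; set pk := (peak _ _ _)%:R in h2 h3 Y1 Y2.
  have h4 : (ln r - ln r1) * (G r1 - e / 3) <= (D p.1)%:R^-1 * (pk * (ln r - ln r1)).
    have -> : (D p.1)%:R^-1 * (pk * (ln r - ln r1)) = (ln r - ln r1) * (pk / (D p.1)%:R) by ring.
    by rewrite ler_pM2l//; lra.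
  have h5 : (ln r - ln r1) * (G r - e) <= (ln r - ln r1) * (G r1 - e / 3) - (ln r - ln r1) * (e / 3).
    by rewrite -mulrBr ler_pM2l//; lra.
  lra.
have upper : \forall p \near whp P,
    emp (root_seq (Q p.1 p.2)) (disk_ind r) <= G r + e.
  (* Past the edge there is no control of the peak, but there [G r = 1] bounds every empirical
     mean. *)
  have [re|re] := leP edge r.
    apply: nearW => p; rewrite G_edge//.
    apply: (@le_trans _ _ (emp (root_seq (Q p.1 p.2)) (fun=> 1))).
      by apply: le_emp => q; rewrite /disk_ind; case: (_ < _).
    by apply: le_trans (emp_cst_le _ _) _ => //; lra.
  have [r2 [rr2 r2e Gr2]] := G_right r0 re e30.
  have r20 : 0 < r2 by apply: lt_trans rr2.
  have D0 : 0 < ln r2 - ln r by rewrite subr_gt0 ltr_ln ?posrE.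
  have De : 0 < (ln r2 - ln r) * (e / 3) by rewrite mulr_gt0.
  have /cvgrPdist_le/(_ _ De) X := jensen_radial_whp r0 r20.
  have /cvgrPdist_le/(_ _ e30) Y := cvg_whp_cst P (peakG r20 r2e).
  near=> p.
  have X' : `|0 - (emp (root_seq (Q p.1 p.2)) (lmax r2 0) -
      emp (root_seq (Q p.1 p.2)) (lmax r 0) -
      (D p.1)%:R^-1 * (ln (max_term (A p.1) (D p.1) r2) -
         ln (max_term (A p.1) (D p.1) r)))| <= (ln r2 - ln r) * (e / 3) by near: p.
  have Y' : `|G r2 - (peak (A p.1) (D p.1) r2)%:R / (D p.1)%:R| <= e / 3 by near: p.
  have h1 := le_emp (root_seq (Q p.1 p.2)) (fun q => disk_le_lmaxB q r0 rr2).
  rewrite empB empZ in h1.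
  have h2 := ln_max_termB_le (D p.1) (A0 p.1) r0 r20.
  have Di0 : 0 <= (D p.1)%:R^-1 :> R by rewrite invr_ge0.
  have h3 := ler_wpM2l Di0 h2.
  rewrite sub0r normrN ler_norml in X'; move/andP: X' => [X1 X2].
  rewrite ler_norml in Y'; move/andP: Y' => [Y1 Y2].
  rewrite -(ler_pM2l D0).
  set E := emp _ (disk_ind r) in h1 *; set pk := (peak _ _ _)%:R in h2 h3 Y1 Y2.
  have h4 : (D p.1)%:R^-1 * (pk * (ln r2 - ln r)) <= (ln r2 - ln r) * (G r2 + e / 3).
    have -> : (D p.1)%:R^-1 * (pk * (ln r2 - ln r)) = (ln r2 - ln r) * (pk / (D p.1)%:R) by ring.
    by rewrite ler_pM2l//; lra.
  have h5 : (ln r2 - ln r) * (G r2 + e / 3) + (ln r2 - ln r) * (e / 3) <= (ln r2 - ln r) * (G r + e).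
    by rewrite -mulrDr ler_pM2l//; lra.
  lra.
near=> p; have lo : G r - e <= emp (root_seq (Q p.1 p.2)) (disk_ind r) by near: p.
have up : emp (root_seq (Q p.1 p.2)) (disk_ind r) <= G r + e by near: p.
by rewrite ler_norml; apply/andP; split; lra.
Unshelve. all: by end_near.
Qed.

End RadialLimit.

End RandomPolynomial.

(** * The limit law on disks *)

Section LimitCdf.
Variable R : realType.
Implicit Types t r x e k z w : R.

(* The value of the limit law on the open disk of radius r. *)
Definition limit_cdf t r : R :=
  if r < (1 - t)^-1 then t * (1 - t) * r / (1 - (1 - t) ^+ 2 * r) else 1.

Lemma limit_cdf_edge t r : (1 - t)^-1 <= r -> limit_cdf t r = 1.
Proof. by move=> h; rewrite /limit_cdf ltNge h. Qed.

Lemma limit_cdf_den t r : 0 < t < 1 -> r <= (1 - t)^-1 ->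
  t <= 1 - (1 - t) ^+ 2 * r.
Proof.
move=> /andP[t0 t1] re; have s0 : 0 < 1 - t by lra.
have : (1 - t) * r <= 1.
  by rewrite mulrC -ler_pdivlMr// mul1r.
by move=> h; rewrite expr2 -mulrA; nra.
Qed.

(** The two branches agree at the edge, where the denominator equals [t]. *)
Lemma limit_cdf_closed t r : 0 < t < 1 -> r <= (1 - t)^-1 ->
  limit_cdf t r = t * (1 - t) * r / (1 - (1 - t) ^+ 2 * r).
Proof.
move=> t01; rewrite le_eqVlt => /orP[/eqP->|re]; last by rewrite /limit_cdf re.
rewrite limit_cdf_edge//; have /andP[t0 t1] := t01.
have t1' : 1 - t != 0 by rewrite subr_eq0 gt_eqF.
have -> : 1 - (1 - t) ^+ 2 * (1 - t)^-1 = t by field.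
by field; rewrite t1' gt_eqF.
Qed.

(** The difference is t(1-t)(y-x) over a product of two denominators, each at least [t]. *)
Lemma limit_cdf_lip t x y : 0 < t < 1 -> 0 <= x -> x <= y -> y <= (1 - t)^-1 ->
  limit_cdf t y - limit_cdf t x <= (y - x) / t.
Proof.
move=> t01 x0 xy ye; have /andP[t0 t1] := t01.
have xe : x <= (1 - t)^-1 by apply: le_trans ye.
rewrite !limit_cdf_closed//.
have dx := limit_cdf_den t01 xe; have dy := limit_cdf_den t01 ye.
set a := 1 - (1 - t) ^+ 2 * x in dx *; set b := 1 - (1 - t) ^+ 2 * y in dy *.
have a0 : 0 < a by apply: lt_le_trans dx.
have b0 : 0 < b by apply: lt_le_trans dy.
have -> : t * (1 - t) * y / b - t * (1 - t) * x / a = t * (1 - t) * (y - x) / (a * b).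
  rewrite /a /b; field; rewrite -/a -/b !gt_eqF//.
rewrite ler_pdivrMr ?mulr_gt0// [leRHS]mulrAC ler_pdivlMr//.
have h1 : t * t <= a * b by apply: ler_pM => //; exact: ltW.
have yx : 0 <= y - x by rewrite subr_ge0.
have h2 := ler_wpM2l yx h1.
have -> : t * (1 - t) * (y - x) * t = (1 - t) * ((y - x) * (t * t)) by ring.
apply: le_trans h2; rewrite ler_piMl//; last by lra.
by rewrite mulr_ge0// mulr_ge0// ltW.
Qed.

Lemma limit_cdf_left t r e : 0 < t < 1 -> 0 < r -> 0 < e ->
  exists r1, [/\ 0 < r1, r1 < r, r1 < (1 - t)^-1 & limit_cdf t r - e <= limit_cdf t r1].
Proof.
move=> t01 r0 e0; have /andP[t0 t1] := t01.
have ed0 : 0 < (1 - t)^-1 by rewrite invr_gt0 subr_gt0.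
(* Beyond the edge the function is constant, so the approximation from the left may start at the
   edge. *)
have [r' [r'0 r'r r'e Gr']] : exists r', [/\ 0 < r', r' <= r, r' <= (1 - t)^-1 &
    limit_cdf t r' = limit_cdf t r].
  have [h|h] := leP r (1 - t)^-1; first by exists r.
  by exists (1 - t)^-1; split => //; [exact: ltW|rewrite !limit_cdf_edge// ltW].
have et0 : 0 < e * t by rewrite mulr_gt0.
have [r1 [r10 r1r' r1e]] : exists r1, [/\ 0 < r1, r1 < r' & r' - r1 <= e * t].
  have [h|h] := leP r' (2 * (e * t)).
    by exists (r' / 2); split; lra.
  by exists (r' - e * t); split; lra.
exists r1; split => //; first exact: lt_le_trans r'r.
  exact: lt_le_trans r'e.
have := limit_cdf_lip t01 (ltW r10) (ltW r1r') r'e; rewrite Gr'.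
have : (r' - r1) / t <= e by rewrite ler_pdivrMr.
lra.
Qed.

Lemma limit_cdf_right t r e : 0 < t < 1 -> 0 < r -> r < (1 - t)^-1 -> 0 < e ->
  exists r2, [/\ r < r2, r2 < (1 - t)^-1 & limit_cdf t r2 <= limit_cdf t r + e].
Proof.
move=> t01 r0 re e0; have /andP[t0 t1] := t01.
have et0 : 0 < e * t by rewrite mulr_gt0.
set ed := (1 - t)^-1 in re *.
have [r2 [rr2 r2e r2r]] : exists r2, [/\ r < r2, r2 < ed & r2 - r <= e * t].
  have [h|h] := leP (ed - r) (e * t).
    by exists ((r + ed) / 2); split; lra.
  by exists (r + e * t / 2); split; lra.
exists r2; split => //.
have := limit_cdf_lip t01 (ltW r0) (ltW rr2) (ltW r2e).
have : (r2 - r) / t <= e by rewrite ler_pdivrMr.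
lra.
Qed.

Lemma Rintegral_dirac1 (f : R -> R) : measurable_fun setT f ->
  Rintegral (haar_aa R) setT f = f 1.
Proof.
move=> mf; rewrite /Rintegral /haar_aa integral_dirac//; last exact/measurable_EFinP.
by rewrite diracT mul1e.
Qed.

Lemma lambda2_haar : lambda2 (haar_abs R) = 1.
Proof.
by rewrite /lambda2 (@Rintegral_dirac1 (fun x => x ^+ 2)) ?expr1n ?sqrtr1.
Qed.

Lemma measurable_inv : measurable_fun setT (fun x : R => x^-1).
Proof.
have -> : [set: R] = [set~ 0] `|` [set 0].
  by apply/seteqP; split => // x _; have [->|/eqP x0] := eqVneq x 0; [right|left].
apply/measurable_funU => //; first exact: measurableC.
split; last exact: measurable_fun_set1.
apply: open_continuous_measurable_fun.
  have -> : [set~ 0] = [set x : R | x < 0] `|` [set x : R | 0 < x].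
    apply/seteqP; split => x /=; first by move/eqP; rewrite neq_lt => /orP[]; [left|right].
    by move=> [] h e; move: h; rewrite e ltxx.
  by apply: openU; [exact: open_lt|exact: open_gt].
by move=> x; rewrite inE/= => /eqP x0; exact: inv_continuous.
Qed.

Lemma Strans_haar z : -1 < z < 0 -> Strans (haar_aa R) z = 1.
Proof.
move=> /andP[z1 z0]; rewrite /Strans.
have MtE y : Mtrans (haar_aa R) y = y / (1 - y).
  rewrite /Mtrans (@Rintegral_dirac1 (fun u => y * u / (1 - y * u))) ?mulr1//.
  apply: measurable_funM; first exact: measurable_funM.
  apply: measurableT_comp; first exact: measurable_inv.
  by apply: measurable_funB => //; exact: measurable_funM.
have z10 : 1 + z != 0 by rewrite gt_eqF//; lra.
have -> : Minv (haar_aa R) z = z / (1 + z).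
  apply: xget_unique => [|y [y0]].
    split; first by rewrite pmulr_llt0// invr_gt0; lra.
    by rewrite MtE; field; rewrite z10/= gt_eqF//; lra.
  rewrite MtE => yz; have y1 : 1 - y != 0 by rewrite gt_eqF//; lra.
  have -> : z = y / (1 - y) by [].
  by field; rewrite y1 subrK oner_eq0.
by field; rewrite z10 lt_eqF.
Qed.

Lemma oplus_cdf_haar k x : 1 < k -> 0 < x ->
  oplus_cdf (haar_aa R) (haar_abs R) k x =
  if x < Num.sqrt k then (k - 1) * x ^+ 2 / (k ^+ 2 - x ^+ 2) else 1.
Proof.
move=> k1 x0; rewrite /oplus_cdf lambda2_haar mulr1; case: ifP => // xk.
have k0 : 0 < k by lra.
have x2k : x ^+ 2 < k.
  by rewrite -[ltRHS](sqr_sqrtr (ltW k0)) ltrXn2r ?nnegrE ?sqrtr_ge0 ?ltW.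
have x20 : 0 < x ^+ 2 by rewrite exprn_gt0.
set X := x ^+ 2 in x2k x20 *.
have den : 0 < k ^+ 2 - X by rewrite expr2; nra.
have kX : 0 < k - X by lra.
have aa0 : fine (haar_aa R [set 0]) = 0.
  rewrite (_ : haar_aa R [set 0] = \d_(1 : R) [set 0])// diracE memNset//= => h1.
  by move/eqP: h1; rewrite oner_eq0.
have kn0 : k != 0 by rewrite gt_eqF.
have zk z : - k < z < 0 -> -1 < z / k < 0.
  move=> /andP[a b]; apply/andP; split.
    by rewrite ltr_pdivlMr// mulN1r.
  by rewrite pmulr_llt0// invr_gt0.
have SkE z : - k < z < 0 -> Sk (haar_aa R) k z = (1 + z / k) / (k * (1 + z)).
  by move=> h; rewrite /Sk Strans_haar ?mulr1//; exact: zk.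
rewrite /Sk_inv aa0 subr0 mulr1.
(* The root of X (k + z) = k^2 (1 + z), that is, of S_k(z) = 1/X with denominators cleared. *)
pose z0 := - (k * (k - X) / (k ^+ 2 - X)).
have z0k : - k < z0 < 0.
  rewrite /z0; apply/andP; split.
    by rewrite ltrN2 ltr_pdivrMr// ltr_pM2l// ltrD2r expr2 ltr_pMr.
  by rewrite oppr_lt0 divr_gt0// mulr_gt0.
have -> : xget 0 [set z | - k < z < 0 /\ Sk (haar_aa R) k z = X^-1] = z0.
  apply: xget_unique => [|z [zk1]].
    split => //; rewrite SkE//.
    have dn : k ^+ 2 - X != 0 by rewrite gt_eqF.
    have -> : 1 + z0 / k = k * (k - 1) / (k ^+ 2 - X) by rewrite /z0; field; rewrite dn.
    have -> : 1 + z0 = (k - 1) * X / (k ^+ 2 - X) by rewrite /z0; field.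
    by field; rewrite dn kn0 !gt_eqF//; lra.
  rewrite SkE// => e.
  (* At z = -1 the quotient is 0 by the convention on inverses, hence different from 1/X. *)
  have z1 : 1 + z != 0.
    apply: contra_eq_neq e => ->; rewrite mulr0 invr0 mulr0 eq_sym invr_eq0.
    by rewrite gt_eqF.
  have h : 1 + z / k = X^-1 * (k * (1 + z)) by rewrite -e divfK// mulf_neq0.
  have h2 : X * (k + z) = k ^+ 2 * (1 + z).
    have -> : X * (k + z) = X * k * (1 + z / k) by field.
    by rewrite h; field; rewrite gt_eqF.
  have h3 : z * (k ^+ 2 - X) = - (k * (k - X)) by lra.
  by rewrite /z0 -mulNr -h3 mulfK// gt_eqF.
by rewrite /z0; field; rewrite gt_eqF.
Qed.

Lemma measurable_closed_disk (r : R) : measurable (closed_disk r).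
Proof.
rewrite [X in measurable X](_ : _ = (fun p : R * R => p.1 ^+ 2 + p.2 ^+ 2) @^-1` `]-oo, r ^+ 2]).
  rewrite -[X in measurable X]setTI.
  have m : measurable_fun setT (fun p : R * R => p.1 ^+ 2 + p.2 ^+ 2).
    by apply: measurable_funD; apply: measurable_funX.
  exact: m.
by apply/seteqP; split => p /=; rewrite in_itv.
Qed.

Lemma limit_cdfE t r : 0 < t < 1 -> 0 < r ->
  oplus_cdf (haar_aa R) (haar_abs R) (1 - t)^-1 (Num.sqrt r) = limit_cdf t r.
Proof.
move=> t01 r0; have /andP[t0 t1] := t01.
have s0 : 0 < 1 - t by lra.
rewrite oplus_cdf_haar ?sqrtr_gt0//; last by rewrite invf_gt1//; lra.
rewrite /limit_cdf ltr_sqrt ?invr_gt0//; case: ifP => // re.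
have d := limit_cdf_den t01 (ltW re).
rewrite sqr_sqrtr ?(ltW r0)//.
have d0 : 1 - (1 - t) ^+ 2 * r != 0 by rewrite gt_eqF// (lt_le_trans t0 d).
by field; rewrite d0 gt_eqF.
Qed.

(** [is_oplus] gives closed disks and [is_sq] needs open ones; left continuity of [limit_cdf]
    bridges the gap. *)
Lemma limit_measure_disk t (rho nu : probability (R * R)%type R) r :
  0 < t < 1 -> limit_measures (1 - t)^-1 rho nu -> 0 < r ->
  nu (open_disk r) = (limit_cdf t r)%:E.
Proof.
move=> t01 [[_ rhoE] [_ nuE]] r0; rewrite nuE//.
have sr0 : 0 < Num.sqrt r by rewrite sqrtr_gt0.
have fin : rho (open_disk (Num.sqrt r)) \is a fin_num.
  by apply: fin_num_measure; apply: measurable_open_disk; exact: ltW.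
apply/eqP; rewrite eq_le; apply/andP; split.
  rewrite -limit_cdfE// -rhoE//; apply: le_measure; rewrite ?inE.
  - by apply: measurable_open_disk; exact: ltW.
  - exact: measurable_closed_disk.
  - by move=> p /= /ltW.
rewrite -(fineK fin) lee_fin; apply/ler_addgt0Pr => e e0.
have [r1 [r10 r1r _ G1]] := limit_cdf_left t01 r0 e0.
rewrite -lerBlDr; apply: le_trans G1 _.
have sr10 : 0 < Num.sqrt r1 by rewrite sqrtr_gt0.
rewrite -lee_fin fineK// -limit_cdfE// -rhoE//; apply: le_measure; rewrite ?inE.
- exact: measurable_closed_disk.
- by apply: measurable_open_disk; exact: ltW.
- move=> p /= h; apply: le_lt_trans h _.
  by rewrite !sqr_sqrtr ?ltW.
Qed.

End LimitCdf.

(** * Weights of the derivative and location of their maximal term *)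

Section KacDerivative.
Variable R : realType.
Implicit Types t r : R.

Definition deriv_order t n : nat := `|Num.ceil (t * n%:R)|%N.
Definition deriv_degree t n : nat := (n - deriv_order t n)%N.

Definition deriv_coef t n k : R :=
  ((1 - t) ^+ 2) ^+ (k + deriv_order t n) *
  ((k + deriv_order t n) ^_ (deriv_order t n))%:R.

Lemma deriv_order_bounds t n : 0 < t < 1 ->
  [/\ (deriv_order t n <= n)%N, t * n%:R <= (deriv_order t n)%:R &
      (deriv_order t n)%:R <= t * n%:R + 1].
Proof.
move=> /andP[t0 t1]; rewrite /deriv_order.
have n0 : 0 <= n%:R :> R by [].
have tn0 : 0 <= t * n%:R by rewrite mulr_ge0// ltW.
have /andP[c1 c2] := ceil_itv (t * n%:R).
have : Num.ceil (t * n%:R) <= n%:Z.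
  by rewrite ceil_le_int ler_piMl// ltW.
have : 0 <= Num.ceil (t * n%:R) by rewrite ceil_ge0; lra.
move: c1 c2; case: (Num.ceil _) => // k; rewrite intrD /= => c1 c2 _ kn.
by split => //; move: c1; rewrite mulrN1z pmulrn; lra.
Qed.

Lemma deriv_coef_gt0 t n k : 0 < t < 1 -> 0 < deriv_coef t n k.
Proof.
move=> /andP[t0 t1]; rewrite mulr_gt0//.
  by rewrite exprn_gt0// exprn_gt0// subr_gt0.
by rewrite ltr0n ffact_gt0 leq_addl.
Qed.

(** The ratio of consecutive weights, cleared of divisions; it decides where the terms stop
    increasing. *)
Lemma deriv_coefS t n k : deriv_coef t n k.+1 * k.+1%:R =
  deriv_coef t n k * (1 - t) ^+ 2 * (k.+1 + deriv_order t n)%:R.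
Proof.
rewrite /deriv_coef; set m := deriv_order t n.
have h : ((k.+1 + m) ^_ m * k.+1 = (k + m) ^_ m * (k.+1 + m))%N.
  have e1 := @ffact_fact (k + m) m (leq_addl _ _).
  have e2 := @ffact_fact (k.+1 + m) m (leq_addl _ _).
  rewrite addnK in e1; rewrite addnK [((k.+1 + m)`!)%N](factS (k + m)) -e1 factS in e2.
  apply/eqP; rewrite -(eqn_pmul2r (fact_gt0 k)) -mulnA e2 -addSn; apply/eqP.
  by rewrite mulnCA mulnA.
rewrite -[LHS]mulrA -natrM h natrM addSn exprS.
move: (_ ^_ _)%:R (k + m).+1%:R ((1 - t) ^+ 2) => a b c; ring.
Qed.

Lemma bin_le_exp2 n m : ('C(n, m) <= 2 ^ n)%N.
Proof.
elim: n m => [|n IH] [|m]; rewrite ?bin0n ?bin0 ?expn_gt0//.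
by rewrite binS expnS mul2n -addnn leq_add.
Qed.

(** The ratio to the weight of index 0 is a power of a number at most 1 times a binomial
    coefficient, hence [H = 2]. *)
Lemma deriv_coef_le t n k : 0 < t < 1 -> (k <= deriv_degree t n)%N ->
  deriv_coef t n k <= deriv_coef t n 0 * 2 ^+ n.
Proof.
move=> t01 kD; have /andP[t0 t1] := t01; have [mn _ _] := deriv_order_bounds n t01.
rewrite /deriv_coef add0n; set m := deriv_order t n in mn *.
have s0 : 0 < (1 - t) ^+ 2 by rewrite exprn_gt0// subr_gt0.
have s1 : (1 - t) ^+ 2 <= 1 by rewrite exprn_ile1//; lra.
have kmn : (k + m <= n)%N by rewrite -(subnK mn) leq_add2r.
rewrite ffactnn -bin_ffact natrM exprD -!mulrA.
have -> : (1 - t) ^+ 2 ^+ k * ((1 - t) ^+ 2 ^+ m * ('C(k + m, m)%:R * m`!%:R)) =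
  ((1 - t) ^+ 2 ^+ m * m`!%:R) * ((1 - t) ^+ 2 ^+ k * 'C(k + m, m)%:R) by ring.
have c0 : 0 < (1 - t) ^+ 2 ^+ m * m`!%:R.
  by apply: mulr_gt0; [rewrite exprn_gt0|rewrite ltr0n fact_gt0].
rewrite [leRHS]mulrA ler_pM2l//.
rewrite -[leRHS]mul1r; apply: ler_pM => //.
- by rewrite exprn_ge0// ltW.
- by rewrite exprn_ile1// ltW.
- rewrite -natrX ler_nat; apply: leq_trans (bin_le_exp2 _ _) _.
  by rewrite leq_exp2l.
Qed.

Lemma near_deriv_degree t : 0 < t < 1 ->
  \forall n \near \oo, (1 - t) / 2 * n%:R <= (deriv_degree t n)%:R.
Proof.
move=> t01; have /andP[t0 t1] := t01; near=> n.
have [mn m1 m2] := deriv_order_bounds n t01.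
rewrite /deriv_degree natrB//.
have h : 2 / (1 - t) <= n%:R by near: n; exact: nbhs_infty_ger.
rewrite ler_pdivrMr ?subr_gt0// in h; lra.
Unshelve. all: by end_near.
Qed.

(** Ratio test: with q = (1-t)^2 r, consecutive terms of index k and k+1 have ratio q(k+1+m)/(k+1),
    which crosses 1 at k+1 = mq/(1-q). The peak is within 1 of this value. *)
Lemma deriv_peak_cvg t r : 0 < t < 1 -> 0 < r -> r < (1 - t)^-1 ->
  (fun n => (peak (deriv_coef t n) (deriv_degree t n) r)%:R /
            (deriv_degree t n)%:R) @ \oo --> limit_cdf t r.
Proof.
move=> t01 r0 re; have /andP[t0 t1] := t01.
have dq := limit_cdf_den t01 (ltW re).
set q := (1 - t) ^+ 2 * r in dq.
have s0 : 0 < (1 - t) ^+ 2 by rewrite exprn_gt0// subr_gt0.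
have q0 : 0 < q by rewrite mulr_gt0.
have q1 : 0 < 1 - q by lra.
have GE : limit_cdf t r = t * q / ((1 - t) * (1 - q)).
  rewrite limit_cdf_closed// ?(ltW re)// -/q /q; field.
  by rewrite -/q subr_eq0 !gt_eqF//; lra.
have G1 : limit_cdf t r <= 1.
  rewrite GE ler_pdivrMr ?mulr_gt0//; last lra.
  by rewrite mul1r; lra.
(* Rounding [t * n] up to [m] moves the crossing point by at most [b] relative to the limit times
   [D]; [C] adds 1 for the integrality of the peak. *)
pose b := q / (1 - q) / (1 - t).
pose C := b + 1.
have b0 : 0 <= b by rewrite !divr_ge0//; lra.
have C0 : 0 < C by rewrite /C; lra.
apply/cvgrPdist_le => e e0.
near=> n.
have Dn : (1 - t) / 2 * n%:R <= (deriv_degree t n)%:R.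
  by near: n; exact: near_deriv_degree.
have n1 : 1 <= n%:R :> R by near: n; exact: nbhs_infty_ger.
have nC : C * (2 / (1 - t)) / e <= n%:R by near: n; exact: nbhs_infty_ger.
have [mn m1 m2] := deriv_order_bounds n t01.
set m := deriv_order t n in mn m1 m2.
set D := deriv_degree t n in Dn *.
have D0 : 0 < D%:R :> R.
  by apply: lt_le_trans Dn; rewrite mulr_gt0 ?divr_gt0//; lra.
have CD : C <= e * D%:R.
  rewrite ler_pdivrMr// mulrA ler_pdivrMr in nC; last lra.
  have := ler_wpM2l (ltW e0) Dn; nra.
have DE : D%:R = n%:R - m%:R :> R by rewrite /D /deriv_degree natrB.
set j := nat_of_ord (peak _ _ _).
have A0 k : 0 < deriv_coef t n k by exact: deriv_coef_gt0.
have jD : (j <= D)%N by rewrite -ltnS ltn_ord.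
have mx k : (k <= D)%N -> deriv_coef t n k * r ^+ k <= deriv_coef t n j * r ^+ j.
  by move=> kD; exact: le_max_term.
have regroup (a s c x : R) : a * s * c * (r * x) = a * x * (s * r * c) by ring.
have j_le : j%:R * (1 - q) <= m%:R * q.
  case jE : j => [|i]; first by rewrite mul0r mulr_ge0// ltW.
  have := mx i; rewrite jE => /(_ (ltnW _)) h.
  have {h} : deriv_coef t n i * r ^+ i <= deriv_coef t n i.+1 * r ^+ i.+1.
    by apply: h; rewrite -jE.
  have i0 : 0 < i.+1%:R :> R by rewrite ltr0n.
  rewrite -(ler_pM2r i0) -[leRHS]mulrA [r ^+ i.+1 * _]mulrC [leRHS]mulrA deriv_coefS -/m.
  rewrite [r ^+ i.+1]exprS regroup -/q.
  have c0 : 0 < deriv_coef t n i * r ^+ i by rewrite mulr_gt0 ?exprn_gt0.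
  by rewrite ler_pM2l// natrD; lra.
(* If the peak is the last index there is no next term to compare with, but then the quotient is 1,
   which is at least the limit. *)
have j_ge : (j = D :> nat) \/ m%:R * q <= (j%:R + 1) * (1 - q).
  have [jD'|jD'] := ltnP j D; last by left; apply/eqP; rewrite eqn_leq jD jD'.
  right; have := mx j.+1 jD'.
  have i0 : 0 < j.+1%:R :> R by rewrite ltr0n.
  rewrite -(ler_pM2r i0) -[leLHS]mulrA [r ^+ j.+1 * _]mulrC [leLHS]mulrA deriv_coefS -/m.
  rewrite [r ^+ j.+1]exprS regroup -/q.
  have c0 : 0 < deriv_coef t n j * r ^+ j by rewrite mulr_gt0 ?exprn_gt0.
  by rewrite ler_pM2l// natrD -[j.+1%:R]natr1; lra.
(* [GE] times [D], compared with [m q / (1 - q)] through [|m - t n| <= 1] *)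
have GD : limit_cdf t r * D%:R = t * q / ((1 - t) * (1 - q)) * D%:R by rewrite GE.
set g := limit_cdf t r in GD G1 *.
have tD : t * D%:R = (1 - t) * m%:R - (m%:R - t * n%:R) by rewrite DE; ring.
have gD1 : g * D%:R = m%:R * q / (1 - q) - q / (1 - q) / (1 - t) * (m%:R - t * n%:R).
  have -> : g * D%:R = t * D%:R * (q / ((1 - t) * (1 - q))) by rewrite GD; ring.
  by rewrite tD; field; rewrite !gt_eqF//; lra.
rewrite -/b in gD1.
have mt : 0 <= m%:R - t * n%:R <= 1 by apply/andP; split; lra.
have bm0 : 0 <= b * (m%:R - t * n%:R) by rewrite mulr_ge0//; lra.
have bm1 : b * (m%:R - t * n%:R) <= b by rewrite ler_piMr//; lra.
have j_le' : j%:R <= m%:R * q / (1 - q) by rewrite ler_pdivlMr.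
have e_le : (b + 1) <= e * D%:R by [].
rewrite ler_norml; apply/andP; split.
  rewrite lerNl opprB lerBlDr ler_pdivrMr// mulrDl; lra.
rewrite lerBlDr; have [jE|jge] := j_ge.
  by rewrite jE divff ?gt_eqF//; lra.
rewrite -ler_pdivrMr// in jge.
rewrite -lerBlDl ler_pdivlMr// mulrBl; lra.
Unshelve. all: by end_near.
Qed.

Lemma deriv_weighted (d : measure_display) (T : measurableType d) (Z : nat -> T -> R) t n w : 0 < t < 1 ->
  weighted (deriv_coef t n) (deriv_degree t n)
    ((Pn Z n w \Po (complex.real_complex R ((1 - t) ^+ 2) *: 'X))^`(deriv_order t n))
    (fun k => xi Z (k + deriv_order t n) w).
Proof.
move=> t01 k; have [mn _ _] := deriv_order_bounds n t01.
set s := (1 - t) ^+ 2; set m := deriv_order t n in mn *.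
have -> : Pn Z n w \Po (complex.real_complex R s *: 'X) =
    \poly_(i < n.+1) (xi Z i w * complex.real_complex R s ^+ i).
  rewrite poly_def /Pn rmorph_sum/=; apply: eq_bigr => i _.
  rewrite comp_polyM comp_polyC comp_Xn_poly exprZn mulrC -scalerAl mulrC.
  by rewrite mul_polyC scalerA mulrC.
rewrite coef_derivn coef_poly /deriv_degree -/m.
have -> : (m + k < n.+1)%N = (k <= n - m)%N by rewrite ltnS leq_subRL.
case: ifP => // _; last by rewrite mul0rn.
have -> : complex.real_complex R (deriv_coef t n k) =
    complex.real_complex R s ^+ (k + m) * ((k + m) ^_ m)%:R.
  by rewrite /deriv_coef -/m -/s rmorphM/= rmorphXn/= rmorph_nat.
rewrite [(m + k)%N]addnC -[LHS]mulr_natr.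
by rewrite mulrAC mulrC -!mulrA; congr (_ * _); rewrite mulrC.
Qed.

End KacDerivative.

Lemma weak_cvg_whp (R : realType) (d : measure_display) (T : measurableType d)
    (P : probability T R) (mu_int : nat -> T -> (R * R -> R) -> R)
    (nu : probability (R * R)%type R) :
  (forall f : R * R -> R, continuous f -> (exists M, forall p, `|f p| <= M) ->
    (fun p => mu_int p.1 p.2 f) @ whp P --> Rintegral nu setT f) ->
  weak_cvg_in_prob P mu_int nu.
Proof.
move=> h f cf bf e e0.
have /cvgrPdist_le/(_ _ e0) [A [mA A0]] := h f cf bf.
exists A; split => // n; split; first exact: (mA n).1.
move=> w /= ew; apply: (mA n).2 => /=.
by rewrite distrC => le_e; move: ew; rewrite ltNge le_e.
Qed.

Lemma weak_cvg_kac_deriv (R : realType) (d : measure_display) (T : measurableType d)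
    (P : probability T R) (Z : nat -> {RV P >-> R}) (t : R)
    (rho nu : probability (R * R)%type R) :
  (forall (n : nat) (A : set R), measurable A ->
     distribution P (Z n) A = normal_prob 0 (Num.sqrt (2^-1)) A) ->
  mutually_independent P (fun n => (Z n : T -> R)) ->
  0 < t < 1 -> limit_measures (1 - t)^-1 rho nu ->
  weak_cvg_in_prob P
    (fun n w => emp_root_int
       ((Pn (fun k => (Z k : T -> R)) n w \Po (complex.real_complex R ((1 - t) ^+ 2) *: 'X))
          ^`(deriv_order t n)))
    nu.
Proof.
move=> distZ indZ t01 lim; have /andP[t0 t1] := t01.
pose Q n w := (Pn (fun k => (Z k : T -> R)) n w \Po
  (complex.real_complex R ((1 - t) ^+ 2) *: 'X))^`(deriv_order t n).
have A0 n k : 0 < deriv_coef t n k by exact: deriv_coef_gt0.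
have Dm n : (deriv_degree t n + deriv_order t n)%N = n.
  by rewrite /deriv_degree subnK//; have [] := deriv_order_bounds n t01.
have AH n k : (k <= deriv_degree t n)%N -> deriv_coef t n k <= deriv_coef t n 0 * 2 ^+ n.
  exact: deriv_coef_le.
have H1 : 1 <= 2 :> R by rewrite ler1n.
have kappa0 : 0 < (1 - t) / 2 by rewrite divr_gt0// subr_gt0.
have Dk := near_deriv_degree t01.
have wQ n w : weighted (deriv_coef t n) (deriv_degree t n) (Q n w)
    (fun k => xi (fun k => (Z k : T -> R)) (k + deriv_order t n) w).
  exact: deriv_weighted.
have Hrot := rotation_good_whp distZ indZ A0 Dm AH H1 kappa0 Dk wQ.
have nuD r : 0 < r -> nu (open_disk r) = (limit_cdf t r)%:E.
  exact: limit_measure_disk lim.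
have Hrad : radial_good (whp P) (fun p => root_seq (Q p.1 p.2)) nu.
  move=> r r0; split; first exact: tame_disk_ind.
  rewrite Rintegral_disk_ind ?(ltW r0)// nuD//=.
  apply: (radial_cdf_whp distZ indZ A0 Dm AH H1 kappa0 Dk wQ (edge := (1 - t)^-1)) => //.
  - by move=> r' r'0 r'e; exact: deriv_peak_cvg.
  - by move=> r' e r'0 e0; exact: limit_cdf_left.
  - by move=> r' e r'0 r'e e0; exact: limit_cdf_right.
  - by move=> r'; exact: limit_cdf_edge.
have nu_rot : rot_invariant nu by case: lim => _ [].
apply: weak_cvg_whp => f cf [M fM].
have B0 : 0 < (1 - t)^-1 by rewrite invr_gt0 subr_gt0.
have nuB : nu (open_disk (1 - t)^-1) = 1%E by rewrite nuD// limit_cdf_edge.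
exact: (good_continuous nu_rot Hrad Hrot B0 nuB cf fM).2.
Qed.

(** * Existence of the limit measures *)

Section PolarMeasures.
Variable R : realType.
Implicit Types (a b c x theta r k v : R) (A E : set R).
Local Notation mu := (@lebesgue_measure R).

Lemma lebesgue_measure_shift c E : measurable E -> mu [set x | E (x + c)] = mu E.
Proof.
move=> mE.
have mc : measurable_fun setT ((fun x => x + c) : R -> measurableTypeR R).
  by apply: measurable_funD.
pose nu := pushforward mu ((fun x => x + c) : R -> measurableTypeR R).
suff : mu E = nu E by move=> ->.
apply: lebesgue_measure_unique => //= _ [[a b]] _ <-.
rewrite /nu /pushforward (_ : _ @^-1` _ = `]a - c, b - c]%classic); last first.
  by apply/seteqP; split => x /=; rewrite !in_itv/= ltrBlDr lerBrDr.
rewrite !lebesgue_measure_itv/= !lte_fin ltrD2r -!EFinD.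
by case: ifP => // _; congr EFin; ring.
Qed.

(** The right end is dropped, at no cost in measure, so that translates of the interval tile the
    line. *)
Lemma uniform_probE a b (ab : a < b) A : measurable A ->
  uniform_prob ab A = ((b - a)^-1%:E * mu (A `&` `[a, b[))%E.
Proof.
move=> mA; rewrite /uniform_prob integral_uniform_pdf.
rewrite (eq_integral (fun=> (b - a)^-1%:E)); last first.
  by move=> x; rewrite inE/= in_itv/= /uniform_pdf => -[_ ->].
rewrite integral_cst//=; last exact: measurableI.
congr (_ * _)%E; rewrite (_ : `[a, b] = `[a, b[ `|` [set b])%classic; last first.
  by rewrite setUitv1//= bnd_simp ltW.
rewrite setIUr; apply: measureU0 => //.
- exact: measurableI.
- exact: measurableI.
- apply/eqP; rewrite eq_le measure_ge0 andbT.
  rewrite -(lebesgue_measure_set1 b); apply: le_measure; rewrite ?inE//.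
  exact: measurableI.
Qed.

(** Both windows contain [c, p); the remaining pieces [0, c) and [p, c + p) differ by one period. *)
Lemma periodic_lebesgue_measure (p : R) c E : measurable E -> 0 <= c <= p ->
  (forall x, E (x + p) <-> E x) ->
  mu (E `&` `[c, c + p[) = mu (E `&` `[0, p[).
Proof.
move=> mE /andP[c0 cp] Ep.
have split3 x y z : x <= y -> y <= z ->
    mu (E `&` `[x, z[) = (mu (E `&` `[x, y[) + mu (E `&` `[y, z[))%E.
  move=> xy yz; rewrite -measureU//.
  - rewrite -setIUr; congr (mu (_ `&` _)); apply/seteqP; split => u /=.
      by rewrite !in_itv/=; case: (ltP u y) => uy /andP[-> ->]; [left|right].
    rewrite !in_itv/= => -[] /andP[h1 h2]; apply/andP; split => //.
      exact: lt_le_trans yz.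
    exact: le_trans h1.
  - exact: measurableI.
  - exact: measurableI.
  - rewrite -subset0 => u [[_ /=]]; rewrite !in_itv/= => /andP[_ h1] [_] /andP[h2 _].
    by move: h1; rewrite ltNge h2.
have p0 := le_trans c0 cp.
rewrite (split3 c p (c + p))//; last by rewrite lerDr.
rewrite (split3 0 c p)// addeC; congr (_ + _)%E.
rewrite -(@lebesgue_measure_shift p); last exact: measurableI.
congr (mu _); apply/seteqP; split => u /=; rewrite !in_itv/=.
  by move=> [/Ep Eu]; rewrite lerDr ltrD2r.
by move=> [/Ep Eu]; rewrite lerDr ltrD2r.
Qed.

Definition polar (g : R -> R) (p : R * R) : R * R :=
  (g p.1 * cos p.2, g p.1 * sin p.2).

Lemma measurable_polar g : measurable_fun setT g -> measurable_fun setT (polar g).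
Proof.
move=> mg; apply/measurable_fun_pairP; split => /=.
  apply: measurable_funM; first exact: measurableT_comp.
  by apply: measurableT_comp => //; apply: continuous_measurable_fun; exact: continuous_cos.
apply: measurable_funM; first exact: measurableT_comp.
by apply: measurableT_comp => //; apply: continuous_measurable_fun; exact: continuous_sin.
Qed.

Lemma polar_norm g p : (polar g p).1 ^+ 2 + (polar g p).2 ^+ 2 = g p.1 ^+ 2.
Proof. by rewrite /polar/= !exprMn -mulrDr cos2Dsin2 mulr1. Qed.

(** Reduces an arbitrary angle to the range that [periodic_lebesgue_measure] accepts. *)
Lemma rot_angle theta : exists2 c, 0 <= c <= pi *+ 2 & Defs.rot theta = Defs.rot c.
Proof.
have cb : -1 <= cos theta <= 1 by rewrite cos_geN1 cos_le1.
have a0 := acos_ge0 cb; have api := acos_lepi cb.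
have ca : cos (acos (cos theta)) = cos theta by rewrite acosK// in_itv/=.
have sa : sin (acos (cos theta)) = `|sin theta|.
  by rewrite sin_acos// -sin2cos2 sqrtr_sqr.
set a := acos _ in a0 api ca sa.
have [s0|s0] := leP 0 (sin theta).
  exists a; first by rewrite a0 mulr2n/=; lra.
  by rewrite /Defs.rot ca sa ger0_norm.
exists (- a + pi *+ 2); first by rewrite mulr2n; apply/andP; split; lra.
by rewrite /Defs.rot cosD2pi sinD2pi cosN sinN ca sa ltr0_norm// opprK.
Qed.

Lemma rot_polar g c p : Defs.rot c (polar g p) = polar g (p.1, p.2 + c).
Proof. by rewrite /Defs.rot /polar/= cosD sinD; congr pair; ring. Qed.

Lemma pi2_gt0 : 0 < pi *+ 2 :> R.
Proof. by rewrite mulrn_wgt0// pi_gt0. Qed.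

(** The law of [polar g] under independent uniform variables on [0, 1] and [0, 2 pi]: a rotation
    translates the angle, and disks see only the radius. Both kinds of disks are recorded, as
    [is_oplus] is stated with closed and [is_sq] with open ones. *)
Lemma radial_probability (g : R -> R) : measurable_fun setT g ->
  (forall v, 0 <= g v) ->
  exists rho : probability (R * R)%type R, [/\ rot_invariant rho,
    (forall r, 0 < r -> rho (open_disk r) = uniform_prob (@ltr01 R) [set v | g v < r]) &
    (forall r, 0 < r -> rho (closed_disk r) = uniform_prob (@ltr01 R) [set v | g v <= r])].
Proof.
move=> mg g0.
have mp : measurable_fun [set: measurableTypeR R * measurableTypeR R] (polar g : _ -> (R * R)%type).
  exact: measurable_polar mg.
pose X : {mfun (measurableTypeR R * measurableTypeR R)%type >-> (R * R)%type} :=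
  HB.pack (polar g) (isMeasurableFun.Build _ _ _ _ _ mp).
pose U := [the probability _ _ of uniform_prob (@ltr01 R)].
pose V := [the probability _ _ of uniform_prob pi2_gt0].
pose W := [the probability _ _ of (U \x V)%E].
have WE (B : set R) : measurable B -> W (B `*` setT) = uniform_prob (@ltr01 R) B.
  move=> mB; transitivity (U B * V setT)%E; first exact: product_measure1E.
  by rewrite probability_setT mule1.
exists (distribution W X); split.
- move=> theta A mA; have [c c2pi ->] := rot_angle theta.
  rewrite /distribution /pushforward /W /product_measure1; apply: eq_integral => v _ /=.
  pose E := [set a | A (polar g (v, a))].
  have mE : measurable E.
    rewrite -[E]setTI; apply: (measurableT_comp mp _ measurableT mA).
    exact: measurable_pair1.
  have Eper a : E (a + pi *+ 2) <-> E a.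
    by rewrite /E/= /polar/= cosD2pi sinD2pi.
  rewrite [X in V X = _](_ : _ = [set a | E (a + c)]); last first.
    by apply/seteqP; split => a; rewrite /xsection/= inE/= rot_polar.
  rewrite [X in _ = V X](_ : _ = E); last first.
    by apply/seteqP; split => a; rewrite /xsection/= inE.
  have mEc : measurable [set a | E (a + c)].
    rewrite -[X in measurable X]setTI.
    have m : measurable_fun setT (fun a => a + c) by apply: measurable_funD.
    exact: m.
  have VE (B : set R) : measurable B ->
      V B = ((pi *+ 2 - 0)^-1%:E * mu (B `&` `[0, pi *+ 2[)%R)%E.
    exact: uniform_probE.
  rewrite !VE//; congr (_ * _)%E.
  rewrite -(periodic_lebesgue_measure mE c2pi Eper).
  rewrite -[RHS](@lebesgue_measure_shift c); last exact: measurableI.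
  congr (mu _); apply/seteqP; split => u /=; rewrite !in_itv/=.
    by rewrite lerDr addrC ltrD2l.
  by rewrite lerDr addrC ltrD2l.
- move=> r r0; rewrite -WE; last first.
    rewrite -[X in measurable X]setTI -/(g @^-1` [set v | v < r]).
    by apply: mg => //; rewrite -set_itvNyo; exact: measurable_itv.
  rewrite /distribution /pushforward/=; congr (W _).
  apply/seteqP; split => p /=; rewrite /open_disk/= polar_norm ltr_pXn2r ?nnegrE ?(ltW r0)//.
  by case.
- move=> r r0; rewrite -WE; last first.
    rewrite -[X in measurable X]setTI -/(g @^-1` [set v | v <= r]).
    by apply: mg => //; rewrite -set_itvNyc; exact: measurable_itv.
  rewrite /distribution /pushforward/=; congr (W _).
  apply/seteqP; split => p /=; rewrite /closed_disk/= polar_norm ler_pXn2r ?nnegrE ?(ltW r0)//.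
  by case.
Qed.

(* Quantile function of the radial part of [limit_measures]: the inverse of
   [r |-> (k - 1) r^2 / (k^2 - r^2)]. *)
Definition oplus_quantile k v : R := k * Num.sqrt (`|v| / (k - 1 + `|v|)).

Lemma measurable_oplus_quantile k : measurable_fun setT (oplus_quantile k).
Proof.
apply: measurable_funM => //; apply: measurableT_comp; first exact: measurable_sqrt.
apply: measurable_funM => //; apply: measurableT_comp; first exact: measurable_inv.
by apply: measurable_funD.
Qed.

Lemma oplus_quantile_le k v r : 1 < k -> 0 <= v -> 0 < r ->
  (oplus_quantile k v <= r) = (k ^+ 2 * v <= r ^+ 2 * (k - 1 + v)).
Proof.
move=> k1 v0 r0; rewrite /oplus_quantile ger0_norm//.
have d0 : 0 < k - 1 + v by lra.
have q0 : 0 <= v / (k - 1 + v) by rewrite divr_ge0// ltW.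
have k0 : 0 <= k by lra.
rewrite -[LHS](@ler_pXn2r _ 2) ?nnegrE ?mulr_ge0 ?sqrtr_ge0 ?(ltW r0)//.
by rewrite exprMn sqr_sqrtr// mulrA ler_pdivrMr.
Qed.

(** Inverse transform: within [0, 1) the event is the interval from 0 to the value of the
    distribution function, or everything past the edge. *)
Lemma uniform_oplus_quantile k r : 1 < k -> 0 < r ->
  uniform_prob (@ltr01 R) [set v | oplus_quantile k v <= r] =
  (oplus_cdf (haar_aa R) (haar_abs R) k r)%:E.
Proof.
move=> k1 r0; rewrite oplus_cdf_haar//.
have k0 : 0 < k by lra.
have sk0 : 0 <= Num.sqrt k by exact: sqrtr_ge0.
have skk : Num.sqrt k ^+ 2 = k by rewrite sqr_sqrtr// ltW.
have mq : measurable [set v | oplus_quantile k v <= r].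
  rewrite -[X in measurable X]setTI -/(oplus_quantile k @^-1` [set v | v <= r]).
  by apply: measurable_oplus_quantile => //; rewrite -set_itvNyc; exact: measurable_itv.
have [rk|rk] := ltP r (Num.sqrt k).
  have r2k : r ^+ 2 < k by rewrite -skk ltr_pXn2r ?nnegrE// ltW.
  set X := r ^+ 2 in r2k *; have X0 : 0 < X by rewrite exprn_gt0.
  have den : 0 < k ^+ 2 - X by rewrite expr2; nra.
  have F0 : 0 <= (k - 1) * X / (k ^+ 2 - X).
    by rewrite divr_ge0// ?mulr_ge0// ltW//; lra.
  have F1 : (k - 1) * X / (k ^+ 2 - X) < 1 by rewrite ltr_pdivrMr// mul1r expr2; nra.
  rewrite uniform_probE// subr0 invr1 mul1e.
  rewrite (_ : _ `&` _ = `[0, (k - 1) * X / (k ^+ 2 - X)]%classic); last first.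
    apply/seteqP; split => v /=; rewrite !in_itv/=.
      move=> [h /andP[v0 v1]]; move: h; rewrite oplus_quantile_le// -/X => h.
      by rewrite v0/= ler_pdivlMr//; lra.
    move=> /andP[v0 h]; rewrite v0 (le_lt_trans h F1); split => //.
    by rewrite oplus_quantile_le// -/X; move: h; rewrite ler_pdivlMr//; lra.
  rewrite lebesgue_measure_itv/= lte_fin -EFinD subr0.
  by case: ltP => // F0'; congr EFin; apply/eqP; rewrite eq_le F0 F0'.
have r2k : k <= r ^+ 2 by rewrite -skk ler_pXn2r ?nnegrE// ltW.
rewrite uniform_probE// subr0 invr1 mul1e.
rewrite (_ : _ `&` _ = `[0, 1[%classic); last first.
  apply/seteqP; split => v /=; rewrite !in_itv/=; first by case.
  move=> /andP[v0 v1]; rewrite v0 v1; split => //.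
  rewrite oplus_quantile_le//.
  have h1 : k * (k - 1 + v) <= r ^+ 2 * (k - 1 + v) by rewrite ler_wpM2r//; lra.
  apply: le_trans h1; rewrite expr2 -mulrA ler_pM2l//.
  by nra.
by rewrite lebesgue_measure_itv/= lte_fin ltr01 -EFinD subr0.
Qed.

(** Squaring the radial quantile realizes [sq], since q^2 < r is equivalent to q < sqrt r. *)
Lemma limit_measures_exist k : 1 < k -> exists rho nu, @limit_measures R k rho nu.
Proof.
move=> k1; have mq := measurable_oplus_quantile k.
have q0 v : 0 <= oplus_quantile k v by rewrite mulr_ge0 ?sqrtr_ge0//; lra.
have [rho [rho_rot rhoo rhoc]] := radial_probability mq q0.
have mq2 : measurable_fun setT (fun v => oplus_quantile k v ^+ 2) by exact: measurable_funX.
have q20 v : 0 <= oplus_quantile k v ^+ 2 by rewrite exprn_ge0.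
have [nu [nu_rot nuo _]] := radial_probability mq2 q20.
exists rho, nu; split; split => // r r0; first by rewrite rhoc// uniform_oplus_quantile.
rewrite nuo// rhoo ?sqrtr_gt0//; congr (uniform_prob _ _).
apply/funext => v /=; congr is_true.
by rewrite -[in LHS](sqr_sqrtr (ltW r0)) ltr_pXn2r ?nnegrE ?sqrtr_ge0.
Qed.

End PolarMeasures.

Theorem theorem1p2 (R : realType) (d : measure_display) (T : measurableType d)
    (P : probability T R) (Z : nat -> {RV P >-> R}) (t : R) :
  (* Z_0, Z_1, ... iid N(0, 1/2); xi_k = Z_{2k} + i Z_{2k+1} iid standard complex Gaussian *)
  (forall (n : nat) (A : set R), measurable A ->
     distribution P (Z n) A = normal_prob 0 (Num.sqrt (2^-1)) A) ->
  mutually_independent P (fun n => (Z n : T -> R)) ->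
  0 < t < 1 ->
  (exists rho nu, limit_measures (1 - t)^-1 rho nu) /\
  (forall rho nu : probability (R * R)%type R,
    limit_measures (1 - t)^-1 rho nu ->
    weak_cvg_in_prob P
      (fun n w => emp_root_int
         ((Pn (fun k => (Z k : T -> R)) n w \Po (complex.real_complex R ((1 - t) ^+ 2) *: 'X))
            ^`(`|Num.ceil (t * n%:R)|%N)))
      nu).
Proof.
move=> distZ indZ t01; split; last by move=> rho nu; exact: weak_cvg_kac_deriv.
have /andP[t0 t1] := t01; apply: limit_measures_exist.
by rewrite invf_gt1 ?subr_gt0// ltrBlDr ltrDl.
Qed.
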